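(* If $\Phi:\mathbb{S}^1\to\mathbb{S}^1$ is a $C^2$ expanding circle map, then $\Phi_\#:\mathscr{P}(\mathbb{S}^1)\to\mathscr{P}(\mathbb{S}^1)$ has a G\^ateaux derivative at its unique invariant absolutely continuous probability measure $\rho\lambda$, whose adjoint operator in $L^2_0(\rho\lambda)$ is $u\mapsto\Phi'\,u\circ\Phi$.
   Context: $\mathbb{S}^1=\mathbb{R}/\mathbb{Z}$, $\lambda$ is the Lebesgue probability measure, $\mathscr{P}(\mathbb{S}^1)$ is the set of Borel probability measures on $\mathbb{S}^1$ and $\Phi_\#$ is push-forward of measures. A $C^2$ map $\Phi:\mathbb{S}^1\to\mathbb{S}^1$ is expanding if $|\Phi'|>1$ everywhere; such a map is a self-covering and has a unique absolutely continuous invariant probability measure $\rho\lambda$, whose density $\rho$ is positive and $C^1$ (known facts). $\mathrm{W}$ is the quadratic Wasserstein metric: $\mathrm{W}(\mu,\nu)=\left(\inf_\Pi\int|x-y|^2\,\Pi(dx\,dy)\right)^{1/2}$, infimum over probability measures $\Pi$ on $\mathbb{S}^1\times\mathbb{S}^1$ with marginals $\mu,\nu$. Vector fields on $\mathbb{S}^1$ are identified with functions $v:\mathbb{S}^1\to\mathbb{R}$. For $\mu\in\mathscr{P}(\mathbb{S}^1)$, $L^2_0(\mu)$ is the closure in $L^2(\mu)$ of the set of derivatives of smooth functions $\mathbb{S}^1\to\mathbb{R}$. Here $L^2_0(\rho\lambda)=\{v\in L^2(\rho\lambda):\int v\,d\lambda=0\}$ (mean zero with respect to $\lambda$), with the inner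 product of $L^2(\rho\lambda)$. For $v\in L^2(\mu)$, $\mu+v:=(\mathrm{Id}+v)_\#\mu$. A map $f:\mathscr{P}(\mathbb{S}^1)\to\mathscr{P}(\mathbb{S}^1)$ has G\^ateaux derivative $L$ at an atomless $\mu$ if $f(\mu)$ has no atom, $L:L^2_0(\mu)\to L^2_0(f(\mu))$ is a continuous linear operator, and for all $v\in L^2_0(\mu)$ one has $\mathrm{W}(f(\mu+tv),f(\mu)+tLv)=o(t)$ as $t\to0$. *)

(* Defs.v *)
From HB Require Import structures.
From mathcomp Require Import all_boot all_order all_algebra.
From mathcomp Require Import ring_quotient.
From mathcomp Require Import all_classical all_reals all_analysis.
From mathcomp Require Import measurable_realfun.
From mathcomp Require Import lra.

Set Implicit Arguments.
Unset Strict Implicit.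
Unset Printing Implicit Defensive.

Import Order.TTheory GRing.Theory Num.Theory.
Import numFieldNormedType.Exports.

Local Open Scope classical_set_scope.
Local Open Scope ring_scope.

Definition int_sub (R : realType) : zmodClosed R :=
  GRing.ZmodClosed.clone R (@Num.int_num_subdef R) _.

(* The additive group R / Z, with the quotient topology and its Borel
   sigma-algebra. *)
Definition circle (R : realType) : Type :=
  Quotient.quot (int_sub R).

HB.instance Definition _ (R : realType) := GRing.Zmodule.copy (circle R)
  (Quotient.quot (int_sub R)).

Definition circle_pi (R : realType) (x : R) : circle R :=
  (\pi_(Quotient.quot (int_sub R)) x)%qT.

Definition circle_open (R : realType) (U : set (circle R)) : Prop :=
  open (@circle_pi R @^-1` U).

Section circle_instances.
Variable R : realType.

Let circle_openT : @circle_open R setT.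
Proof. by rewrite /circle_open preimage_setT; exact: openT. Qed.

Let circle_openI (A B : set (circle R)) :
  circle_open A -> circle_open B -> circle_open (A `&` B).
Proof. by rewrite /circle_open preimage_setI; exact: openI. Qed.

Let circle_open_bigU (I : Type) (f : I -> set (circle R)) :
  (forall i, circle_open (f i)) -> circle_open (\bigcup_i f i).
Proof.
by move=> fo; rewrite /circle_open preimage_bigcup; apply: bigcup_open => i _;
   exact: fo.
Qed.

HB.instance Definition _ := @isOpenTopological.Build (circle R)
  (@circle_open R) circle_openT circle_openI circle_open_bigU.

HB.instance Definition _ := isPointed.Build (circle R) 0.

HB.instance Definition _ := @isMeasurable.Build
  (sigma_display (@open (circle R))) (circle R) <<s @open (circle R) >>
  (@sigma_algebra0 _ setT (@open (circle R))) (@sigma_algebraC _ _)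
  (@sigma_algebra_bigcup _ setT (@open (circle R))).

End circle_instances.

Lemma circle_measurable_fun d (T : measurableType d) (R : realType)
    (f : T -> circle R) :
  (forall U, open U -> measurable (f @^-1` U)) -> measurable_fun setT f.
Proof.
move=> mf; apply: (measurability (@open (circle R))) => //.
by move=> _ [U oU <-]; rewrite setTI; exact: mf.
Qed.

Lemma measurable_circle_pi (R : realType) :
  measurable_fun setT (@circle_pi R).
Proof. by apply: circle_measurable_fun => U oU; exact: open_measurable. Qed.

Lemma continuous_circle_measurable (R : realType) (f : circle R -> circle R) :
  continuous f -> measurable_fun setT f.
Proof.
move=> /continuousP cf; apply: circle_measurable_fun => U oU.
by apply: sub_sigma_algebra; exact: cf.
Qed.

Lemma circle_piD (R : realType) (x y : R) :
  circle_pi (x + y) = circle_pi x + circle_pi y.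
Proof. by rewrite /circle_pi /= (@Quotient.pi_add R (int_sub R)). Qed.

Lemma circle_pi_eq (R : realType) (x y : R) :
  (circle_pi x = circle_pi y) <-> (x - y \is a Num.int).
Proof.
split=> [/eqP|xy].
  by rewrite /circle_pi -(@Quotient.idealrBE R (int_sub R)).
by apply/eqP; rewrite /circle_pi -(@Quotient.idealrBE R (int_sub R)).
Qed.

(* The representative in [-1/2, 1/2[, i.e. the signed distance to 0. *)
Definition circle_repr (R : realType) (x : circle R) : R :=
  let r := repr (x : Quotient.quot (int_sub R)) in
  r - (Num.floor (r + 2^-1))%:~R.

Lemma circle_reprK (R : realType) :
  cancel (@circle_repr R) (@circle_pi R).
Proof.
move=> x; rewrite -[RHS](@reprK _ (Quotient.quot (int_sub R)) x).
apply/circle_pi_eq; rewrite /circle_repr addrAC subrr add0r.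
by rewrite rpredN intr_int.
Qed.

Lemma circle_repr_itv (R : realType) (x : circle R) :
  - 2^-1 <= circle_repr x < 2^-1.
Proof.
rewrite /circle_repr; set r := repr _.
have /andP[] := floor_itv (r + 2^-1); rewrite intrD.
set n := (Num.floor _)%:~R; move=> n1 n2; apply/andP; split; lra.
Qed.

Lemma measurable_circle_repr (R : realType) :
  measurable_fun setT (@circle_repr R).
Proof.
move=> _; apply: (measurability _ (RGenOInfty.measurableE R)) => //.
move=> /= _ [_ [a ->] <-]; rewrite setTI.
have [ha|ha] := ltP a (- 2^-1).
  rewrite (_ : _ @^-1` _ = setT); first exact: measurableT.
  apply/seteqP; split=> // x _ /=; rewrite in_itv /= andbT.
  by case/andP: (circle_repr_itv x) => h _; exact: lt_le_trans h.
apply: sub_sigma_algebra.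
rewrite /open /= /circle_open.
rewrite (_ : _ @^-1` _ =
    \bigcup_(n : int) `]a + n%:~R, 2^-1 + n%:~R[%classic); last first.
  apply/seteqP; split=> [x /=|x [n _] /=]; rewrite !in_itv /= ?andbT.
    set y := circle_repr _ => ay.
    have /circle_pi_eq /intrP[m xy] : circle_pi x = circle_pi y.
      by rewrite circle_reprK.
    exists m => //=; rewrite in_itv /= -xy.
    by have /andP[_] := circle_repr_itv (circle_pi x); rewrite -/y; lra.
  set y := circle_repr _ => /andP[xa xb].
  have /circle_pi_eq /intrP[m xy] : circle_pi x = circle_pi y.
    by rewrite circle_reprK.
  have /andP[y1 y2] : - 2^-1 <= y < 2^-1 by exact: circle_repr_itv.
  suff mn : m = n by move: xy; rewrite mn; lra.
  have h1 : (m%:~R : R) < (n + 1)%:~R by rewrite intrD; lra.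
  have h2 : (n%:~R : R) < (m + 1)%:~R by rewrite intrD; lra.
  by move: h1 h2; rewrite !ltr_int !ltzD1 => h1 h2; apply/eqP; rewrite eq_le h1.
by apply: bigcup_open => n _; exact: interval_open.
Qed.

Definition circle_dist (R : realType) (x y : circle R) : R :=
  `|circle_repr (x - y)|.

Definition circle_lebesgue (R : realType) (A : set (circle R)) : \bar R :=
  lebesgue_measure (@circle_pi R @^-1` A `&` `[0, 1[).

Section circle_lebesgue_measure.
Variable R : realType.
Local Notation lambda := (@circle_lebesgue R).

Let mitv01 : measurable (`[0, 1[%classic : set R).
Proof. exact: measurable_itv. Qed.

Let lambda0 : lambda set0 = 0%E.
Proof. by rewrite /circle_lebesgue preimage_set0 set0I measure0. Qed.

Let lambda_ge0 A : (0 <= lambda A)%E.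
Proof. exact: measure_ge0. Qed.

Let lambda_sigma_additive : semi_sigma_additive lambda.
Proof.
have mpi : measurable_fun [set: measurableTypeR R] (@circle_pi R).
  exact: measurable_circle_pi.
have h := @measure_semi_sigma_additive _ _ _
  (pushforward (mrestr lebesgue_measure mitv01) (@circle_pi R)).
exact: (h mpi).
Qed.

HB.instance Definition _ := isMeasure.Build _ _ _ lambda
  lambda0 lambda_ge0 lambda_sigma_additive.

Let lambdaT : lambda setT = 1%E.
Proof.
rewrite /circle_lebesgue preimage_setT setTI lebesgue_measure_itv /=.
by rewrite lte_fin ltr01 -EFinB subr0.
Qed.

HB.instance Definition _ :=
  Measure_isProbability.Build _ _ _ lambda lambdaT.

End circle_lebesgue_measure.

(* Differential calculus on the circle: real functions and circle maps are
   read in the charts given by translates of circle_pi and circle_repr. *)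
Definition fun_chart (R : realType) (g : circle R -> R) (x : circle R)
  : R -> R := fun h => g (x + circle_pi h).

Definition map_chart (R : realType) (F : circle R -> circle R) (x : circle R)
  : R -> R := fun h => circle_repr (F (x + circle_pi h) - F x).

Definition fun_derivable (R : realType) (g : circle R -> R) : Prop :=
  forall x, derivable (fun_chart g x) 0 1.

Definition fun_deriv (R : realType) (g : circle R -> R) : circle R -> R :=
  fun x => derive1 (fun_chart g x) 0.

Definition map_derivable (R : realType) (F : circle R -> circle R) : Prop :=
  forall x, derivable (map_chart F x) 0 1.

Definition map_deriv (R : realType) (F : circle R -> circle R) : circle R -> R :=
  fun x => derive1 (map_chart F x) 0.

Definition C1_fun (R : realType) (g : circle R -> R) : Prop :=
  fun_derivable g /\ continuous (fun_deriv g).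

Definition smooth_fun (R : realType) (g : circle R -> R) : Prop :=
  forall n, fun_derivable (iter n (@fun_deriv R) g).

Definition C2_map (R : realType) (F : circle R -> circle R) : Prop :=
  [/\ continuous F, map_derivable F & C1_fun (map_deriv F)].

Definition expanding (R : realType) (F : circle R -> circle R) : Prop :=
  forall x, 1 < `|map_deriv F x|.

Definition push (R : realType) (F : circle R -> circle R)
    (mF : measurable_fun setT F) (mu : probability (circle R) R)
  : probability (circle R) R :=
  distribution mu (mfun_Sub (mem_set mF)).

Lemma C2_map_measurable (R : realType) (F : circle R -> circle R) :
  C2_map F -> measurable_fun setT F.
Proof. by case=> cF _ _; exact: continuous_circle_measurable. Qed.

Lemma measurable_shift (R : realType) (v : {mfun circle R >-> R}) :
  measurable_fun setT (fun x : circle R => x + circle_pi (v x)).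
Proof.
rewrite (_ : (fun x => _) =
    @circle_pi R \o (@circle_repr R \+ v)); last first.
  by apply/funext => x /=; rewrite circle_piD circle_reprK.
apply: measurableT_comp; first exact: measurable_circle_pi.
by apply: measurable_funD => //; exact: measurable_circle_repr.
Qed.

(* The measure written mu + v in optimal transport: (Id + v)_# mu. *)
Definition shift (R : realType) (mu : probability (circle R) R)
    (v : {mfun circle R >-> R}) : probability (circle R) R :=
  push (measurable_shift v) mu.

Definition atomless (R : realType) (mu : probability (circle R) R) : Prop :=
  forall x, mu [set x] = 0%E.

(* Measures are functions on all sets, hence the restriction to measurable
   ones when they are compared. *)
Definition coupling (R : realType) (mu nu : probability (circle R) R)
  : set (probability (circle R * circle R)%type R) :=
  [set P | forall A, measurable A ->
     P (A `*` setT) = mu A /\ P (setT `*` A) = nu A].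

Definition wasserstein2 (R : realType) (mu nu : probability (circle R) R) : R :=
  Num.sqrt (fine (ereal_inf
    [set (\int[P]_z (circle_dist z.1 z.2 ^+ 2)%:E)%E | P in coupling mu nu])).

(* Elements of L^2(mu) are represented by measurable functions. *)
Definition L2 (R : realType) (mu : probability (circle R) R)
  : set {mfun circle R >-> R} := [set v | (v : circle R -> R) \in Lfun mu 2%:E].

Definition L2_dist (R : realType) (mu : probability (circle R) R)
    (u v : {mfun circle R >-> R}) : \bar R :=
  'N[mu]_2%:E [EFin \o (u - v)].

Definition L2_inner (R : realType) (mu : probability (circle R) R)
    (u v : {mfun circle R >-> R}) : R := \int[mu]_x (u x * v x).

Definition L20 (R : realType) (mu : probability (circle R) R)
  : set {mfun circle R >-> R} :=
  [set v | L2 mu v /\ forall e : R, 0 < e ->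
     exists g, smooth_fun g /\
     exists2 w : {mfun circle R >-> R}, w =1 fun_deriv g &
       (L2_dist mu v w < e%:E)%E].

(* Linearity holds modulo a.e. equality; continuity at each point for the L^2
   pseudo-distances makes L compatible with a.e. equality. *)
Definition L20_continuous_linear (R : realType)
    (mu nu : probability (circle R) R)
    (L : {mfun circle R >-> R} -> {mfun circle R >-> R}) : Prop :=
  [/\ forall v, L20 mu v -> L20 nu (L v),
      forall (a : R) u v, L20 mu u -> L20 mu v ->
        (L (a *: u + v) : circle R -> R) = a *: L u + L v %[ae nu] &
      forall u, L20 mu u -> forall e : R, 0 < e -> exists2 d : R, 0 < d &
        forall v, L20 mu v ->
          (L2_dist mu u v < d%:E)%E -> (L2_dist nu (L u) (L v) < e%:E)%E].

Definition is_adjoint (R : realType) (mu nu : probability (circle R) R)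
    (L A : {mfun circle R >-> R} -> {mfun circle R >-> R}) : Prop :=
  (forall u, L20 nu u -> L20 mu (A u)) /\
  forall u v, L20 nu u -> L20 mu v ->
    L2_inner nu (L v) u = L2_inner mu v (A u).

Definition is_gateaux_derivative (R : realType)
    (f : probability (circle R) R -> probability (circle R) R)
    (mu : probability (circle R) R)
    (L : {mfun circle R >-> R} -> {mfun circle R >-> R}) : Prop :=
  [/\ atomless mu, atomless (f mu), L20_continuous_linear mu (f mu) L &
      forall v, L20 mu v ->
        (fun t : R => wasserstein2 (f (shift mu (t *: v)))
                                   (shift (f mu) (t *: L v)) / t)
        @ 0^' --> 0].

Definition has_density (R : realType) (mu : probability (circle R) R)
    (rho : circle R -> R) : Prop :=
  forall A, measurable A ->
    mu A = (\int[@circle_lebesgue R]_(x in A) (rho x)%:E)%E.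

Definition invariant_measure (R : realType) (F : circle R -> circle R)
    (mu : probability (circle R) R) : Prop :=
  forall A, measurable A -> mu (F @^-1` A) = mu A.

(* Main.v *)
(* Write [mu = rho lambda]. The candidate derivative sends [v] to the conditional
   expectation of [Phi' v] given [Phi] under [mu], corrected by the multiple of
   [1 / rho] (which spans the orthocomplement of [L^2_0(mu)]: it is the field of
   the rotation flow preserving [mu]) that makes it mean-zero for [lambda]; its
   adjoint is [u |-> Phi' u(Phi)].

   For smooth [w], put [eta = Phi' w - (L w)(Phi)].  Let [U] be uniform on [0, 1[,
   [X = gamma(U)] of law [mu], and [H] the inverse of the increasing lift
   [E = Phi o gamma], of degree [d].  Perturb [H] into [Psi_t = H - t theta],
   where [theta = H' eta] is chosen so that [theta(y) + ... + theta(y + d - 1)] is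
   constant.  Then [Z = Psi_t^-1(U)] has again law [mu], and a Taylor expansion
   gives [Phi(X + t w(X)) = Z + t (L w)(Z) + O(t^2)] uniformly.  So the pair
   [(Phi(X + t v(X)), Z + t (L v)(Z))] couples the two measures, and replacing [v]
   by a smooth [w] costs only [O(t |v - w|)] in [L^2], as [X] and [Z] have law
   [mu]. No triangle inequality for the Wasserstein distance is needed. *)
Require Import Defs.
From HB Require Import structures.
From mathcomp Require Import all_boot all_order all_algebra.
From mathcomp Require Import all_classical all_reals all_analysis.
From mathcomp Require Import measurable_realfun ring lra zify.
Import Order.TTheory GRing.Theory Num.Theory.
Import numFieldNormedType.Exports.
Local Open Scope classical_set_scope.
Local Open Scope ring_scope.
Set Implicit Arguments.
Unset Strict Implicit.
Unset Printing Implicit Defensive.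

(** * The circle R / Z *)

(** The obstacle is that [Phi] is many-to-one. The mass arriving near a point comes from [d]
    branches, each displaced at its own rate [Phi' w], whereas the target moves all of it at the
    single rate [L w]. Pairing [Phi(X + t w(X))] with [Phi(X) + t (L w)(Phi(X))] thus leaves an
    error of order [t]. The perturbation of [H] absorbs it: the base point [Z] is put ahead of
    [Phi(X)] by about [t eta], which moves mass of order [t] along each branch. The mass of an arc
    is the sum over the branches of the increments of [Psi_t], so [mu] is preserved exactly when the
    perturbations of the branches cancel in increments. This allows the sum of [theta] to be a
    nonzero constant, and that constant is the multiple of [1 / rho] removed to make [L w]
    mean-zero. The quantitative part uses Lipschitz functions and quadratic Taylor bounds
    throughout. With [rho] of class C^1 and [Phi] of class C^2, [L w] cannot be expected to be
    smooth even for smooth [w]; a Lipschitz [theta] is enough to keep [Psi_t] increasing for small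
    [t] and the error quadratic. *)

Section circle_basics.
Variable R : realType.
Implicit Types (x y : R) (p q : circle R).

Lemma circle_piB x y : circle_pi (x - y) = circle_pi x - circle_pi y.
Proof.
by apply/(canRL (addrK _)); rewrite -circle_piD subrK.
Qed.

Lemma circle_pi0 : circle_pi (0 : R) = 0.
Proof. by rewrite -(subrr (0 : R)) circle_piB subrr. Qed.

Lemma circle_piDz x (n : int) : circle_pi (x + n%:~R) = circle_pi x.
Proof. by apply/circle_pi_eq; rewrite addrAC subrr add0r intr_int. Qed.

Lemma circle_piDn x (n : nat) : circle_pi (x + n%:R) = circle_pi x.
Proof. exact: (circle_piDz x n). Qed.

Lemma circle_repr_pi x : exists n : int, circle_repr (circle_pi x) = x + n%:~R.
Proof.
have /circle_pi_eq /intrP[n h] : circle_pi (circle_repr (circle_pi x)) = circle_pi x.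
  by rewrite circle_reprK.
by exists n; rewrite -h addrC subrK.
Qed.

Lemma circle_repr_small x : - 2^-1 <= x < 2^-1 -> circle_repr (circle_pi x) = x.
Proof.
have [n h] := circle_repr_pi x; have := circle_repr_itv (circle_pi x).
rewrite h => /andP[h1 h2] /andP[h3 h4].
suff -> : n = 0 by rewrite addr0.
have a1 : (n%:~R : R) < 1%:~R by lra.
have a2 : ((-1)%:~R : R) < n%:~R by rewrite intrN; lra.
by move: a1 a2; rewrite !ltr_int; lia.
Qed.

Lemma le_circle_repr_pi x : `|circle_repr (circle_pi x)| <= `|x|.
Proof.
have [/circle_repr_small -> //|h] := boolP (- 2^-1 <= x < 2^-1).
have /andP[h1 h2] := circle_repr_itv (circle_pi x).
apply: (@le_trans _ _ 2^-1); first by rewrite ler_norml; apply/andP; split; lra.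
rewrite leNgt; apply: contra h; rewrite ltr_norml => /andP[h3 h4].
by apply/andP; split; lra.
Qed.

Lemma circle_dist_pi x y : circle_dist (circle_pi x) (circle_pi y) <= `|x - y|.
Proof. by rewrite /circle_dist -circle_piB le_circle_repr_pi. Qed.

Lemma circle_dist_ge0 p q : 0 <= circle_dist p q.
Proof. exact: normr_ge0. Qed.

Lemma circle_distD p q (r : circle R) : circle_dist p r <= circle_dist p q + circle_dist q r.
Proof.
rewrite /circle_dist; set a := circle_repr (p - q); set b := circle_repr (q - r).
have -> : p - r = circle_pi (a + b) by rewrite circle_piD !circle_reprK addrA subrK.
exact: le_trans (le_circle_repr_pi _) (ler_normD _ _).
Qed.

(** [circle_repr] is not odd: the antipode of 0 is its own opposite and has representative -1/2.
    Hence the detour through two inequalities. *)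
Lemma circle_distC p q : circle_dist p q = circle_dist q p.
Proof.
suff H (a b : circle R) : circle_dist a b <= circle_dist b a by apply/eqP; rewrite eq_le !H.
rewrite /circle_dist; set c := circle_repr (b - a).
have -> : a - b = circle_pi (- c).
  by rewrite -[- c]add0r circle_piB circle_pi0 circle_reprK sub0r opprB.
by rewrite -[leRHS]normrN le_circle_repr_pi.
Qed.

Lemma circle_distxx p : circle_dist p p = 0.
Proof. by rewrite /circle_dist subrr -circle_pi0 circle_repr_small ?normr0//; lra. Qed.

Lemma circle_dist_eq0 p q : circle_dist p q = 0 -> p = q.
Proof.
move/normr0_eq0 => h; apply/eqP; rewrite -subr_eq0; apply/eqP.
by rewrite -(circle_reprK (p - q)) h circle_pi0.
Qed.

Lemma continuous_circle_pi : continuous (@circle_pi R).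
Proof. by apply/continuousP => A. Qed.

Lemma measurable_fun_pi_repr d (T : measurableType d) (f : R -> T) :
  measurable_fun setT f -> measurable_fun setT (f \o @circle_repr R).
Proof. by move=> mf; apply: measurableT_comp mf (@measurable_circle_repr R). Qed.

Lemma measurable_fun_circle d (T : measurableType d) (f : circle R -> T) :
  measurable_fun setT (f \o @circle_pi R) -> measurable_fun setT f.
Proof.
move=> /measurable_fun_pi_repr; congr measurable_fun.
by apply/funext => p /=; rewrite circle_reprK.
Qed.

(** The passage between the line and the circle: a 1-periodic [f] descends to [f \o circle_repr],
    and composing with [circle_pi] gives [f] back. *)
Lemma periodic_circle_repr (T : Type) (f : R -> T) :
  (forall x, f (x + 1) = f x) -> forall x, f (circle_repr (circle_pi x)) = f x.
Proof.
move=> f1.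
have fn (n : nat) y : f (y + n%:R) = f y.
  elim: n y => [|n IH] y; first by rewrite addr0.
  by rewrite -addn1 natrD addrA f1 IH.
move=> x; have [[n|n] ->] := circle_repr_pi x; first exact: fn.
by rewrite NegzE intrN -[LHS](fn n.+1) subrK.
Qed.

End circle_basics.

(** * Transfer of integrals *)

Import HBNNSimple.

(** One statement for push-forwards ([g = 1]), densities and changes of variables: [nu] is the image
    under [phi] of the measure [g m] on [D]. The proof goes through simple functions and monotone
    convergence. *)
Lemma integral_transfer d1 d2 (T1 : measurableType d1) (T2 : measurableType d2)
    (R : realType) (m : {measure set T1 -> \bar R}) (nu : {measure set T2 -> \bar R})
    (phi : T1 -> T2) (D : set T1) (g : T1 -> R) :
  measurable D -> measurable_fun setT phi -> measurable_fun setT g ->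
  (forall x, 0 <= g x) ->
  (forall A, measurable A -> nu A = \int[m]_(x in D `&` phi @^-1` A) (g x)%:E)%E ->
  forall f : T2 -> \bar R, (forall y, 0 <= f y)%E -> measurable_fun setT f ->
  (\int[nu]_y f y = \int[m]_(x in D) (f (phi x) * (g x)%:E))%E.
Proof.
move=> mD mphi mg g0 nuE f f0 mf.
pose h := nnsfun_approx measurableT mf.
have mhphi n : measurable_fun D (EFin \o h n \o phi).
  apply: measurable_funTS; apply/measurable_EFinP.
  exact: measurableT_comp.
have mEg : measurable_fun D (EFin \o g) by apply: measurable_funTS; exact/measurable_EFinP.
have -> : (\int[nu]_y f y = limn (fun n => \int[nu]_x (EFin \o h n) x))%E.
  have fE x : f x = limn (fun n => (EFin \o h n) x).
    by apply/esym/cvg_lim => //; exact: cvg_nnsfun_approx.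
  under eq_integral do rewrite fE.
  apply: monotone_convergence => //.
  - by move=> n; apply/measurable_EFinP.
  - by move=> n x Ex //=; rewrite lee_fin.
  - by move=> x Ex a b ab; rewrite lee_fin; exact/lefP/nd_nnsfun_approx.
have -> : (\int[m]_(x in D) (f (phi x) * (g x)%:E) =
    limn (fun n => \int[m]_(x in D) ((EFin \o h n) (phi x) * (g x)%:E)))%E.
  have fg x : (f (phi x) * (g x)%:E =
      limn (fun n => (EFin \o h n) (phi x) * (g x)%:E))%E.
    apply/esym/cvg_lim => //; apply: cvgeZr => //.
    by apply: cvg_nnsfun_approx => //.
  under eq_integral do rewrite fg.
  apply: monotone_convergence => //.
  - by move=> n; apply: emeasurable_funM => //; exact: mhphi.
  - by move=> n x Ex /=; rewrite mule_ge0 ?lee_fin.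
  - move=> x Ex a b ab /=; rewrite lee_wpmul2r ?lee_fin//.
    exact/lefP/nd_nnsfun_approx.
congr (limn _); apply/funext => n.
transitivity (\int[nu]_x (\sum_(y \in range (h n)) (y * \1_(h n @^-1` [set y]) x)%:E))%E.
  by apply: eq_integral => t tE; rewrite /= fimfunE -fsumEFin.
rewrite ge0_integral_fsum//; last 2 first.
  - move=> r; apply/measurable_EFinP.
    by apply: measurable_funM => //.
  - by move=> r x _; exact: nnfun_muleindic_ge0.
transitivity (\int[m]_(x in D) (\sum_(y \in range (h n))
    (y * \1_(h n @^-1` [set y]) (phi x))%:E * (g x)%:E))%E; last first.
  apply: eq_integral => x xE.
  rewrite -ge0_mule_fsuml => [|y]; last exact: nnfun_muleindic_ge0.
  by rewrite fsumEFin // -(fimfunE _ (phi x)).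
have mi r : measurable_fun setT (fun x => \1_(h n @^-1` [set r]) (phi x) : R).
  by apply: measurableT_comp => //; exact: measurable_indic.
rewrite ge0_integral_fsum//; last 2 first.
  - move=> y; apply: emeasurable_funM => //; apply: measurable_funTS.
    by apply/measurable_EFinP; exact: measurable_funM.
  - by move=> y x _; rewrite mule_ge0 ?lee_fin//; exact: (nnfun_muleindic_ge0 (h n) y (phi x)).
apply: eq_fsbigr => r /[!inE] -[x0 _ x0r].
have r0 : 0 <= r by rewrite -x0r.
have mr : measurable (h n @^-1` [set r]) by [].
have mir' : measurable_fun setT (fun y => (\1_(h n @^-1` [set r]) y : R)%:E).
  by apply/measurable_EFinP; exact: measurable_indic.
under eq_integral do rewrite EFinM.
rewrite ge0_integralZl//.
rewrite integral_indic// setIT nuE//.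
under [RHS]eq_integral do rewrite EFinM -muleA.
rewrite ge0_integralZl//; last 2 first.
  - apply: emeasurable_funM => //; apply: measurable_funTS; exact/measurable_EFinP.
  - by move=> x _; rewrite mule_ge0// lee_fin.
congr (_ * _)%E.
rewrite integral_mkcondr; apply: eq_integral => x _.
rewrite /patch/= indicE /= (_ : (x \in _) = (phi x \in h n @^-1` [set r])).
  by case: (_ \in _); rewrite ?mul1e ?mul0e.
by apply/idP/idP; rewrite !inE.
Qed.

(** * Calculus on the line *)

Section real_calculus.
Variable R : realType.
Implicit Types (f g : R -> R) (a b c x y : R).
Local Notation leb := (@lebesgue_measure R).

Lemma derive_continuous f df : (forall x, is_derive x 1 f (df x)) -> continuous f.
Proof. by move=> fd x; exact/differentiable_continuous/derivable1_diffP. Qed.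

Lemma mean_value f df a b : (forall x, is_derive x 1 f (df x)) ->
  a <= b -> exists2 c, a <= c <= b & f b - f a = df c * (b - a).
Proof.
move=> fd ab.
have [|c cab e] := @MVT_segment R f df a b ab.
  by apply: continuous_subspaceT; exact: derive_continuous fd.
by exists c => //; move: cab; rewrite in_itv.
Qed.

Lemma mean_value_pair f df x y : (forall x, is_derive x 1 f (df x)) ->
  exists2 c, `|c - x| <= `|y - x| & f y - f x = df c * (y - x).
Proof.
move=> fd; have [xy|/ltW yx] := leP x y.
  have [c /andP[xc cy] e] := mean_value fd xy.
  by exists c => //; rewrite !ger0_norm; lra.
have [c /andP[xc cy] e] := mean_value fd yx.
exists c => //; first by rewrite !ler0_norm; lra.
by rewrite -opprB e; lra.
Qed.

(** The integral of [f] from 0 to [x], written with a lower end [- a] to the left of both points so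
    that the sign of [x] does not matter. *)
Let prim f (a x : R) : R :=
  \int[leb]_(t in `[- a, x]) f t - \int[leb]_(t in `[- a, 0]) f t.

Let prim_derive f a x : continuous f -> - a < x -> is_derive x 1 (prim f a) (f x).
Proof.
move=> cf ax; have xx1 : x < x + 1 by rewrite ltrDl.
have fi : leb.-integrable `[- a, x + 1] (EFin \o f).
  apply: continuous_compact_integrable; first exact: segment_compact.
  exact: continuous_subspaceT.
have [h1 h2] := continuous_FTC1_closed xx1 fi ax (cf x).
rewrite -[f x]subr0; apply: is_deriveB; apply: DeriveDef => //.
by rewrite -derive1E.
Qed.

Let prim_eq f a b x : continuous f -> 0 < a -> a <= b -> - a < x ->
  prim f a x = prim f b x.
Proof.
move=> cf a0 ab ax.
have d y : - a < y -> is_derive y 1 (prim f a - prim f b) 0.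
  move=> ay; rewrite -[0](subrr (f y)); apply: is_deriveB; apply: prim_derive => //.
  lra.
have d0 : (prim f a - prim f b) 0 = 0.
  by change (prim f a 0 - prim f b 0 = 0); rewrite /prim !subrr.
suff : prim f a x - prim f b x = 0 by move=> /eqP; rewrite subr_eq0 => /eqP.
change ((prim f a - prim f b) x = 0); rewrite -d0.
have H u v : - a < u -> u <= v -> (prim f a - prim f b) u = (prim f a - prim f b) v.
  move=> au uv.
  have [||c _] := @MVT_segment R (prim f a - prim f b) (fun=> 0) u v uv.
  - by move=> y; rewrite in_itv /= => /andP[uy _]; apply: d; lra.
  - apply: derivable_within_continuous => y; rewrite in_itv /= => /andP[uy _].
    have : - a < y by lra.
    by move/d => [].
  - by rewrite mul0r => /eqP; rewrite subr_eq0 => /eqP.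
by have [/H -> //|/ltW h] := leP x 0; rewrite (H 0 x)//; lra.
Qed.

Lemma antiderivative f : continuous f ->
  exists2 F, F 0 = 0 & forall x, is_derive x (1 : R) F (f x).
Proof.
move=> cf; exists (fun x => prim f (`|x| + 1) x); first by rewrite /prim subrr.
move=> x.
(* The value does not depend on the lower end, so near [x] the moving end can be frozen at
   [|x| + 2], where the fundamental theorem of calculus applies. *)
apply: (@near_eq_is_derive _ _ _ (prim f (`|x| + 2))) => //; last first.
  by apply: prim_derive => //; have := ler_norm (- x); rewrite normrN; lra.
near=> y.
have yx : `|y - x| < 1.
  by near: y; apply: cvgr_distC_lt => //; exact: cvg_id.
have := ler_norm (- y); rewrite normrN => h1.
have h2 := normr_ge0 y; have h3 := lerB_dist y x.
 by apply/esym/prim_eq => //; lra.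
Unshelve. all: by end_near. Qed.

Lemma integral_derive f F a b : continuous f ->
  (forall x, is_derive x (1 : R) F (f x)) -> a <= b ->
  (\int[leb]_(x in `[a, b[) (f x)%:E = (F b - F a)%:E)%E.
Proof.
move=> cf dF; rewrite le_eqVlt => /predU1P[->|ab].
  by rewrite set_itv_ge ?bnd_simp ?ltxx// integral_set0 subrr.
rewrite integral_itv_bndo_bndc; last first.
  apply/measurable_EFinP/measurable_funTS.
  exact: continuous_measurable_fun.
rewrite (@continuous_FTC2 _ f F)//.
- exact: continuous_subspaceT.
- have cF := derive_continuous dF; split.
  + by move=> x _; case: (dF x).
  + exact/cvg_at_right_filter/cF.
  + exact/cvg_at_left_filter/cF.
- by move=> x _; rewrite derive1E; case: (dF x).
Qed.

End real_calculus.

(** * Lipschitz, bounded and periodic functions; quadratic Taylor bounds *)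

Section lipschitz.
Variable R : realType.
Implicit Types (f g : R -> R) (a b c x y : R).

Definition lipschitz_fun f :=
  exists2 C : R, 0 <= C & forall x y, `|f x - f y| <= C * `|x - y|.
Definition bounded_function f := exists2 C : R, 0 <= C & forall x, `|f x| <= C.

Lemma lipschitz_continuous f : lipschitz_fun f -> continuous f.
Proof.
move=> [C C0 lf] x; apply/cvgrPdist_lt => e e0; near=> y.
apply: (le_lt_trans (lf x y)).
apply: (@le_lt_trans _ _ ((C + 1) * `|x - y|)); first by rewrite ler_wpM2r//; lra.
rewrite mulrC -ltr_pdivlMr; last lra.
near: y; apply: cvgr_dist_lt; last by rewrite divr_gt0//; lra.
exact: cvg_id.
Unshelve. all: by end_near. Qed.

Lemma lipschitz_cst c : lipschitz_fun (fun=> c).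
Proof. by exists 0 => // x y; rewrite subrr normr0 mul0r. Qed.

Lemma lipschitzD f g : lipschitz_fun f -> lipschitz_fun g ->
  lipschitz_fun (fun x => f x + g x).
Proof.
move=> [C C0 lf] [D D0 lg]; exists (C + D) => [|x y]; first exact: addr_ge0.
rewrite (_ : _ - _ = (f x - f y) + (g x - g y)); last lra.
by rewrite mulrDl (le_trans (ler_normD _ _))// lerD.
Qed.

Lemma lipschitzM f g : lipschitz_fun f -> bounded_function f ->
  lipschitz_fun g -> bounded_function g -> lipschitz_fun (fun x => f x * g x).
Proof.
move=> [C C0 lf] [B B0 bf] [D D0 lg] [E E0 bg].
exists (C * E + B * D) => [|x y]; first by rewrite addr_ge0// mulr_ge0.
rewrite (_ : _ - _ = (f x - f y) * g x + f y * (g x - g y)); last lra.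
rewrite (le_trans (ler_normD _ _))// !normrM mulrDl lerD//.
  by rewrite mulrAC ler_pM.
by rewrite -mulrA ler_pM.
Qed.

Lemma lipschitzZ c f : lipschitz_fun f -> lipschitz_fun (fun x => c * f x).
Proof.
move=> [C C0 lf]; exists (`|c| * C) => [|x y]; first by rewrite mulr_ge0.
by rewrite -mulrBr normrM -mulrA ler_wpM2l.
Qed.

Lemma lipschitz_comp f g : lipschitz_fun f -> lipschitz_fun g ->
  lipschitz_fun (fun x => f (g x)).
Proof.
move=> [C C0 lf] [D D0 lg]; exists (C * D) => [|x y]; first exact: mulr_ge0.
by rewrite (le_trans (lf _ _))// -mulrA ler_wpM2l.
Qed.

Lemma lipschitz_shift f c : lipschitz_fun f -> lipschitz_fun (fun x => f (x + c)).
Proof.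
move=> [C C0 lf]; exists C => // x y; rewrite (le_trans (lf _ _))//.
by rewrite opprD addrACA subrr addr0.
Qed.

Lemma lipschitzV f c : 0 < c -> (forall x, c <= `|f x|) -> lipschitz_fun f ->
  lipschitz_fun (fun x => (f x)^-1).
Proof.
move=> c0 cf [C C0 lf]; exists (C / c ^+ 2) => [|x y].
  by rewrite divr_ge0// sqr_ge0.
have fx z : f z != 0 by rewrite -normr_gt0 (lt_le_trans c0).
rewrite (_ : _ - _ = - (f x - f y) * ((f x)^-1 * (f y)^-1)); last first.
  by field; rewrite !fx.
rewrite normrM normrN mulrAC ler_pM// -invfM normfV lef_pV2 ?posrE ?exprn_gt0//.
  by rewrite normrM expr2 ler_pM// ltW.
by rewrite normr_gt0 mulf_neq0.
Qed.

Lemma lipschitz_sum n (f : nat -> R -> R) : (forall i, lipschitz_fun (f i)) ->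
  lipschitz_fun (fun x => \sum_(i < n) f i x).
Proof.
move=> lf; elim: n => [|n IH].
  by under eq_fun do rewrite big_ord0; exact: lipschitz_cst.
under eq_fun do rewrite big_ord_recr /=.
exact: lipschitzD.
Qed.

Lemma bounded_function_cst c : bounded_function (fun=> c).
Proof. by exists `|c|. Qed.

Lemma boundedD f g : bounded_function f -> bounded_function g ->
  bounded_function (fun x => f x + g x).
Proof.
move=> [C C0 bf] [D D0 bg]; exists (C + D) => [|x]; first exact: addr_ge0.
by rewrite (le_trans (ler_normD _ _))// lerD.
Qed.

Lemma boundedM f g : bounded_function f -> bounded_function g ->
  bounded_function (fun x => f x * g x).
Proof.
move=> [C C0 bf] [D D0 bg]; exists (C * D) => [|x]; first exact: mulr_ge0.
by rewrite normrM ler_pM.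
Qed.

Lemma boundedV f c : 0 < c -> (forall x, c <= `|f x|) ->
  bounded_function (fun x => (f x)^-1).
Proof.
move=> c0 cf; exists c^-1 => [|x]; first by rewrite invr_ge0 ltW.
by rewrite normfV lef_pV2 ?posrE// (lt_le_trans c0).
Qed.

Lemma bounded_comp f g : bounded_function f -> bounded_function (fun x => f (g x)).
Proof. by move=> [C C0 bf]; exists C. Qed.

Lemma bounded_sum n (f : nat -> R -> R) : (forall i, bounded_function (f i)) ->
  bounded_function (fun x => \sum_(i < n) f i x).
Proof.
move=> lf; elim: n => [|n IH].
  by under eq_fun do rewrite big_ord0; exact: bounded_function_cst.
under eq_fun do rewrite big_ord_recr /=.
exact: boundedD.
Qed.

Lemma periodic_values f : (forall x, f (x + 1) = f x) ->
  forall x, exists2 y, 0 <= y <= 1 & f x = f y.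
Proof.
move=> f1 x.
have fn (n : nat) y : f (y + n%:R) = f y.
  elim: n y => [|n IH] y; first by rewrite addr0.
  by rewrite -addn1 natrD addrA f1 IH.
have fz (n : int) y : f (y + n%:~R) = f y.
  case: n => n; first exact: fn.
  by rewrite NegzE intrN -[LHS](fn n.+1) subrK.
exists (x - (Num.floor x)%:~R); last by rewrite -intrN fz.
have /andP[h1] := floor_itv x; rewrite intrD => h2; apply/andP; split; lra.
Qed.

Lemma periodic_bounded f : (forall x, f (x + 1) = f x) -> continuous f ->
  bounded_function f.
Proof.
move=> f1 cf.
have cn : {within `[0 : R, 1], continuous (fun x => `|f x|)}.
  apply: continuous_subspaceT => x; apply: continuous_comp; first exact: cf.
  exact: norm_continuous.
have [c _ cm] := EVT_max ler01 cn.
exists `|f c| => // x; have [y y01 ->] := periodic_values f1 x.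
by apply: cm; rewrite in_itv.
Qed.

Lemma periodic_gt0_lbound f : (forall x, f (x + 1) = f x) -> continuous f ->
  (forall x, 0 < f x) -> exists2 c, 0 < c & forall x, c <= f x.
Proof.
move=> f1 cf f0.
have [c _ cm] := EVT_min ler01 (continuous_subspaceT (A := `[0 : R, 1]) cf).
exists (f c) => // x; have [y y01 ->] := periodic_values f1 x.
by apply: cm; rewrite in_itv.
Qed.

Lemma derive_bounded_lipschitz f df : (forall x, is_derive x 1 f (df x)) ->
  bounded_function df -> lipschitz_fun f.
Proof.
move=> fd [C C0 bd]; exists C => // x y.
have [c _ ->] := mean_value_pair y x fd.
by rewrite normrM ler_wpM2r.
Qed.

(** The order hypothesis makes such an [f] increasing; it is then a bijection of the line whose
    inverse is of the same kind. *)
Definition bilipschitz f := exists c C : R, [/\ 0 < c, 0 < C &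
  forall x y, x <= y -> c * (y - x) <= f y - f x <= C * (y - x)].

Lemma bilipschitz_lip f : bilipschitz f -> lipschitz_fun f.
Proof.
move=> [c [C [c0 C0 h]]]; exists C => [|x y]; first exact: ltW.
wlog yx : x y / y <= x.
  by move=> H; have [/H //|/ltW/H] := leP y x; rewrite distrC (distrC y).
have /andP[h1 h2] := h _ _ yx.
rewrite !ger0_norm ?subr_ge0//.
rewrite -subr_ge0 (le_trans _ h1)// mulr_ge0 ?subr_ge0// ltW//.
Qed.

Lemma bilipschitz_lt f x y : bilipschitz f -> x < y -> f x < f y.
Proof.
move=> [c [C [c0 _ h]]] xy; have /andP[h1 _] := h _ _ (ltW xy).
by rewrite -subr_gt0 (lt_le_trans _ h1)// mulr_gt0// subr_gt0.
Qed.

Lemma bilipschitz_ltE f x y : bilipschitz f -> (f x < f y) = (x < y).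
Proof.
move=> bf; apply/idP/idP; last exact: bilipschitz_lt.
by apply: contraTT; rewrite -!leNgt le_eqVlt => /predU1P[->//|/(bilipschitz_lt bf)/ltW].
Qed.

Lemma bilipschitz_leE f x y : bilipschitz f -> (f x <= f y) = (x <= y).
Proof. by move=> bf; rewrite !leNgt bilipschitz_ltE. Qed.

Lemma bilipschitz_inverse f : bilipschitz f ->
  exists g, [/\ cancel f g, cancel g f & bilipschitz g].
Proof.
move=> bf; have [c [C [c0 C0 h]]] := bf.
have cf := lipschitz_continuous (bilipschitz_lip bf).
have ex y : exists x, f x = y.
  (* The lower slope [c] forces [f (- M) <= y <= f M]. *)
  pose M := `|y - f 0| / c.
  have M0 : 0 <= M by rewrite divr_ge0 ?normr_ge0// ltW.
  have cM : c * M = `|y - f 0| by rewrite /M mulrC divfK// gt_eqF.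
  have /andP[h1 _] := h _ _ M0.
  have NM0 : - M <= 0 by lra.
  have /andP[h2 _] := h _ _ NM0.
  have := ler_norm (y - f 0); have := ler_norm (- (y - f 0)); rewrite normrN => h3 h4.
  have yl : f (- M) <= y <= f M by apply/andP; split; lra.
  have MM : - M <= M by lra.
  have [||x _ <-] := @IVT R f (- M) M y MM; last by exists x.
    exact: continuous_subspaceT.
  have fM : f (- M) <= f M by case/andP: yl; exact: le_trans.
  by rewrite (min_idPl fM) (max_idPr fM).
pose g y := sval (cid (ex y)).
have gK : cancel g f by move=> y; rewrite /g; case: cid.
have fK : cancel f g.
  move=> x; apply/eqP; rewrite eq_le -(bilipschitz_leE _ _ bf) gK lexx.
  by rewrite -(bilipschitz_leE _ _ bf) gK lexx.
exists g; split => //; exists C^-1, c^-1; split; rewrite ?invr_gt0// => x y xy.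
have gxy : g x <= g y by rewrite -(bilipschitz_leE _ _ bf) !gK.
have := h _ _ gxy; rewrite !gK => /andP[h1 h2].
by rewrite ler_pdivrMl// h2 ler_pdivlMl.
Qed.

Lemma derive_bilipschitz f df c C : (forall x, is_derive x 1 f (df x)) ->
  0 < c -> (forall x, c <= df x <= C) -> bilipschitz f.
Proof.
move=> fd c0 h; have C0 : 0 < C.
  by have /andP[h1 h2] := h 0; rewrite (lt_le_trans c0)// (le_trans h1).
exists c, C; split => // x y xy.
have [z _ ->] := mean_value fd xy; have /andP[h1 h2] := h z.
by rewrite !ler_wpM2r ?subr_ge0.
Qed.

(** A uniform form of class C^(1,1). It is the form in which the O(t^2) estimates use
    differentiability, and it passes to inverse functions by algebra alone. *)
Definition has_lip_derive f df := exists2 C, 0 <= C &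
  forall x y, `|f y - f x - df x * (y - x)| <= C * (y - x) ^+ 2.

Lemma derive_has_lip_derive f df : (forall x, is_derive x 1 f (df x)) ->
  lipschitz_fun df -> has_lip_derive f df.
Proof.
move=> fd [C C0 ld]; exists C => // x y.
have [z zx ->] := mean_value_pair x y fd.
rewrite -mulrBl normrM -real_normK ?num_real// expr2 mulrA.
by rewrite ler_wpM2r// (le_trans (ld _ _))// ler_wpM2l.
Qed.

Lemma has_lip_derive_is_derive f df x : has_lip_derive f df ->
  is_derive x (1 : R) f (df x).
Proof.
move=> [C C0 h].
suff H : h^-1 *: (f (h *: (1 : R) + x) - f x) @[h --> 0^'] --> df x.
  by apply: DeriveDef; [apply/cvg_ex; exists (df x)|exact/cvg_lim].
apply/cvgrPdist_lt => e e0; near=> t.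
have t0 : t != 0 by near: t; exact: nbhs_dnbhs_neq.
have := h x (t *: 1 + x); rewrite addrK [t *: 1]mulr1 => {}h.
have te : `|t| < e / (C + 1).
  near: t; apply/dnbhs0_lt; rewrite divr_gt0//; lra.
rewrite distrC (_ : _ - _ = t^-1 * (f (t + x) - f x - df x * t)); last first.
  by rewrite mulrBr mulrCA mulVf// mulr1.
rewrite normrM normfV ltr_pdivrMl ?normr_gt0//.
apply: (le_lt_trans h); rewrite -real_normK ?num_real// expr2 mulrA mulrC.
rewrite ltr_pM2l ?normr_gt0//.
apply: (@le_lt_trans _ _ ((C + 1) * `|t|)); first by rewrite ler_wpM2r//; lra.
by rewrite mulrC -ltr_pdivlMr//; lra.
Unshelve. all: by end_near. Qed.

(** The Taylor remainder of [g] between [x] and [y] is [- (df (g x))^-1] times that of [f] between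
    [g x] and [g y]. *)
Lemma has_lip_derive_inverse f df g c : has_lip_derive f df -> 0 < c ->
  (forall x, c <= df x) -> cancel g f -> lipschitz_fun g ->
  has_lip_derive g (fun y => (df (g y))^-1).
Proof.
move=> [C C0 hf] c0 hc gK [E E0 lg].
exists (c^-1 * (C * E ^+ 2)) => [|x y].
  by rewrite !mulr_ge0 ?invr_ge0 ?sqr_ge0// ltW.
have d0 : 0 < df (g x) by exact: lt_le_trans (hc _).
rewrite (_ : _ - _ = - ((df (g x))^-1 * (f (g y) - f (g x) - df (g x) * (g y - g x)))); last first.
  by rewrite !gK; field; rewrite gt_eqF.
rewrite normrN normrM -mulrA ler_pM//.
  by rewrite gtr0_norm ?invr_gt0// lef_pV2 ?posrE.
rewrite (le_trans (hf _ _))// -mulrA ler_wpM2l//.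
rewrite -exprMn -[leLHS]real_normK ?num_real// -[leRHS]real_normK ?num_real//.
by rewrite lerXn2r ?nnegrE// normrM (ger0_norm E0).
Qed.

End lipschitz.

(** * Lebesgue measure and periodic sets *)

(** The absolute value makes this a measure for every measurable [g], so that the measure instance
    carries no sign hypothesis. *)
Definition density d (T : measurableType d) (R : realType)
    (m : {measure set T -> \bar R}) (g : T -> R) (A : set T) : \bar R :=
  (\int[m]_(x in A) `|g x|%:E)%E.

Section density.
Context d (T : measurableType d) (R : realType) (m : {measure set T -> \bar R})
  (g : T -> R) (mg : measurable_fun setT g).
Local Notation dm := (density m g).

Let dm0 : dm set0 = 0%E. Proof. exact: integral_set0. Qed.

Let dm_ge0 A : (0 <= dm A)%E.
Proof. by apply: integral_ge0 => x _; rewrite lee_fin. Qed.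

Let dm_sigma : semi_sigma_additive dm.
Proof.
move=> F mF tF mUF; rewrite [X in _ --> X](_ : _ =
    (\sum_(i <oo) dm (F i))%E); last first.
  rewrite [LHS]ge0_integral_bigcup//=.
  by apply: measurable_funTS; apply/measurable_EFinP; exact: measurableT_comp.
by apply: is_cvg_nneseries => n _ _; exact: dm_ge0.
Qed.

HB.instance Definition _ := isMeasure.Build _ _ _ dm dm0 dm_ge0 dm_sigma.
Definition density_measure : {measure set T -> \bar R} := dm.
End density.

Definition image_measure d1 d2 (T1 : measurableType d1) (T2 : measurableType d2)
    (R : realType) (m : {measure set T1 -> \bar R}) (f : T1 -> T2)
    (mf : measurable_fun setT f) : {measure set T2 -> \bar R} :=
  measure_function_pushforward__canonical__measure_function_Measure m mf.

Section lebesgue_periodic.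
Variable R : realType.
Implicit Types (a b c s x y : R).
Local Notation leb := (@lebesgue_measure R).

(** By uniqueness of Lebesgue measure: the image under [f] of the measure with density [df] gives
    []a, b]] the mass [f (g b) - f (g a) = b - a]. *)
Lemma lebesgue_change_of_variables (f df : R -> R) (B : set R) :
  bilipschitz f -> (forall x, is_derive x 1 f (df x)) -> continuous df ->
  (forall x, 0 <= df x) -> measurable B ->
  leb B = (\int[leb]_(x in f @^-1` B) (df x)%:E)%E.
Proof.
move=> bf fd cdf df0 mB.
have [g [fK gK bg]] := bilipschitz_inverse bf.
have mdf : measurable_fun [set: measurableTypeR R] df by exact: continuous_measurable_fun.
have mf : measurable_fun [set: measurableTypeR R]
    (f : measurableTypeR R -> measurableTypeR R).
  by apply: continuous_measurable_fun; exact: derive_continuous fd.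
pose m := image_measure (density_measure leb mdf) mf.
have mE A : m A = (\int[leb]_(x in f @^-1` A) (df x)%:E)%E.
  by apply: eq_integral => x _ /=; rewrite ger0_norm.
rewrite -mE; refine (@lebesgue_measure_unique R m _ B mB).
move=> _ [[a b] _ <-]; rewrite mE /=.
have -> : f @^-1` `]a, b] = `]g a, g b]%classic.
  apply/seteqP; split=> x /=; rewrite !in_itv /=.
    by move=> /andP[h1 h2]; rewrite -(fK x) bilipschitz_ltE// bilipschitz_leE// h1.
  by rewrite -{1 2}(fK x) bilipschitz_ltE// bilipschitz_leE.
have mdfE D : measurable_fun D (fun x => (df x)%:E).
  by apply/measurable_EFinP/measurable_funTS.
rewrite integral_itv_obnd_cbnd// -integral_itv_bndo_bndc//.
rewrite lebesgue_measure_itv /=; case: ifPn => [|]; rewrite lte_fin.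
  move=> ab; rewrite (integral_derive cdf fd) ?gK -?EFinB//.
  by rewrite bilipschitz_leE// ltW.
rewrite -leNgt => ba; rewrite set_itv_ge ?integral_set0// bnd_simp -leNgt.
by rewrite bilipschitz_leE.
Qed.

Lemma lebesgue_measure_shift c (B : set R) : measurable B ->
  leb B = leb ((fun x => x + c) @^-1` B).
Proof.
move=> mB.
have d x : is_derive x (1 : R) (fun x : R => x + c) 1.
  by rewrite -[X in is_derive _ _ _ X]addr0; apply: is_deriveD.
rewrite (@lebesgue_change_of_variables (fun x => x + c) (fun=> 1) B)//.
- rewrite integral_cst ?mul1e//.
  rewrite -[X in measurable X]setTI; apply: measurable_funD => //.
- apply: (derive_bilipschitz (c := 1) (C := 1) d) => // x; by rewrite lexx.
- exact: cst_continuous.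
Qed.

Lemma lebesgue_periodic (B : set R) s : measurable B ->
  (forall x, B (x + 1) <-> B x) -> leb (B `&` `[s, s + 1[) = leb (B `&` `[0, 1[).
Proof.
move=> mB B1.
have Bn (n : nat) x : B (x + n%:R) <-> B x.
  elim: n x => [|n IH] x; first by rewrite addr0.
  by rewrite -addn1 natrD addrA B1.
have Bz (n : int) x : B (x + n%:~R) <-> B x.
  case: n => n; first exact: Bn.
  by rewrite NegzE intrN -[in X in _ <-> X](subrK (n.+1%:R) x) Bn.
have sh (n : int) a b : leb (B `&` `[a + n%:~R, b + n%:~R[) = leb (B `&` `[a, b[).
  rewrite (lebesgue_measure_shift n%:~R); last by apply: measurableI => //; exact: measurable_itv.
  congr (leb _); apply/seteqP; split=> x /=; rewrite !in_itv /= lerD2r ltrD2r.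
    by rewrite Bz.
  by rewrite Bz.
have sp a b c : a <= b -> b <= c ->
    leb (B `&` `[a, c[) = (leb (B `&` `[a, b[) + leb (B `&` `[b, c[))%E.
  move=> ab bc; rewrite -measureU.
  - rewrite -setIUr; congr (leb (B `&` _)); apply/seteqP; split=> x /=; rewrite !in_itv /=.
      move=> /andP[h1 h2]; have [h|h] := ltP x b; [left|right]; apply/andP; split => //.
    by move=> [|] /andP[h1 h2]; apply/andP; split; lra.
  - by apply: measurableI => //; exact: measurable_itv.
  - by apply: measurableI => //; exact: measurable_itv.
  - apply/seteqP; split => // x /=; rewrite !in_itv /= => -[[_ /andP[_ h1]] [_ /andP[h2 _]]].
    by move: h1; rewrite ltNge h2.
have /andP[n1] := floor_itv s; set n := Num.floor s; rewrite intrD => n2.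
(* Cut at the integer [n + 1]. Up to integer translations the two pieces are [[s - n, 1[] and [[0, s
   - n[]. *)
rewrite (sp s (1 + n%:~R)); [|lra|lra].
rewrite -[s in `[s, _[](subrK n%:~R) sh.
have -> : `[1 + n%:~R, s + 1[%classic = `[0 + (n + 1)%:~R, (s - n%:~R) + (n + 1)%:~R[%classic.
  have e1 : 0 + (n + 1)%:~R = 1 + n%:~R :> R by rewrite intrD; lra.
  have e2 : s - n%:~R + (n + 1)%:~R = s + 1 by rewrite intrD; lra.
  by rewrite e1 e2.
rewrite sh addeC -sp//; lra.
Qed.

(** This is the law of [circle_pi (K U)] on an arc, for [U] uniform on [0, 1[. On the window of
    length 1 starting at [Psi a], [K] runs once over [[a, a + d[], which meets the translates of
    []a, b[] by [i < d] and no others, because [b <= a + 1]. *)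
Lemma lebesgue_arc (K Psi : R -> R) d a b : bilipschitz K -> bilipschitz Psi ->
  cancel K Psi -> cancel Psi K -> (forall u, K (u + 1) = K u + d%:R) ->
  a < b -> b <= a + 1 ->
  leb ([set u | exists k : int, a + k%:~R < K u < b + k%:~R] `&` `[0, 1[) =
  (\sum_(i < d) (Psi (b + i%:R) - Psi (a + i%:R)))%:E.
Proof.
move=> bK bPsi KK PsiK K1 ab ba1; set B := [set u | _].
have cK := lipschitz_continuous (bilipschitz_lip bK).
have mB : measurable B.
  rewrite (_ : B = \bigcup_(k : int) (K @^-1` `]a + k%:~R, b + k%:~R[)).
    apply: open_measurable; apply: bigcup_open => k _.
    by apply: open_comp; [move=> x _; exact: cK|exact: interval_open].
  apply/seteqP; split=> u /=; first by move=> [k h]; exists k => //=; rewrite in_itv.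
  by move=> [k _] /=; rewrite in_itv; exists k.
rewrite -(@lebesgue_periodic B (Psi a))//; last first.
  move=> u; rewrite /B /= K1; split=> -[k /andP[h1 h2]].
    by exists (k - d%:Z); rewrite intrB; apply/andP; split; lra.
  by exists (k + d%:Z); rewrite intrD; apply/andP; split; lra.
have Psi1 : Psi a + 1 = Psi (a + d%:R) by rewrite -[LHS]KK K1 PsiK.
rewrite (_ : _ `&` _ = \big[setU/set0]_(i < d) `]Psi (a + i%:R), Psi (b + i%:R)[%classic); last first.
  rewrite -(bigcup_mkord d (fun i => `]Psi (a + i%:R), Psi (b + i%:R)[%classic)); apply/seteqP; split=> u /=.
    move=> [[k /andP[h1 h2]]]; rewrite in_itv /= Psi1 -{1 2}(KK u).
    rewrite bilipschitz_leE// bilipschitz_ltE// => /andP[h3 h4].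
    have k0 : ((-1)%:~R : R) < k%:~R by rewrite intrN; lra.
    have kd : (k%:~R : R) < d%:~R by lra.
    move: k0 kd; rewrite !ltr_int; case: k h1 h2 => // k h1 h2 _ kd.
    exists k => //=; rewrite in_itv /=.
    by rewrite -(KK u) !bilipschitz_ltE// h1.
  move=> [i /= id] ; rewrite in_itv /= -{1 2}(KK u) !bilipschitz_ltE// => /andP[h1 h2].
  split; first by exists i%:Z; rewrite h1.
  rewrite in_itv /= Psi1 -{1 2}(KK u) bilipschitz_leE// bilipschitz_ltE//.
  have i0 : (0 : R) <= i%:R by [].
  have {}id : (i.+1%:R : R) <= d%:R by rewrite ler_nat.
  by move: id; rewrite -addn1 natrD => id; apply/andP; split; lra.
rewrite measure_bigsetU_ord//=; last first.
  apply/trivIsetP => i j _ _ ij; apply/seteqP; split => // u /=.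
  rewrite !in_itv /= -{1 2 3 4}(KK u) !bilipschitz_ltE// => -[/andP[h1 h2] /andP[h3 h4]].
  have e1 : ((i : nat)%:~R : R) < (j%:Z + 1)%:~R by rewrite intrD; lra.
  have e2 : ((j : nat)%:~R : R) < (i%:Z + 1)%:~R by rewrite intrD; lra.
  move: e1 e2; rewrite !ltr_int => e1 e2.
  by move/negP: ij; apply; apply/eqP/val_inj => /=; lia.
rewrite -sumEFin; apply: eq_bigr => i _.
by rewrite lebesgue_measure_itv /= lte_fin bilipschitz_ltE// ltrD2r ab EFinB.
Qed.

Definition circle_arc a b : set (circle R) := @circle_pi R @` `]a, b[.

Lemma circle_arc_pi a b x : circle_arc a b (circle_pi x) <-> exists k : int, a + k%:~R < x < b + k%:~R.
Proof.
split=> [[y]|[k /andP[h1 h2]]].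
  rewrite /= in_itv /= => /andP[ay yb] /circle_pi_eq /intrP[k yx].
  by exists (- k); rewrite intrN; apply/andP; split; lra.
exists (x - k%:~R); first by rewrite /= in_itv /=; apply/andP; split; lra.
by rewrite -intrN circle_piDz.
Qed.

Lemma measurable_circle_arc a b : measurable (circle_arc a b).
Proof.
apply: sub_sigma_algebra; rewrite /open /= /circle_open.
rewrite (_ : _ @^-1` _ = \bigcup_(k : int) `]a + k%:~R, b + k%:~R[%classic).
  by apply: bigcup_open => k _; exact: interval_open.
apply/seteqP; split=> x /=.
  by move/circle_arc_pi => [k h]; exists k => //=; rewrite in_itv.
by move=> [k _] /=; rewrite in_itv /= => h; apply/circle_arc_pi; exists k.
Qed.

(** Two arcs may meet in two arcs, so arcs are not stable under intersection. Both measures are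
    therefore carried to the line by [circle_repr], where rays are stable; the preimage of a ray is
    everything, nothing, or an arc ending at 1/2. *)
Lemma circle_measure_unique (m1 m2 : {measure set (circle R) -> \bar R}) :
  m1 setT = m2 setT -> (m1 setT < +oo)%E ->
  (forall a b, a < b -> b <= a + 1 -> m1 (circle_arc a b) = m2 (circle_arc a b)) ->
  forall A, measurable A -> m1 A = m2 A.
Proof.
move=> mT m1T marc A mA.
have mrp := @measurable_circle_repr R.
have pm (m : {measure set (circle R) -> \bar R}) : m A = image_measure m mrp (@circle_pi R @^-1` A).
  by rewrite /image_measure /= /pushforward; congr (m _); apply/seteqP; split=> p /=; rewrite circle_reprK.
rewrite !pm.
have mpiA : measurable (@circle_pi R @^-1` A).
  by rewrite -[X in measurable X]setTI; exact: measurable_circle_pi.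
pose M1 := image_measure m1 mrp.
pose M2 := image_measure m2 mrp.
refine (@measure_unique _ _ _ (@RGenOInfty.G R) (fun k => `]- k%:R, +oo[%classic) _ _ _ _ M1 M2 _ _ _ mpiA).
- exact: RGenOInfty.measurableE.
- move=> _ _ [x ->] [y ->]; exists (Num.max x y).
  apply/seteqP; split=> z /=; rewrite !in_itv /= !andbT gt_max.
    by move=> [-> ->].
  by case/andP.
- by move=> k; exists (- k%:R).
- apply/seteqP; split => // x _; exists (Num.truncn `|x|).+1 => //=.
  rewrite in_itv /= andbT; have := ler_norm (- x); rewrite normrN.
  have /andP[_] := truncn_itv (normr_ge0 x); lra.
- move=> _ [x ->]; rewrite /M1 /M2 /= /pushforward.
  have [x1|x1] := ltP x (- 2^-1).
    rewrite (_ : _ @^-1` _ = setT)//; apply/seteqP; split=> // p _ /=; rewrite in_itv /= andbT.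
    by case/andP: (circle_repr_itv p) => h _; exact: lt_le_trans h.
  have [x2|x2] := leP 2^-1 x.
    rewrite (_ : _ @^-1` _ = set0) ?measure0//; apply/seteqP; split=> // p /=; rewrite in_itv /= andbT.
    case/andP: (circle_repr_itv p) => _ h1 h2.
    by have := lt_le_trans (lt_trans h2 h1) x2; rewrite ltxx.
  rewrite (_ : _ @^-1` _ = circle_arc x 2^-1); first by apply: marc => //; move: x1 x2; clear; lra.
  apply/seteqP; split=> p /=; rewrite in_itv /= andbT.
    move=> xp; exists (circle_repr p); last exact: circle_reprK.
    by rewrite /= in_itv /= xp; case/andP: (circle_repr_itv p).
  move=> [y]; rewrite /= in_itv /= => /andP[xy y2] <-.
  by rewrite circle_repr_small//; move: x1 xy y2; clear; lra.
- move=> k; apply: le_lt_trans m1T; rewrite /M1 /= /pushforward.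
  by apply: le_measure; rewrite ?inE//; rewrite -[X in measurable X]setTI; exact: measurable_circle_repr.
Qed.

End lebesgue_periodic.

(** * Lifting circle maps *)

Section circle_derivatives.
Variable R : realType.
Implicit Types (x y : R) (p q : circle R).

Lemma continuous_comp_circle_pi (T : topologicalType) (h : circle R -> T) :
  continuous h -> continuous (h \o @circle_pi R).
Proof. by move=> ch x; apply: continuous_comp; [exact: continuous_circle_pi|exact: ch]. Qed.

Lemma is_derive_shift_comp (f g : R -> R) x a d :
  (forall y, g y = f (y + a)) -> is_derive (x + a) (1 : R) f d -> is_derive x (1 : R) g d.
Proof.
move=> gE df; rewrite (_ : g = f \o (fun y => y + a)); last by apply/funext => y /=.
rewrite -[d]mulr1; apply: is_derive1_comp.
by rewrite -[X in is_derive _ _ _ X]addr0; apply: is_deriveD.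
Qed.

Lemma is_derive_fun_deriv (g : circle R -> R) x : fun_derivable g ->
  is_derive x (1 : R) (g \o @circle_pi R) (fun_deriv g (circle_pi x)).
Proof.
move=> dg; apply: (@is_derive_shift_comp (fun_chart g (circle_pi x)) _ _ (- x)).
  by move=> y /=; rewrite /fun_chart circle_piB addrC subrK.
by rewrite subrr; apply: DeriveDef; [exact: dg|rewrite /fun_deriv derive1E].
Qed.

Lemma fun_deriv_unique (g h : circle R -> R) :
  (forall x, is_derive x (1 : R) (g \o @circle_pi R) (h (circle_pi x))) ->
  fun_derivable g /\ fun_deriv g = h.
Proof.
move=> gh.
have H p : is_derive (0 : R) (1 : R) (fun_chart g p) (h p).
  apply: (@is_derive_shift_comp (g \o @circle_pi R) _ _ (circle_repr p)).
    by move=> y; rewrite /fun_chart /= circle_piD circle_reprK addrC.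
  by rewrite add0r -{2}(circle_reprK p).
split=> [p|]; first by case: (H p).
by apply/funext => p; rewrite /fun_deriv derive1E; case: (H p).
Qed.

(** For functions controlled only through their increments, such as the circle distance in
    [circle_lift]. *)
Lemma is_derive0_squeeze (f k : R -> R) x : k 0 = 0 -> is_derive (0 : R) (1 : R) k 0 ->
  (forall h, `|f (x + h) - f x| <= `|k h|) -> is_derive x (1 : R) f 0.
Proof.
move=> k0 dk fk.
have ck : h^-1 *: (k (h *: (1 : R) + 0) - k 0) @[h --> 0^'] --> (0 : R).
  by have [h1 h2] := dk; rewrite -[X in _ --> X]h2; exact: h1.
suff H : h^-1 *: (f (h *: (1 : R) + x) - f x) @[h --> 0^'] --> (0 : R).
  by apply: DeriveDef; [apply/cvg_ex; exists 0|exact/cvg_lim].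
apply/cvgrPdist_lt => e e0; have /cvgr0Pnorm_lt/(_ _ e0) ck' := ck.
near=> t.
rewrite sub0r normrN normrM.
apply: (@le_lt_trans _ _ `|t^-1 *: (k (t *: (1 : R) + 0) - k 0)|).
  rewrite normrM ler_wpM2l// k0 subr0 addr0 [t *: 1]mulr1 [t + x]addrC; exact: fk.
by near: t.
Unshelve. all: by end_near. Qed.

(** The lift is obtained by integrating the derivative, without covering theory. The defect [D]
    between [F] and the candidate is circle-valued, but its distance to [D 0] is a real function,
    whose derivative vanishes because the increments of [D] are those of [k] and [k] has derivative
    0. *)
Lemma circle_lift (F : circle R -> circle R) : map_derivable F ->
  continuous (map_deriv F) ->
  exists2 f : R -> R, (forall x, is_derive x (1 : R) f (map_deriv F (circle_pi x)))
    & forall x, circle_pi (f x) = F (circle_pi x).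
Proof.
move=> dF cF; have [f0 f00 df0] := antiderivative (continuous_comp_circle_pi cF).
pose a := circle_repr (F (circle_pi 0)).
pose f x := a + f0 x.
have df x : is_derive x (1 : R) f (map_deriv F (circle_pi x)).
  by rewrite -[X in is_derive _ _ _ X]add0r; apply: is_deriveD.
exists f => //.
pose D x := F (circle_pi x) - circle_pi (f x).
pose g x := circle_dist (D x) (D 0).
have dg x : is_derive x (1 : R) g 0.
  pose k h := map_chart F (circle_pi x) h - (f (h + x) - f x).
  apply: (@is_derive0_squeeze g k).
  - by rewrite /k /map_chart circle_pi0 addr0 add0r !subrr -circle_pi0 circle_repr_small ?subrr//; lra.
  - rewrite -[X in is_derive _ _ _ X](subrr (map_deriv F (circle_pi x))).
    apply: is_deriveB.
      by apply: DeriveDef; [exact: dF|rewrite /map_deriv derive1E].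
    rewrite -[X in is_derive _ _ _ X]subr0; apply: is_deriveB.
    apply: (@is_derive_shift_comp f _ _ x) => //.
    by rewrite add0r; exact: df.
  - move=> h.
    have le1 : circle_dist (D (x + h)) (D x) <= `|k h|.
      rewrite /circle_dist.
      have -> : D (x + h) - D x = circle_pi (k h); last exact: le_circle_repr_pi.
      rewrite /D /k (circle_piB (map_chart _ _ _)) (circle_piB (f _)) circle_reprK circle_piD [h + x]addrC.
      by rewrite !opprB [LHS]addrCA [RHS]addrCA; congr (_ + _); exact: addrAC.
    apply: le_trans le1.
    have := circle_distD (D (x + h)) (D x) (D 0).
    have := circle_distD (D x) (D (x + h)) (D 0).
    rewrite (circle_distC (D x) (D (x + h))) /g => h1 h2.
    by rewrite ler_norml; apply/andP; split; lra.
move=> x; have : g x = g 0 by apply: is_derive_0_is_cst.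
rewrite {2}/g circle_distxx => /circle_dist_eq0.
have -> : D 0 = 0 by rewrite /D /f f00 addr0 circle_reprK subrr.
by rewrite /D => /eqP; rewrite subr_eq0 => /eqP.
Qed.

Lemma lift_degree (F : circle R -> circle R) (f : R -> R) :
  (forall x, is_derive x (1 : R) f (map_deriv F (circle_pi x))) ->
  (forall x, circle_pi (f x) = F (circle_pi x)) ->
  exists n : int, forall x, f (x + 1) = f x + n%:~R.
Proof.
move=> df fF.
have /circle_pi_eq /intrP[n nE] : circle_pi (f 1) = circle_pi (f 0).
  by rewrite !fF -[1]add0r (circle_piDn 0 1).
exists n => x; rewrite -nE.
pose g x := f (x + 1) - f x.
have dg y : is_derive y (1 : R) g 0.
  rewrite -[X in is_derive _ _ _ X](subrr (map_deriv F (circle_pi y))).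
  apply: is_deriveB; apply: (@is_derive_shift_comp f _ _ 1) => //.
  by rewrite -(circle_piDn y 1).
have : g x = g 0 by exact: is_derive_0_is_cst.
by rewrite /g add0r; lra.
Qed.

End circle_derivatives.

(** * Approximation by derivatives of smooth functions *)

Section trigonometric_approximation.
Variable R : realType.
Implicit Types (f g b h : R -> R) (x y z : R).

(** The default 0 makes this a total function of [f], so that [mean] takes no proof of
    continuity. *)
Definition primitive f : R -> R :=
  xget (fun=> 0) [set F | F 0 = 0 /\ forall x, is_derive x (1 : R) F (f x)].

Lemma primitiveP f : continuous f ->
  primitive f 0 = 0 /\ forall x, is_derive x (1 : R) (primitive f) (f x).
Proof.
move=> cf; have [F F0 dF] := antiderivative cf.
by rewrite /primitive; case: xgetP => [G -> //|/(_ F)]; case; split.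
Qed.

Lemma primitiveE f F x : (forall x, is_derive x (1 : R) F (f x)) ->
  continuous f -> primitive f x = F x - F 0.
Proof.
move=> dF cf; have [p0 dp] := primitiveP cf.
have d0 y : is_derive y (1 : R) (primitive f - F) 0.
  by rewrite -(subrr (f y)); apply: is_deriveB.
have : (primitive f - F) x = (primitive f - F) 0 by exact: is_derive_0_is_cst.
by rewrite !fctE p0; lra.
Qed.

Definition mean f := primitive f 1.

Lemma meanE f F : (forall x, is_derive x (1 : R) F (f x)) -> continuous f ->
  mean f = F 1 - F 0.
Proof. exact: primitiveE. Qed.

Lemma mean_ge0 f : continuous f -> (forall x, 0 <= f x) -> 0 <= mean f.
Proof.
move=> cf f0; have [p0 dp] := primitiveP cf.
have [c _] := mean_value dp ler01; rewrite /mean p0 !subr0 mulr1 => ->; exact: f0.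
Qed.

Let continuousZ a f : continuous f -> continuous (fun x => a * f x).
Proof. by move=> cf x; apply: continuousM; [exact: cst_continuous|exact: cf]. Qed.

Let continuousS f g : continuous f -> continuous g -> continuous (fun x => f x + g x).
Proof. by move=> cf cg x; apply: continuousD; [exact: cf|exact: cg]. Qed.

Lemma meanD f g : continuous f -> continuous g ->
  mean (fun x => f x + g x) = mean f + mean g.
Proof.
move=> cf cg; have [p0 dp] := primitiveP cf; have [q0 dq] := primitiveP cg.
have cfg : continuous (fun x => f x + g x).
  by move=> x; apply: continuousD; [exact: cf|exact: cg].
have d x : is_derive x (1 : R) (primitive f + primitive g) (f x + g x).
  exact: is_deriveD.
by rewrite (meanE d cfg) !fctE p0 q0 /mean; lra.
Qed.

Lemma meanZ a f : continuous f -> mean (fun x => a * f x) = a * mean f.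
Proof.
move=> cf; have [p0 dp] := primitiveP cf.
have cfg := continuousZ (a := a) cf.
have d x : is_derive x (1 : R) (a \*: primitive f) (a * f x).
  exact: is_deriveZ.
by rewrite (meanE d cfg) /= p0 /mean [_ *: 0]mulr0 subr0.
Qed.

Lemma mean_cst a : mean (fun=> a) = a.
Proof.
have d x : is_derive x (1 : R) (a \*: id) a.
  have := @is_deriveZ _ _ _ id a x 1 1 (is_derive_id _ _).
  by rewrite [a *: 1]mulr1.
rewrite (meanE d) /=; first by rewrite [_ *: 1]mulr1 [_ *: 0]mulr0 subr0.
exact: cst_continuous.
Qed.

Lemma le_mean f g : continuous f -> continuous g -> (forall x, f x <= g x) ->
  mean f <= mean g.
Proof.
move=> cf cg fg.
have cNf := continuousZ (a := -1) cf.
rewrite -subr_ge0 -mulN1r -(meanZ (-1) cf) -(meanD cg cNf).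
by apply: mean_ge0 => [|x]; [exact: continuousS|rewrite mulN1r subr_ge0].
Qed.

Lemma mean_shift f a : continuous f -> (forall x, f (x + 1) = f x) ->
  mean (fun x => f (x + a)) = mean f.
Proof.
move=> cf f1; have [p0 dp] := primitiveP cf.
have d x : is_derive x (1 : R) (fun x => primitive f (x + a)) (f (x + a)).
  exact: (@is_derive_shift_comp _ (primitive f) _ _ a).
have cfa : continuous (fun x => f (x + a)).
  by move=> x; apply: continuous_comp; [apply: continuousD => //; exact: cst_continuous|exact: cf].
rewrite (meanE d cfa).
pose G x := primitive f (x + 1) - primitive f x.
have dG x : is_derive x (1 : R) G 0.
  rewrite -(subrr (f x)); apply: is_deriveB.
  by apply: (@is_derive_shift_comp _ (primitive f) _ _ 1) => //; rewrite -f1.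
have : G a = G 0 by exact: is_derive_0_is_cst.
by rewrite /G !add0r p0 subr0 [1 + a]addrC => ->.
Qed.

Definition ccos x := cos (2 * pi * x).
Definition csin x := sin (2 * pi * x).

Lemma ccos_derive x : is_derive x (1 : R) ccos (- (2 * pi) * csin x).
Proof.
rewrite (_ : - _ * _ = (- csin x) * (2 * pi)); last by rewrite mulrC mulrN mulNr.
apply: is_derive1_comp.
by have := @is_deriveZ _ _ _ id (2 * pi) x 1 1 (is_derive_id _ _); rewrite [_ *: 1]mulr1.
Qed.

Lemma csin_derive x : is_derive x (1 : R) csin (2 * pi * ccos x).
Proof.
rewrite mulrC; apply: is_derive1_comp.
by have := @is_deriveZ _ _ _ id (2 * pi) x 1 1 (is_derive_id _ _); rewrite [_ *: 1]mulr1.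
Qed.

Lemma ccos1 x : ccos (x + 1) = ccos x.
Proof. by rewrite /ccos mulrDr mulr1 {2}mulr_natl cosD2pi. Qed.

Lemma csin1 x : csin (x + 1) = csin x.
Proof. by rewrite /csin mulrDr mulr1 {2}mulr_natl sinD2pi. Qed.

(** Closure under products replaces the higher frequencies, and makes derivatives and powers of the
    kernel stay in the class by structural induction. *)
Inductive trig_poly : (R -> R) -> Prop :=
| trig_cst a : trig_poly (fun=> a)
| trig_cos : trig_poly ccos
| trig_sin : trig_poly csin
| trig_add f g : trig_poly f -> trig_poly g -> trig_poly (fun x => f x + g x)
| trig_mul f g : trig_poly f -> trig_poly g -> trig_poly (fun x => f x * g x).

Lemma trig_poly_derive f : trig_poly f ->
  exists2 df, trig_poly df & forall x, is_derive x (1 : R) f (df x).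
Proof.
elim=> [a|||{}f g tf [df tdf dfE] tg [dg tdg dgE]|{}f g tf [df tdf dfE] tg [dg tdg dgE]].
- exists (fun=> 0); [exact: trig_cst|move=> x; exact: is_derive_cst].
- exists (fun x => - (2 * pi) * csin x); last exact: ccos_derive.
  by apply: (@trig_mul (fun=> _)); [exact: trig_cst|exact: trig_sin].
- exists (fun x => (2 * pi) * ccos x); last exact: csin_derive.
  by apply: (@trig_mul (fun=> _)); [exact: trig_cst|exact: trig_cos].
- exists (fun x => df x + dg x); first exact: trig_add.
  by move=> x; exact: is_deriveD.
- exists (fun x => f x * dg x + g x * df x).
    by apply: trig_add; exact: trig_mul.
  by move=> x; exact: is_deriveM.
Qed.

Lemma trig_poly_continuous f : trig_poly f -> continuous f.
Proof. by move=> /trig_poly_derive[df _]; exact: derive_continuous. Qed.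

Lemma trig_poly1 f : trig_poly f -> forall x, f (x + 1) = f x.
Proof.
elim=> [//|||{}f g _ IHf _ IHg x|{}f g _ IHf _ IHg x]; [exact: ccos1|exact: csin1| |];
  by rewrite IHf IHg.
Qed.

Lemma trig_poly_fun_deriv f df : trig_poly f -> trig_poly df ->
  (forall x, is_derive x (1 : R) f (df x)) ->
  fun_derivable (f \o @circle_repr R) /\
  fun_deriv (f \o @circle_repr R) = df \o @circle_repr R.
Proof.
move=> tf tdf dE; apply: fun_deriv_unique => x.
rewrite [X in is_derive _ _ X _](_ : _ = f).
  by rewrite /= (periodic_circle_repr (trig_poly1 tdf)).
by apply/funext => y /=; rewrite (periodic_circle_repr (trig_poly1 tf)).
Qed.

Lemma trig_poly_smooth f : trig_poly f -> smooth_fun (f \o @circle_repr R).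
Proof.
move=> tf n.
suff [g tg ->] : exists2 g, trig_poly g &
    iter n (@fun_deriv R) (f \o @circle_repr R) = g \o @circle_repr R.
  have [dg tdg gE] := trig_poly_derive tg.
  by case: (trig_poly_fun_deriv tg tdg gE).
elim: n => [|n [g tg gE]]; first by exists f.
have [dg tdg dgE] := trig_poly_derive tg; exists dg => //.
by rewrite iterS gE; case: (trig_poly_fun_deriv tg tdg dgE).
Qed.

(** Zero mean makes the primitive periodic. It need not be exhibited as a trigonometric polynomial:
    beyond order 0, its smoothness is that of [f]. *)
Lemma trig_poly_primitive f : trig_poly f -> mean f = 0 ->
  exists2 g, smooth_fun g & forall x, fun_deriv g (circle_pi x) = f x.
Proof.
move=> tf mf; have [p0 dp] := primitiveP (trig_poly_continuous tf).
have p1 x : primitive f (x + 1) = primitive f x.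
  have := mean_shift x (trig_poly_continuous tf) (trig_poly1 tf).
  have d y : is_derive y (1 : R) (fun y => primitive f (y + x)) (f (y + x)).
    exact: (@is_derive_shift_comp _ (primitive f) _ _ x).
  have cfx : continuous (fun y => f (y + x)).
    move=> y; apply: continuous_comp; last exact: (trig_poly_continuous tf).
    by apply: continuousD => //; exact: cst_continuous.
  by rewrite mf (meanE d cfx) add0r [1 + x]addrC => /eqP; rewrite subr_eq0 => /eqP.
have [gd gE] : fun_derivable (primitive f \o @circle_repr R) /\
    fun_deriv (primitive f \o @circle_repr R) = f \o @circle_repr R.
  apply: fun_deriv_unique => x; rewrite [X in is_derive _ _ X _](_ : _ = primitive f).
    by rewrite /= (periodic_circle_repr (trig_poly1 tf)).
  by apply/funext => y /=; rewrite (periodic_circle_repr p1).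
exists (primitive f \o @circle_repr R) => [[|n]|x] //.
  by rewrite iterSr gE; exact: trig_poly_smooth.
by rewrite gE /= (periodic_circle_repr (trig_poly1 tf)).
Qed.

(* [ker x = cos (pi x) ^ 2]. *)
Definition ker x : R := (1 + ccos x) / 2.

Lemma ker_trig : trig_poly ker.
Proof.
apply: (@trig_mul (fun x => 1 + ccos x) (fun=> 2^-1)); last exact: trig_cst.
by apply: (@trig_add (fun=> 1)); [exact: trig_cst|exact: trig_cos].
Qed.

Lemma ker_pow_trig n : trig_poly (fun x => ker x ^+ n).
Proof.
elim: n => [|n IH]; first by under eq_fun do rewrite expr0; exact: trig_cst.
by under eq_fun do rewrite exprS; apply: trig_mul => //; exact: ker_trig.
Qed.

Lemma ker_ge0 x : 0 <= ker x.
Proof. by rewrite /ker /ccos; have := cos_geN1 (2 * pi * x); lra. Qed.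

Lemma ker_le1 x : ker x <= 1.
Proof. by rewrite /ker /ccos; have := cos_le1 (2 * pi * x); lra. Qed.

Lemma kerN x : ker (- x) = ker x.
Proof. by rewrite /ker /ccos mulrN cosN. Qed.

Lemma kerB x y : ker (x - y) = (1 + ccos x * ccos y + csin x * csin y) / 2.
Proof. by rewrite /ker /ccos mulrBr cosB /csin; lra. Qed.

(** A Wallis recurrence. The derivative of [csin * ker ^+ n] has mean zero over a period, and
    [csin ^+ 2 = 4 * ker * (1 - ker)], [ccos = 2 * ker - 1] turn it into a combination of two
    consecutive powers. *)
Lemma mean_ker_rec n :
  (2 * n.+1)%:R * mean (fun x => ker x ^+ n.+1) = (2 * n + 1)%:R * mean (fun x => ker x ^+ n).
Proof.
have ck m : continuous (fun x => ker x ^+ m) by exact/trig_poly_continuous/ker_pow_trig.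
have dk x : is_derive x (1 : R) ker (- pi * csin x).
  have d1 : is_derive x (1 : R) (cst (1 : R) + ccos) (0 + - (2 * pi) * csin x).
    by apply: is_deriveD; exact: ccos_derive.
  rewrite (_ : ker = 2^-1 \*: (cst 1 + ccos)); last first.
    by apply/funext => y; rewrite /ker mulrC.
  rewrite (_ : - pi * csin x = 2^-1 *: (0 + - (2 * pi) * csin x)); first exact: is_deriveZ.
  by rewrite /GRing.scale /=; lra.
pose F x := csin x * ker x ^+ n.
have dF x : is_derive x (1 : R) F (2 * pi * ((2 * n.+1)%:R * ker x ^+ n.+1 + - (2 * n + 1)%:R * ker x ^+ n)).
  have dkn := is_deriveX n (dk x).
  have := @is_deriveM _ _ csin _ x 1 _ _ (csin_derive x) dkn.
  have -> : csin * ker ^+ n = F by apply/funext => y; rewrite /F fctE exprfctE.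
  congr is_derive; rewrite /GRing.scale /=.
  have cs : csin x ^+ 2 = 4 * ker x * (1 - ker x).
    by rewrite /csin /ker /ccos; have := cos2Dsin2 (2 * pi * x); lra.
  have cc : ccos x = 2 * ker x - 1 by rewrite /ker; lra.
  have hn : n%:R * ker x ^+ n.-1 * ker x = n%:R * ker x ^+ n.
    by clear; case: n => [|n]; rewrite ?mul0r// -mulrA -exprSr.
  have -> : csin x * (n%:R * ker x ^+ n.-1 * (- pi * csin x)) =
      - (pi * 4 * (1 - ker x)) * (n%:R * ker x ^+ n).
    rewrite -hn; transitivity (- (pi * (n%:R * ker x ^+ n.-1) * csin x ^+ 2)); first by ring.
    by rewrite cs; ring.
  by rewrite cc exprfctE exprS !(natrM, natrD) -[n.+1]addn1 natrD; ring.
have := meanE dF; rewrite /F.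
have cc a m := continuousZ (a := a) (ck m).
have c2 := continuousS (cc (2 * n.+1)%:R n.+1) (cc (- (2 * n + 1)%:R) n).
rewrite meanZ// meanD// !meanZ//.
have -> : csin 1 = csin 0 by rewrite -[1]add0r csin1.
have -> : ker 1 = ker 0 by rewrite -[1]add0r (trig_poly1 ker_trig).
rewrite subrr => /(_ _)/eqP.
rewrite !mulf_eq0 pnatr_eq0 /= (gt_eqF (pi_gt0 R)) /= mulNr subr_eq0 => H.
apply/eqP; apply: H; exact: continuousZ.
Qed.

Lemma mean_ker_gt0 n : 0 < mean (fun x => ker x ^+ n).
Proof.
elim: n => [|n IH]; first by under eq_fun do rewrite expr0; rewrite mean_cst.
have := mean_ker_rec n => /esym e.
have : 0 < (2 * n.+1)%:R * mean (fun x => ker x ^+ n.+1).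
  by rewrite -e mulr_gt0// ltr0n addn1.
by rewrite pmulr_rgt0// ltr0n.
Qed.

End trigonometric_approximation.

(** * Convolution and uniform density of smooth derivatives *)

Section smooth_density.
Variable R : realType.
Implicit Types (f g b h : R -> R) (x y z : R).

Let contM f g : continuous f -> continuous g -> continuous (fun x => f x * g x).
Proof. by move=> cf cg x; apply: continuousM; [exact: cf|exact: cg]. Qed.

Let contC (a : R) : continuous (fun _ : R => a).
Proof. by move=> x; exact: cst_continuous. Qed.

Let contD f g : continuous f -> continuous g -> continuous (fun x => f x + g x).
Proof. by move=> cf cg x; apply: continuousD; [exact: cf|exact: cg]. Qed.

Let contk n x : continuous (fun y => ker (x - y) ^+ n).
Proof.
move=> y; apply: (@continuous_comp _ _ _ (fun y => x - y) (fun z => ker z ^+ n)).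
  by apply: continuousB => //; exact: cst_continuous.
exact: (trig_poly_continuous (ker_pow_trig R n)).
Qed.

(** The addition formula splits one factor of the kernel into functions of [x] times functions of
    [y]. The latter are absorbed into [b], which is why the induction quantifies over [b]. *)
Lemma convolution_trig n b : continuous b ->
  exists2 q, trig_poly q & forall x, mean (fun y => b y * ker (x - y) ^+ n) = q x.
Proof.
elim: n b => [|n IH] b cb.
  exists (fun=> mean b); first exact: trig_cst.
  by move=> x; under eq_fun do rewrite expr0 mulr1.
have cc : continuous (@ccos R) by exact: trig_poly_continuous (trig_cos R).
have cs : continuous (@csin R) by exact: trig_poly_continuous (trig_sin R).
have cb1 := contM cb (@contC 2^-1).
have [q1 t1 E1] := IH _ cb1.
have [q2 t2 E2] := IH _ (contM cb1 cc).
have [q3 t3 E3] := IH _ (contM cb1 cs).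
exists (fun x => q1 x + (ccos x * q2 x + csin x * q3 x)).
  apply: trig_add => //; apply: trig_add; apply: trig_mul => //.
  - exact: trig_cos.
  - exact: trig_sin.
move=> x; rewrite -E1 -E2 -E3.
have c1 := contM cb1 (@contk n x).
have c2 := contM (contM cb1 cc) (@contk n x).
have c3 := contM (contM cb1 cs) (@contk n x).
rewrite -(meanZ (ccos x) c2) -(meanZ (csin x) c3).
have c2' := contM (@contC (ccos x)) c2.
have c3' := contM (@contC (csin x)) c3.
rewrite -(meanD c2' c3') -(meanD c1 (contD c2' c3')).
congr mean; apply/funext => y.
by rewrite exprS kerB; ring.
Qed.

Lemma ker_lbound (e : R) : 0 < e -> exists2 m : R, 0 < m &
  forall z, - 2^-1 <= z <= 2^-1 -> e <= `|z| -> m <= 1 - ker z.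
Proof.
move=> e0.
have pi0 := pi_gt0 R.
(* The cap at 1/2 keeps [2 * pi * d] in [[0, pi]], where the cosine decreases. *)
pose d := Num.min e 2^-1.
have d0 : 0 < d by rewrite lt_min e0; lra.
have d2 : d <= 2^-1 by rewrite ge_min lexx orbT.
have de : d <= e by rewrite ge_min lexx.
have inpi t : 0 <= t <= 2^-1 -> 2 * pi * t \in `[0, pi].
  move=> /andP[t0 t1]; rewrite in_itv /=; apply/andP; split.
    by rewrite !mulr_ge0// pi_ge0.
  by rewrite mulrAC ler_piMl ?pi_ge0//; lra.
have kd z : d <= z -> z <= 2^-1 -> ker z <= ker d.
  move=> dz z2; rewrite /ker ler_wpM2r// lerD2l /ccos.
  rewrite leNgt ltr_cos -?leNgt; first by rewrite ler_wpM2l// mulr_ge0// pi_ge0.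
  - by apply: inpi; apply/andP; split; lra.
  - by apply: inpi; apply/andP; split; lra.
exists (1 - ker d).
  have : ccos d < 1.
    have in0 : (0 : R) \in `[0, pi] by rewrite in_itv /= lexx pi_ge0.
    have ind : 2 * pi * d \in `[0, pi] by apply: inpi; apply/andP; split; lra.
    by rewrite -cos0 /ccos ltr_cos// !mulr_gt0.
  by rewrite /ker; lra.
move=> z /andP[z1 z2] ez.
have -> : ker z = ker `|z| by case: (ger0P z) => // _; rewrite kerN.
rewrite lerD2l lerN2; apply: kd; first exact: le_trans ez.
by rewrite ler_norml; apply/andP; split; lra.
Qed.

(** Korovkin's device: the oscillation of [h] is dominated by a function whose average against the
    kernel can be computed. Close points are handled by the Lipschitz bound; for the others
    [1 - ker] is at least [m], and [L * |z| <= L] gives the constant [L / m]. *)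
Lemma modulus_ker h e : lipschitz_fun h -> (forall x, h (x + 1) = h x) -> 0 < e ->
  exists2 C : R, 0 <= C & forall x y, `|h x - h y| <= e + C * (1 - ker (x - y)).
Proof.
move=> [L L0 lh] h1 e0.
have [|m m0 hm] := @ker_lbound (e / (L + 1)); first by rewrite divr_gt0//; lra.
exists (L / m) => [|x y]; first by rewrite divr_ge0// ltW.
pose z := circle_repr (circle_pi (x - y)).
have [n zE] := circle_repr_pi (x - y).
have zitv : - 2^-1 <= z <= 2^-1.
  by have /andP[a b] := circle_repr_itv (circle_pi (x - y)); apply/andP; split => //; exact: ltW.
have kz : ker (x - y) = ker z.
  by rewrite /z (periodic_circle_repr (trig_poly1 (ker_trig R))).
have hx : h x = h (y + z).
  have -> : y + z = x + n%:~R by rewrite /z zE; lra.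
  rewrite -(periodic_circle_repr h1 x) -(periodic_circle_repr h1 (x + _)).
  by rewrite circle_piDz.
have hz : `|h x - h y| <= L * `|z|.
  by rewrite hx (le_trans (lh _ _))// addrC addKr.
have k1 : 0 <= 1 - ker (x - y) by have := ker_le1 (x - y); lra.
have [ze|ze] := leP (e / (L + 1)) `|z|.
  have := hm _ zitv ze; rewrite -kz => mk.
  apply: (le_trans hz); rewrite (@le_trans _ _ (L * 1))//.
    by rewrite ler_wpM2l// ler_norml; move/andP: zitv => [a b]; apply/andP; split; lra.
  have : L / m * m <= L / m * (1 - ker (x - y)) by rewrite ler_wpM2l// divr_ge0// ltW.
  by rewrite divfK ?gt_eqF//; lra.
apply: (le_trans hz).
have L1 : 0 < L + 1 by lra.
move: ze; rewrite ltr_pdivlMr// => ze.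
have : 0 <= L / m * (1 - ker (x - y)) by rewrite mulr_ge0// divr_ge0// ltW.
have : 0 <= `|z| by [].
by nra.
Qed.

(* Convolution with the normalized powers of [cos (pi x) ^ 2] turns [h] into a
   trigonometric polynomial; the error is controlled by the recurrence
   [mean_ker_rec], which bounds the mean of [(1 - ker) * ker ^+ n]. *)
Lemma smooth_deriv_dense h e : lipschitz_fun h -> (forall x, h (x + 1) = h x) ->
  mean h = 0 -> 0 < e -> exists2 g, smooth_fun g &
    forall x, `|h x - fun_deriv g (circle_pi x)| <= e.
Proof.
move=> lh h1 mh e0; have ch := lipschitz_continuous lh.
have e4 : 0 < e / 4 by lra.
have [C C0 hC] := modulus_ker lh h1 e4.
(* The mean of [(1 - ker) * ker ^+ n] is [I / (2 * n.+1)]; this [n] makes [C] times it at most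
   [e / 4 * I]. *)
pose n := Num.truncn (C / (e / 4)).
have nC : C <= (e / 4) * (2 * n.+1)%:R.
  have : C / (e / 4) < n.+1%:R by exact: truncnS_gt.
  rewrite ltr_pdivrMr// natrM => ?; have : 0 <= n.+1%:R :> R by [].
  by nra.
have [q0 tq0 q0E] := convolution_trig n ch.
pose I := mean (fun x : R => ker x ^+ n).
have I0 : 0 < I by exact: mean_ker_gt0.
have meank m x : mean (fun y => ker (x - y) ^+ m) = mean (fun x : R => ker x ^+ m).
  rewrite -(mean_shift (- x) (trig_poly_continuous (ker_pow_trig R m))
      (trig_poly1 (ker_pow_trig R m))).
  by congr mean; apply/funext => y; rewrite -kerN opprB.
have key x : `|h x * I - q0 x| <= e / 2 * I.
  have cK := @contk n x.
  have cK1 := @contk n.+1 x.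
  have c1 := contM (@contC (h x)) cK.
  have c2 := contM ch cK.
  have c3 := contM (@contC (e / 4 + C)) cK.
  have c4 := contM (@contC (- C)) cK1.
  have c34 := contD c3 c4.
  have c5 := contM (@contC (- (e / 4 + C))) cK.
  have c6 := contM (@contC C) cK1.
  have c56 := contD c5 c6.
  have hI : h x * I = mean (fun y => h x * ker (x - y) ^+ n) by rewrite (meanZ _ cK) meank.
  have mI := mean_ker_rec R n.
  have J1 : mean (fun x : R => ker x ^+ n.+1) = I - I / (2 * n.+1)%:R.
    rewrite -[LHS](mulKf (x := (2 * n.+1)%:R)) ?pnatr_eq0// mI -/I.
    have n1 : 0 < n%:R + 1 :> R by rewrite ltr_wpDl// ler0n.
    rewrite !(natrM, natrD) -[n.+1]addn1 natrD; field.
    by rewrite gt_eqF.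
  have CI : C * (I / (2 * n.+1)%:R) <= e / 4 * I.
    by rewrite mulrCA mulrC ler_pM2r// ler_pdivrMr// ltr0n.
  have p0 y : 0 <= ker (x - y) ^+ n by rewrite exprn_ge0// ker_ge0.
  have up : h x * I <= q0 x + e / 2 * I.
    rewrite hI -q0E.
    apply: (@le_trans _ _ (mean (fun y => h y * ker (x - y) ^+ n) +
       mean (fun y => (e / 4 + C) * ker (x - y) ^+ n + - C * ker (x - y) ^+ n.+1))).
      rewrite -(meanD c2 c34); apply: le_mean => //; first exact: contD.
      move=> y; have := hC x y; rewrite ler_norml => /andP[_ hxy].
      have := ler_wpM2r (p0 y) hxy; rewrite exprS; set p := _ ^+ n; set k := ker _; clear; nra.
    rewrite lerD2l (meanD c3 c4) (meanZ _ cK) (meanZ _ cK1) !meank J1 -/I; move: CI; set T := I / _; clear; nra.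
  have low : q0 x <= h x * I + e / 2 * I.
    rewrite hI -q0E.
    apply: (@le_trans _ _ (mean (fun y => h x * ker (x - y) ^+ n) +
       mean (fun y => (e / 4 + C) * ker (x - y) ^+ n + - C * ker (x - y) ^+ n.+1))).
      rewrite -(meanD c1 c34); apply: le_mean => //; first exact: contD.
      move=> y; have := hC x y; rewrite ler_norml => /andP[hxy _].
      have := ler_wpM2r (p0 y) hxy; rewrite exprS; set p := _ ^+ n; set k := ker _; clear; nra.
    rewrite lerD2l (meanD c3 c4) (meanZ _ cK) (meanZ _ cK1) !meank J1 -/I; move: CI; set T := I / _; clear; nra.
  by rewrite ler_norml; apply/andP; split; lra.
have cq0 := trig_poly_continuous tq0.
pose q x := I^-1 * q0 x.
have tq : trig_poly q by apply: (@trig_mul _ (fun=> I^-1)) => //; exact: trig_cst.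
have cq := trig_poly_continuous tq.
have hq x : `|h x - q x| <= e / 2.
  rewrite (_ : h x - q x = I^-1 * (h x * I - q0 x)); last first.
    by rewrite /q; field; rewrite gt_eqF.
  by rewrite normrM gtr0_norm ?invr_gt0// ler_pdivrMl// [I * _]mulrC key.
have mq : `|mean q| <= e / 2.
  have ce := @contC (e / 2).
  have u : mean q <= mean h + mean (fun=> e / 2).
    rewrite -(meanD ch ce); apply: le_mean => //; first exact: contD.
    by move=> x; have := hq x; rewrite ler_norml => /andP[]; lra.
  have l : mean h <= mean q + mean (fun=> e / 2).
    rewrite -(meanD cq ce); apply: le_mean => //; first exact: contD.
    by move=> x; have := hq x; rewrite ler_norml => /andP[]; lra.
  by move: u l; rewrite mean_cst mh ler_norml => u l; apply/andP; split; lra.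
(* Convolution need not give mean exactly zero. Removing the mean of [q], which is within [e / 2] of
   that of [h], costs the second half of the error. *)
have tq' : trig_poly (fun x => q x + - mean q) by apply: trig_add => //; exact: trig_cst.
have [|g sg gE] := trig_poly_primitive tq'.
  by rewrite (meanD cq (@contC _)) mean_cst subrr.
exists g => // x; rewrite gE opprD opprK addrA.
by rewrite (le_trans (ler_normD _ _))//; have := hq x; lra.
Qed.

End smooth_density.

(** * Inverse branches *)

Section branches.
Variable R : realType.
Implicit Types (a b u x y : R).
Local Notation leb := (@lebesgue_measure R).

Lemma continuous_circle_fun (T : topologicalType) (g : circle R -> T) :
  continuous (g \o @circle_pi R) -> continuous g.
Proof.
move=> /continuousP cg; apply/continuousP => U oU.
by rewrite /open /= /circle_open -comp_preimage; exact: cg.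
Qed.

Lemma pi_periodic (T : Type) (g : circle R -> T) x :
  (g \o @circle_pi R) (x + 1) = (g \o @circle_pi R) x.
Proof. by rewrite /= (circle_piDn x 1). Qed.

Lemma C1_fun_lipschitz (g : circle R -> R) : C1_fun g ->
  [/\ continuous g, lipschitz_fun (g \o @circle_pi R) &
      bounded_function (g \o @circle_pi R)].
Proof.
move=> [dg cg]; have dgpi x := is_derive_fun_deriv x dg.
have cgpi : continuous (g \o @circle_pi R) by exact: derive_continuous dgpi.
split; first exact: continuous_circle_fun.
  apply: (derive_bounded_lipschitz dgpi).
  exact: (periodic_bounded (pi_periodic (fun_deriv g)) (continuous_comp_circle_pi cg)).
exact: (periodic_bounded (pi_periodic g) cgpi).
Qed.

Lemma constant_sign (g : R -> R) : continuous g -> (forall x, 1 < `|g x|) ->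
  exists2 s : R, s = 1 \/ s = -1 & forall x, 1 < s * g x.
Proof.
move=> cg g1.
have nz x : g x != 0 by rewrite -normr_gt0 (lt_trans ltr01).
have same x y : x <= y -> (0 < g x) = (0 < g y).
  move=> xy; apply/eqP; apply: contraT => h.
  have bnd : Num.min (g x) (g y) <= 0 <= Num.max (g x) (g y).
    rewrite ge_min le_max; move: h.
    by have [?|?|?] := ltgtP (g x) 0; have [?|?|?] := ltgtP (g y) 0;
      rewrite ?lexx ?orbT//= ?eqxx.
  have [z _ gz] := IVT xy (continuous_subspaceT (A := `[x, y]) cg) bnd.
  by have := nz z; rewrite gz eqxx.
have sameT x : (0 < g x) = (0 < g 0).
  by have [/same|/ltW/same] := leP x 0.
have [g0|g0] := boolP (0 < g 0).
  exists 1 => [|x]; first by left.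
  by rewrite mul1r; have := g1 x; rewrite gtr0_norm// sameT.
exists (-1) => [|x]; first by right.
have := g1 x; rewrite mulN1r ler0_norm// leNgt sameT//.
Qed.

Lemma lebesgue_setIco_oc (B : set R) a b : measurable B ->
  leb (B `&` `[a, b[) = leb (B `&` `]a, b]).
Proof.
move=> mB; rewrite -!integral_indic//.
have mi : measurable_fun (`]a, b[%classic : set R) (fun x => (\1_B x : R)%:E).
  by apply/measurable_EFinP/measurable_funTS; exact: measurable_indic.
by rewrite (integral_itv_bndoo _ _ mi) [RHS](integral_itv_bndoo _ _ mi).
Qed.

Lemma lebesgue_periodicN (B : set R) : measurable B -> (forall x, B (x + 1) <-> B x) ->
  leb ((-%R @^-1` B) `&` `[0, 1[) = leb (B `&` `[0, 1[).
Proof.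
move=> mB B1.
have mNB : measurable (-%R @^-1` B).
  by rewrite -[X in measurable X]setTI; exact: oppr_measurable.
rewrite -(@lebesgue_periodic R B (-1))// addNr [RHS]lebesgue_setIco_oc//.
rewrite -[RHS]lebesgue_measureN; last by apply: measurableI => //; exact: measurable_itv.
rewrite /pushforward; congr (leb _); apply/seteqP; split=> x /=; rewrite !in_itv /=.
  by move=> [? /andP[? ?]]; split => //; apply/andP; split; lra.
by move=> [? /andP[? ?]]; split => //; apply/andP; split; lra.
Qed.

Lemma integral_circle_lebesgue (g : circle R -> \bar R) :
  (forall p, 0 <= g p)%E -> measurable_fun setT g ->
  (\int[@circle_lebesgue R]_p g p = \int[leb]_(x in `[0%R, 1%R[) g (circle_pi x))%E.
Proof.
move=> g0 mg.
rewrite (@integral_transfer _ _ _ _ _ leb (@circle_lebesgue R) (@circle_pi R)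
  `[0%R, 1%R[%classic (fun=> 1))//.
- by apply: eq_integral => x _; rewrite mule1.
- exact: measurable_circle_pi.
- move=> A mA; rewrite integral_cst ?mul1e; first by rewrite setIC.
  apply: measurableI; first exact: measurable_itv.
  by rewrite -[X in measurable X]setTI; exact: measurable_circle_pi.
Qed.

End branches.

(* A lift of the circle map together with a reparametrization [param] of the
   line such that [param] pushes the uniform law on [0, 1[ to the invariant
   measure and [fwd = blift \o param] is increasing, of inverse [bwd].  The [i]-th
   preimage of [y] is then [param (bwd (y + i))], for [i < deg]. *)
Record branch_system (R : realType) (F : circle R -> circle R) (rho : circle R -> R)
    (mu : probability (circle R) R) := BranchSystem {
  blift : R -> R;
  sgn : R;
  deg : nat;
  param : R -> R;
  fwd : R -> R;
  bwd : R -> R;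
  slope := map_deriv F \o @circle_pi R;
  dens := rho \o @circle_pi R;
  sgn_unit : sgn = 1 \/ sgn = -1;
  blift_pi : forall x, circle_pi (blift x) = F (circle_pi x);
  blift_lip_derive : has_lip_derive blift slope;
  slope_lip : lipschitz_fun slope;
  slope_bounded : bounded_function slope;
  slope_gt1 : forall x, 1 < sgn * slope x;
  dens_lip : lipschitz_fun dens;
  dens_bounded : bounded_function dens;
  dens_lbound : exists2 m : R, 0 < m & forall x, m <= dens x;
  param_lip : lipschitz_fun param;
  param_pi1 : forall u, circle_pi (param (u + 1)) = circle_pi (param u);
  param_law : forall A, measurable A ->
    mu A = lebesgue_measure ([set u | A (circle_pi (param u))] `&` `[0, 1[);
  fwdE : forall u, fwd u = blift (param u);
  fwd1 : forall u, fwd (u + 1) = fwd u + deg%:R;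
  fwd_bilip : bilipschitz fwd;
  bwd_bilip : bilipschitz bwd;
  fwdK : cancel fwd bwd;
  bwdK : cancel bwd fwd;
  fwd_lip_derive : has_lip_derive fwd (fun u => sgn * slope (param u) / dens (param u));
  bwd_derive := fun y => dens (param (bwd y)) / (sgn * slope (param (bwd y)));
  bwd_lip_derive : has_lip_derive bwd bwd_derive;
  bwd_arc : forall a b, a < b -> b <= a + 1 ->
    mu (circle_arc a b) = (\sum_(i < deg) (bwd (b + i%:R) - bwd (a + i%:R)))%:E;
  bwd_derive_sum : forall y, \sum_(i < deg) bwd_derive (y + i%:R) = dens y }.

(** * Construction of the branches from the invariant density *)

Section branch_system_exists.
Variable R : realType.
Variables (F : circle R -> circle R) (rho : circle R -> R) (mu : probability (circle R) R).
Hypotheses (F_C2 : C2_map F) (F_exp : expanding F).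
Hypotheses (rho_gt0 : forall x, 0 < rho x) (rho_C1 : C1_fun rho).
Hypotheses (mu_rho : has_density mu rho) (mu_inv : invariant_measure F mu).
Local Notation leb := (@lebesgue_measure R).
Implicit Types (a b u x y : R).

Let r := rho \o @circle_pi R.

Let cr : continuous r.
Proof. by case: (C1_fun_lipschitz rho_C1) => /continuous_comp_circle_pi. Qed.

Let r_lbound : exists2 m : R, 0 < m & forall x, m <= r x.
Proof. by apply: periodic_gt0_lbound; [exact: pi_periodic|exact: cr|move=> x; exact: rho_gt0]. Qed.

Let mrho : measurable_fun setT rho.
Proof.
apply: measurable_fun_circle.
exact: (continuous_measurable_fun cr).
Qed.

Lemma density_integral A : measurable A ->
  mu A = (\int[leb]_(x in `[0%R, 1%R[ `&` @circle_pi R @^-1` A) (r x)%:E)%E.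
Proof.
move=> mA; rewrite mu_rho// integral_mkcond.
have mr : measurable_fun A (fun p => (rho p)%:E).
  by apply: measurable_funTS; exact/measurable_EFinP.
rewrite integral_circle_lebesgue; last 2 first.
- by move=> p; rewrite erestrict_ge0// => q _; rewrite lee_fin ltW.
- by case: (measurable_restrictT (fun p => (rho p)%:E) mA) => + _; exact.
rewrite [RHS]integral_mkcondr; apply: eq_integral => x _.
by rewrite /patch (_ : (circle_pi x \in A) = (x \in @circle_pi R @^-1` A)).
Qed.

Lemma cdf_exists : exists cdf : R -> R, [/\ cdf 0 = 0, bilipschitz cdf,
  forall x, is_derive x (1 : R) cdf (r x) & forall x, cdf (x + 1) = cdf x + 1].
Proof.
have [cdf c0 dc] := antiderivative cr.
have [m m0 rm] := r_lbound; have [M M0 rM] := periodic_bounded (pi_periodic rho) cr.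
exists cdf; split => //.
  apply: (derive_bilipschitz (c := m) (C := M) dc) => // x; rewrite rm /=.
  by rewrite (le_trans (ler_norm _))// rM.
have c1 : cdf 1 = 1.
  have := @density_integral setT measurableT.
  rewrite probability_setT preimage_setT setIT (integral_derive cr dc ler01) c0 subr0.
  by move=> -[].
pose g x := cdf (x + 1) - cdf x.
have dg x : is_derive x (1 : R) g 0.
  rewrite -(subrr (r x)); apply: is_deriveB.
  by apply: (@is_derive_shift_comp _ cdf _ _ 1) => //; rewrite /r -(pi_periodic rho).
move=> x; have : g x = g 0 by exact: is_derive_0_is_cst.
by rewrite /g add0r c1 c0; lra.
Qed.

(** Sampling by the quantile function: [G], inverse of the distribution function, carries the
    uniform law to [mu]. *)
Lemma cdf_law (cdf G : R -> R) A : cdf 0 = 0 -> cdf 1 = 1 -> bilipschitz cdf ->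
  (forall x, is_derive x (1 : R) cdf (r x)) -> cancel cdf G -> cancel G cdf ->
  continuous G -> measurable A ->
  mu A = leb ([set u | A (circle_pi (G u))] `&` `[0, 1[).
Proof.
move=> c0 c1 bc dc cK GK cG mA; rewrite (density_integral mA).
rewrite (@lebesgue_change_of_variables R cdf r)//.
- congr (integral _ _ _); apply/seteqP; split=> x /=; rewrite !in_itv /= cK.
    by move=> [/andP[x0 x1] Ax]; split => //; rewrite -c0 -c1 bilipschitz_leE// bilipschitz_ltE// x0.
  by rewrite -{1}c0 -{1}c1 bilipschitz_leE// bilipschitz_ltE// => -[Ax ?]; split.
- by move=> x; rewrite ltW// rho_gt0.
- apply: measurableI; last exact: measurable_itv.
  rewrite (_ : [set u | _] = G @^-1` (@circle_pi R @^-1` A))//.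
  rewrite -[X in measurable X]setTI; apply: (continuous_measurable_fun cG) => //.
  by rewrite -[X in measurable X]setTI; exact: measurable_circle_pi.
Qed.

Lemma is_derive_shift_sum n (H dH : R -> R) y :
  (forall x, is_derive x (1 : R) H (dH x)) ->
  is_derive y (1 : R) (fun x => \sum_(i < n) H (x + i%:R)) (\sum_(i < n) dH (y + i%:R)).
Proof.
move=> dHE; elim: n => [|n IH].
  by under eq_fun do rewrite big_ord0; rewrite big_ord0; exact: is_derive_cst.
under eq_fun do rewrite big_ord_recr /=; rewrite big_ord_recr /=.
by apply: is_deriveD => //; apply: (@is_derive_shift_comp _ H _ _ n%:R).
Qed.

Lemma branch_system_exists : inhabited (branch_system F rho mu).
Proof.
have [cF dF F'C1] := F_C2.
pose phi := map_deriv F \o @circle_pi R.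
have [cF' lphi bphi] := C1_fun_lipschitz F'C1.
have cphi : continuous phi by exact: continuous_comp_circle_pi.
have [s sE sphi] := constant_sign cphi (fun x => F_exp (circle_pi x)).
have s2 : s * s = 1 by case: sE => ->; rewrite ?mul1r// mulrNN mulr1.
have [f df fF] := circle_lift dF cF'.
have [n fn] := lift_degree df fF.
have [_ lr br] := C1_fun_lipschitz rho_C1.
have [m m0 rm] := r_lbound.
have [M M0 rM] := br.
have r0 x : 0 < r x by exact: lt_le_trans (rm x).
have Mgt0 : 0 < M by rewrite (lt_le_trans (r0 0))// (le_trans (ler_norm _))// rM.
have [C C0 hphi] := bphi.
have sphiC x : s * phi x <= C.
  apply: le_trans (hphi x); case: sE => ->; rewrite ?mul1r ?mulN1r ?ler_norm//.
  by rewrite -normrN ler_norm.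
have Cgt0 : 0 < C by rewrite (lt_le_trans ltr01)// (le_trans _ (sphiC 0))// ltW.
have [cdf [c0 bc dc cdf1]] := cdf_exists.
have c1 : cdf 1 = 1 by rewrite -[1 in LHS]add0r cdf1 c0 add0r.
have [G [cK GK bG]] := bilipschitz_inverse bc.
have G1 u : G (u + 1) = G u + 1 by rewrite -[RHS]cK cdf1 GK.
have GB1 u : G (u - 1) = G u - 1 by rewrite -[u in RHS](subrK 1) G1 addrK.
have lcdf := derive_has_lip_derive dc lr.
have lG := has_lip_derive_inverse lcdf m0 rm GK (bilipschitz_lip bG).
(* When [F] reverses orientation, running through the quantiles backwards makes [f \o gam]
   increasing all the same. *)
pose gam u := G (s * u).
have lgam : lipschitz_fun gam.
  apply: lipschitz_comp (bilipschitz_lip bG) _.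
  exists 1 => // x y; rewrite -mulrBr normrM mul1r.
  by case: sE => ->; rewrite ?normrN normr1 mul1r.
have dgam u : is_derive u (1 : R) gam (s / r (gam u)).
  have ds : is_derive u (1 : R) (fun u => s * u) s.
    have := @is_deriveZ _ _ _ id s u 1 1 (is_derive_id _ _).
    by rewrite [s *: 1]mulr1.
  rewrite mulrC; apply: (@is_derive1_comp R G (fun u => s * u) u) => //.
  exact: has_lip_derive_is_derive lG.
have gam1 u : gam (u + 1) = gam u + s.
  by rewrite /gam mulrDr mulr1; case: sE => ->; rewrite ?G1 ?GB1.
have gampi u : circle_pi (gam (u + 1)) = circle_pi (gam u).
  rewrite gam1; case: sE => ->; first exact: (circle_piDn _ 1).
  by rewrite -(circle_piDn _ 1) subrK.
pose E u := f (gam u).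
pose e u := s * phi (gam u) / r (gam u).
have dE u : is_derive u (1 : R) E (e u).
  rewrite /e mulrAC mulrC.
  by apply: (@is_derive1_comp R f gam u) => //; rewrite -fF'.
have eM u : M^-1 <= e u.
  rewrite /e -[leLHS]mul1r ler_pM//; last 2 first.
  - exact: ltW (sphi _).
  - by rewrite lef_pV2 ?posrE// (le_trans (ler_norm _))// rM.
  by rewrite invr_ge0 ltW.
have eC u : e u <= C / m.
  rewrite /e ler_pM//.
  - by rewrite ltW// (lt_trans ltr01)// sphi.
  - by rewrite invr_ge0 ltW.
  - by rewrite lef_pV2 ?posrE.
have MV0 : 0 < M^-1 by rewrite invr_gt0.
have bE : bilipschitz E.
  by apply: (derive_bilipschitz (C := C / m) dE MV0) => u; rewrite eM eC.
have le : lipschitz_fun e.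
  apply: lipschitzM.
  - by apply: lipschitzZ; exact: lipschitz_comp lphi lgam.
  - exact: (boundedM (bounded_function_cst s) (bounded_comp gam bphi)).
  - apply: (@lipschitzV R (fun u => r (gam u)) m) => //; last exact: lipschitz_comp lr lgam.
    by move=> u; rewrite gtr0_norm.
  - by apply: (@boundedV R (fun u => r (gam u)) m) => // u; rewrite gtr0_norm.
have lE := derive_has_lip_derive dE le.
have [H [EK HK bH]] := bilipschitz_inverse bE.
have lH := has_lip_derive_inverse lE MV0 eM HK (bilipschitz_lip bH).
have fn' x : f (x - 1) = f x - n%:~R by rewrite -[x in RHS](subrK 1) fn addrK.
have Esn u : E (u + 1) = E u + s * n%:~R.
  by rewrite /E gam1; case: sE => ->; rewrite ?fn ?fn' ?mul1r ?mulN1r.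
(* Since [E] increases, [s] times the signed degree [n] is positive, hence equal to [|n|]. *)
have dn : s * n%:~R = (absz n)%:R.
  have : 0 < s * n%:~R.
    by have := bilipschitz_lt bE (ltr01 : (0 : R) < 1); rewrite -[1]add0r Esn; lra.
  case: sE => ->; rewrite ?mul1r ?mulN1r.
    by rewrite ltr0z => n0; rewrite -{1}(gtz0_abs n0).
  by rewrite oppr_gt0 ltrz0 => n0; rewrite -mulrNz -(ltz0_abs n0).
have E1 u : E (u + 1) = E u + (absz n)%:R by rewrite Esn dn.
have cG := lipschitz_continuous (bilipschitz_lip bG).
have law A : measurable A -> mu A = leb ([set u | A (circle_pi (gam u))] `&` `[0, 1[).
  move=> mA; rewrite (cdf_law c0 c1 bc dc cK GK cG mA).
  case: sE => sE.
    by congr (leb (_ `&` _)); apply/seteqP; split=> u; rewrite /= /gam sE mul1r.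
  (* In the orientation-reversing case, [gam] samples [mu] because reflection preserves the uniform
     law on the circle. *)
  rewrite -lebesgue_periodicN; last 2 first.
  - rewrite (_ : [set u | _] = G @^-1` (@circle_pi R @^-1` A))//.
    rewrite -[X in measurable X]setTI; apply: (continuous_measurable_fun cG) => //.
    by rewrite -[X in measurable X]setTI; exact: measurable_circle_pi.
  - by move=> u /=; rewrite G1 (circle_piDn _ 1).
  by congr (leb (_ `&` _)); apply/seteqP; split=> u; rewrite /= /gam sE mulN1r.
have mF := C2_map_measurable F_C2.
have arcH a b : a < b -> b <= a + 1 ->
    mu (circle_arc a b) = (\sum_(i < absz n) (H (b + i%:R) - H (a + i%:R)))%:E.
  move=> ab ba; rewrite -(mu_inv (measurable_circle_arc a b)) law; last first.
    by rewrite -[X in measurable X]setTI; apply: mF => //; exact: measurable_circle_arc.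
  rewrite -(lebesgue_arc bE bH EK HK E1 ab ba); congr (leb (_ `&` _)).
  by apply/seteqP; split=> u; rewrite /= -fF circle_arc_pi.
have arcG a b : a < b -> b <= a + 1 -> mu (circle_arc a b) = (cdf b - cdf a)%:E.
  move=> ab ba.
  rewrite (cdf_law c0 c1 bc dc cK GK cG (measurable_circle_arc a b)).
  have := @lebesgue_arc R G cdf 1%N a b bG bc GK cK G1 ab ba.
  rewrite big_ord1 !addr0 => <-; congr (leb (_ `&` _)).
  by apply/seteqP; split=> u; rewrite /= circle_arc_pi.
(* The fixed-point equation of the transfer operator. The mass of a short arc is an increment of the
   sum of branches by invariance, and of [cdf] by density. Hence [D] is locally constant, and
   differentiating gives the identity. *)
have dsum y : \sum_(i < absz n) (e (H (y + i%:R)))^-1 = r y.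
  pose D x := \sum_(i < absz n) H (x + i%:R) - cdf x.
  have Dab a b : a < b -> b <= a + 1 -> D b = D a.
    move=> ab ba; have := arcH a b ab ba; rewrite arcG// => -[].
    by rewrite sumrB /D; lra.
  have dH x : is_derive x (1 : R) H (e (H x))^-1 by exact: has_lip_derive_is_derive lH.
  have dD : is_derive y (1 : R) D (\sum_(i < absz n) (e (H (y + i%:R)))^-1 - r y).
    by apply: is_deriveB; exact: is_derive_shift_sum.
  have dD0 : is_derive y (1 : R) D 0.
    apply: (@near_eq_is_derive _ _ _ (fun=> D y)).
    near=> x.
    have xy : `|x - y| < 1.
      by near: x; apply: cvgr_distC_lt => //; exact: cvg_id.
    have [xly|yx|-> //] := ltgtP x y; last by rewrite (@Dab y x)//; move: xy; rewrite ltr_norml => /andP[_]; lra.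
    by rewrite (@Dab x y)//; move: xy; rewrite ltr_norml => /andP[]; lra.
  have := @derive_val _ _ _ _ _ _ _ dD; rewrite (@derive_val _ _ _ _ _ _ _ dD0).
  by move/esym/eqP; rewrite subr_eq0 => /eqP.
have eV y : (e (H y))^-1 = r (gam (H y)) / (s * phi (gam (H y))).
  by rewrite /e invf_div.
constructor.
apply: (@BranchSystem R F rho mu f s (absz n) gam E H) => //.
- exact: derive_has_lip_derive df lphi.
- by move: lH; congr has_lip_derive; apply/funext => y; rewrite eV.
- by move=> y; rewrite -[RHS](dsum y); apply: eq_bigr => i _; rewrite eV.
Unshelve. all: by end_near. Qed.

End branch_system_exists.

(** * The transfer operator *)

Section transfer_operator.
Variable R : realType.
Variables (F : circle R -> circle R) (rho : circle R -> R) (mu : probability (circle R) R).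
Variable S : branch_system F rho mu.
Local Notation leb := (@lebesgue_measure R).
Local Notation d := (deg S).
Implicit Types (u x y z : R) (v : circle R -> R).

Definition branch z : circle R := circle_pi (param S (bwd S z)).

Definition transfer v y : R := \sum_(i < d) rho (branch (y + i%:R)) * v (branch (y + i%:R)).

Lemma bwdDdeg y : bwd S (y + d%:R) = bwd S y + 1.
Proof. by rewrite -[RHS](fwdK S) fwd1 bwdK. Qed.

Lemma branchDdeg y : branch (y + d%:R) = branch y.
Proof. by rewrite /branch bwdDdeg param_pi1. Qed.

Lemma branchK z : F (branch z) = circle_pi z.
Proof. by rewrite /branch -(blift_pi S) -fwdE bwdK. Qed.

Lemma measurable_branch : measurable_fun setT branch.
Proof.
apply: measurableT_comp (@measurable_circle_pi R) _; apply: continuous_measurable_fun.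
exact/lipschitz_continuous/(lipschitz_comp (param_lip S) (bilipschitz_lip (bwd_bilip S))).
Qed.

Lemma sum_shift1 (T : nmodType) n (g : R -> T) y : (forall z, g (z + n%:R) = g z) ->
  \sum_(i < n) g (y + 1 + i%:R) = \sum_(i < n) g (y + i%:R).
Proof.
case: n => [|n] gn; first by rewrite !big_ord0.
rewrite big_ord_recr [RHS]big_ord_recl /= addr0 [RHS]addrC; congr (_ + _).
  by apply: eq_bigr => i _; rewrite -addrA -natr1 [1 + _]addrC.
by rewrite -addrA nat1r gn.
Qed.

Lemma transfer1 v y : transfer v (y + 1) = transfer v y.
Proof.
apply: (sum_shift1 (g := fun z => rho (branch z) * v (branch z))) => z.
by rewrite branchDdeg.
Qed.

Lemma bwd_derive_gt0 : exists2 q, 0 < q & forall y, q <= bwd_derive S y.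
Proof.
have [m m0 rm] := dens_lbound S; have [C C0 hC] := slope_bounded S.
have sC x : sgn S * slope S x <= C.
  apply: le_trans (hC x); case: (sgn_unit S) => ->; rewrite ?mul1r ?mulN1r ?ler_norm//.
  by rewrite -normrN ler_norm.
have Cgt0 : 0 < C by rewrite (lt_le_trans ltr01)// (le_trans _ (sC 0))// ltW// slope_gt1.
exists (m / C); first by rewrite divr_gt0.
move=> y; rewrite /bwd_derive ler_pM//; [exact: ltW|by rewrite invr_ge0 ltW|].
by rewrite lef_pV2 ?posrE// (lt_trans ltr01)// slope_gt1.
Qed.

Lemma bwd_derive_ge0 y : 0 <= bwd_derive S y.
Proof. by have [q q0 h] := bwd_derive_gt0; rewrite (le_trans (ltW q0)). Qed.

Lemma bwd_derive_lip : lipschitz_fun (bwd_derive S) /\ bounded_function (bwd_derive S).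
Proof.
have lp := lipschitz_comp (param_lip S) (bilipschitz_lip (bwd_bilip S)).
have sn y : 1 <= `|sgn S * slope S (param S (bwd S y))|.
  by rewrite (le_trans _ (ler_norm _))// ltW// slope_gt1.
have bs := bounded_comp (fun y => param S (bwd S y)) (slope_bounded S).
have br := bounded_comp (fun y => param S (bwd S y)) (dens_bounded S).
have bV := boundedV ltr01 sn.
split; last exact: boundedM br bV.
apply: lipschitzM => //; first exact: lipschitz_comp (dens_lip S) lp.
apply: (lipschitzV ltr01 sn); apply: lipschitzZ; exact: lipschitz_comp (slope_lip S) lp.
Qed.

Lemma integral_unit_split (k : R -> \bar R) n : measurable_fun setT k ->
  (forall y, 0 <= k y)%E ->
  (\int[leb]_(y in `[0%R, n%:R[) k y =
   \sum_(i < n) \int[leb]_(y in `[0%R, 1%R[) k (y + i%:R)%R)%E.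
Proof.
move=> mk k0; elim: n => [|n IH].
  by rewrite big_ord0 set_itv_ge ?integral_set0// bnd_simp ltxx.
have msh : measurable_fun [set: R] (fun y : R => y + n%:R) by exact: measurable_funD.
rewrite big_ord_recr /= -IH.
have -> : (\int[leb]_(y in `[0%R, 1%R[) k (y + n%:R)%R =
    \int[leb]_(y in `[n%:R, n.+1%:R[) k y)%E.
  rewrite [RHS]integral_mkcond.
  rewrite (@integral_transfer _ _ _ _ _ leb leb (fun y : R => y + n%:R) setT (fun=> 1))//; last 3 first.
  - move=> A mA; rewrite setTI integral_cst ?mul1e; first exact: lebesgue_measure_shift.
    by rewrite -[X in measurable X]setTI; exact: msh.
  - by move=> y; rewrite erestrict_ge0.
  - apply/(measurable_restrictT _ _).1; [exact: measurable_itv|exact: measurable_funTS].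
  rewrite [LHS]integral_mkcond; apply: eq_integral => y _; rewrite mule1 /patch.
  rewrite (_ : (y \in _) = (y + n%:R \in `[n%:R, n.+1%:R[%classic))//.
  by apply/idP/idP; rewrite !inE /= !in_itv /= -natr1 => /andP[? ?]; apply/andP; split; lra.
rewrite -ge0_integral_setU//=.
- congr (integral _ _ _); apply/seteqP; split=> x /=; rewrite !in_itv /= -natr1.
    by move=> /andP[? ?]; have [?|?] := ltP x n%:R; [left|right]; apply/andP.
  have := ler0n R n => ? [|] /andP[? ?]; apply/andP; split; lra.
- exact: measurable_funTS.
- apply/disj_set2P/seteqP; split => // x [] /=; rewrite !in_itv /= => /andP[_ h1] /andP[h2 _].
  by move: h1; rewrite ltNge h2.
Qed.

(* The weights [bwd_derive (y + i) / rho y] are the conditional probabilities of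
   the preimages of [y] under the invariant measure. *)
Lemma integral_branch (f : circle R -> R) : measurable_fun setT f ->
  (forall p, 0 <= f p) ->
  (\int[mu]_p (f p)%:E = \int[leb]_(y in `[0%R, 1%R[)
     (\sum_(i < d) bwd_derive S (y + i%:R) * f (branch (y + i%:R)))%:E)%E.
Proof.
move=> mf f0; pose g u := circle_pi (param S u).
have mg : measurable_fun setT g.
  apply: measurableT_comp (@measurable_circle_pi R) _; apply: continuous_measurable_fun.
  exact/lipschitz_continuous/(param_lip S).
have mgA A : measurable A -> measurable [set u | A (g u)].
  by move=> mA; rewrite -[X in measurable X]setTI; exact: mg.
have H0d : bwd S d%:R = bwd S 0 + 1 by rewrite -bwdDdeg add0r.
have mEf : measurable_fun setT (fun p => (f p)%:E) by exact/measurable_EFinP.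
have mfg : measurable_fun setT (fun u => (f (g u))%:E).
  by apply/measurable_EFinP; exact: measurableT_comp.
(* By periodicity the unit window may start at [bwd S 0]: it then is the image under [bwd] of [[0,
   d[], which will be cut into [d] unit intervals. *)
have -> : (\int[mu]_p (f p)%:E =
    \int[leb]_(u in `[bwd S 0%R, bwd S d%:R[) (f (g u))%:E)%E.
  rewrite (@integral_transfer _ _ _ _ _ leb mu g `[bwd S 0, bwd S d%:R[%classic (fun=> 1))//.
  - by apply: eq_integral => u _; rewrite mule1.
  - move=> A mA; rewrite integral_cst ?mul1e; last by apply: measurableI => //; exact: mgA.
    apply: (eq_trans (param_law S mA)); rewrite [X in _ = leb X]setIC H0d.
    apply/esym/lebesgue_periodic; first exact: mgA.
    by move=> u /=; rewrite /g param_pi1.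
have [bdl _] := bwd_derive_lip.
have mbd : measurable_fun [set: R] (bwd_derive S).
  by apply: continuous_measurable_fun; exact: lipschitz_continuous.
have mH : measurable_fun [set: R] (bwd S).
  by apply: continuous_measurable_fun; exact/lipschitz_continuous/bilipschitz_lip/bwd_bilip.
rewrite integral_mkcond.
rewrite (@integral_transfer _ _ _ _ _ leb leb (bwd S) setT (bwd_derive S))//; first last.
- apply/(measurable_restrictT _ _).1; [exact: measurable_itv|exact: measurable_funTS].
- by move=> u; rewrite erestrict_ge0// => ? _; rewrite lee_fin.
- move=> A mA; rewrite setTI; apply: lebesgue_change_of_variables => //.
  + exact: bwd_bilip.
  + by move=> x; exact: has_lip_derive_is_derive (bwd_lip_derive S).
  + exact: lipschitz_continuous.
  + exact: bwd_derive_ge0.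
- exact: bwd_derive_ge0.
transitivity (\int[leb]_(y in `[0%R, d%:R[) (bwd_derive S y * f (branch y))%:E)%E.
  rewrite [RHS]integral_mkcond; apply: eq_integral => y _; rewrite /patch.
  rewrite (_ : (y \in _) = (bwd S y \in `[bwd S 0, bwd S d%:R[%classic)); last first.
    by apply/idP/idP; rewrite !inE /= !in_itv /= bilipschitz_leE ?bilipschitz_ltE//; exact: bwd_bilip.
  by case: ifP => _; rewrite ?mul0e// -EFinM mulrC.
have mk : measurable_fun [set: R] (fun y => bwd_derive S y * f (branch y)).
  by apply: measurable_funM => //; apply: measurableT_comp => //; exact: measurable_branch.
have k0 y : 0 <= bwd_derive S y * f (branch y) by rewrite mulr_ge0// bwd_derive_ge0.
rewrite integral_unit_split; [|exact/measurable_EFinP|by move=> y; rewrite lee_fin].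
rewrite -ge0_integral_sum//.
- by apply: eq_integral => y _; rewrite sumEFin.
- move=> i; apply: measurable_funTS; apply/measurable_EFinP.
  apply: (@measurableT_comp _ _ _ _ _ _ (fun y => bwd_derive S y * f (branch y)) _ (fun y : R => y + i%:R)) => //.
  exact: measurable_funD.
- by move=> i y _; rewrite lee_fin.
Qed.

End transfer_operator.

(** * Square integrals and signed integrands *)

Section square_integrals.
Variable R : realType.
Implicit Types (m : probability (circle R) R) (u v w : circle R -> R) (e : R).

Definition sqnorm m u : \bar R := (\int[m]_x ((u x) ^+ 2)%:E)%E.

Lemma measurable_sqr u : measurable_fun setT u ->
  measurable_fun setT (fun x => ((u x) ^+ 2)%:E).
Proof. by move=> mu; apply/measurable_EFinP; exact: measurable_funX. Qed.

Lemma sqnorm_ge0 m u : (0 <= sqnorm m u)%E.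
Proof. by apply: integral_ge0 => x _; rewrite lee_fin sqr_ge0. Qed.

Lemma Lnorm_sqnorm m u : ('N[m]_2%:E [EFin \o u] `^ 2 = sqnorm m u)%E.
Proof.
rewrite powR_Lnorm//; apply: eq_integral => x _ /=.
by rewrite powR_mulrn// real_normK ?num_real.
Qed.

Lemma Lnorm_lt m u e : 0 < e ->
  ('N[m]_2%:E [EFin \o u] < e%:E)%E = (sqnorm m u < (e ^+ 2)%:E)%E.
Proof.
move=> e0; rewrite -Lnorm_sqnorm; have := Lnorm_ge0 m 2%:E (EFin \o u).
case: ('N[m]_2%:E [EFin \o u])%E => [r| |]//= r0.
  rewrite !lte_fin powR_mulrn// ltr_pXn2r// nnegrE// ltW//.
by rewrite gt_eqF//.
Qed.

Lemma L2_dist_lt m (u v : {mfun circle R >-> R}) e : 0 < e ->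
  (L2_dist m u v < e%:E)%E = (sqnorm m (fun x => u x - v x)%R < (e ^+ 2)%:E)%E.
Proof. exact: Lnorm_lt. Qed.

Lemma L2P m (v : {mfun circle R >-> R}) : L2 m v <-> (sqnorm m v < +oo)%E.
Proof.
rewrite -Lnorm_sqnorm; split=> [vL|h].
  have vf : finite_norm m 2%:E v by exact: (set_mem (sub_Lfun_finLfun vL)).
  exact: (poweR_lty 2 vf).
apply/andP; split; first exact: mfunP.
apply: mem_set; exact: (lty_poweRy _ h).
Qed.

Lemma le_sqnorm m u v c : measurable_fun setT u -> measurable_fun setT v ->
  0 <= c -> (forall x, `|u x| <= c * `|v x|) ->
  (sqnorm m u <= (c ^+ 2)%:E * sqnorm m v)%E.
Proof.
move=> mu mv c0 uv; rewrite /sqnorm -ge0_integralZl//.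
- apply: ge0_le_integral => //.
  + by move=> x _; rewrite lee_fin sqr_ge0.
  + exact: measurable_sqr.
  + by apply: emeasurable_funM => //; exact: measurable_sqr.
  + move=> x _; rewrite -EFinM lee_fin -exprMn.
    rewrite -[leLHS]real_normK ?num_real// -[leRHS]real_normK ?num_real//.
    by rewrite lerXn2r ?nnegrE// normrM (ger0_norm c0).
- exact: measurable_sqr.
- by move=> x _; rewrite lee_fin sqr_ge0.
- by rewrite lee_fin sqr_ge0.
Qed.

Lemma sqnormD m u v w : measurable_fun setT u -> measurable_fun setT v ->
  measurable_fun setT w -> (forall x, `|u x| <= `|v x| + `|w x|) ->
  (sqnorm m u <= 2%:E * sqnorm m v + 2%:E * sqnorm m w)%E.
Proof.
move=> mu mv mw uvw; rewrite /sqnorm -!ge0_integralZl//; last 4 first.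
- exact: measurable_sqr.
- by move=> x _; rewrite lee_fin sqr_ge0.
- exact: measurable_sqr.
- by move=> x _; rewrite lee_fin sqr_ge0.
have mZ (f : circle R -> R) : measurable_fun setT f -> measurable_fun setT (fun x : circle R => (2%:E * (f x ^+ 2)%:E)%E).
  by move=> mf; apply: emeasurable_funM => //; exact: measurable_sqr.
rewrite -ge0_integralD//; last 4 first.
- by move=> x _; rewrite -EFinM lee_fin mulr_ge0 ?sqr_ge0.
- exact: mZ.
- by move=> x _; rewrite -EFinM lee_fin mulr_ge0 ?sqr_ge0.
- exact: mZ.
apply: ge0_le_integral => //.
- by move=> x _; rewrite lee_fin sqr_ge0.
- exact: measurable_sqr.
- by apply: emeasurable_funD; exact: mZ.
move=> x _; rewrite -!EFinM -EFinD lee_fin.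
rewrite -[leLHS]real_normK ?num_real// -[v x ^+ 2]real_normK ?num_real//.
rewrite -[w x ^+ 2]real_normK ?num_real//.
apply: (@le_trans _ _ ((`|v x| + `|w x|) ^+ 2)).
  by rewrite lerXn2r ?nnegrE ?addr_ge0.
by have := sqr_ge0 (`|v x| - `|w x|); lra.
Qed.

Lemma sqnorm_bounded m u c : measurable_fun setT u -> (forall x, `|u x| <= c) ->
  (sqnorm m u <= (c ^+ 2)%:E)%E.
Proof.
move=> mu uc; have c0 : 0 <= c by apply: le_trans (uc 0).
have := @le_sqnorm m u (fun=> 1) c mu (measurable_cst _) c0.
have -> : sqnorm m (fun=> 1) = 1%E.
  rewrite /sqnorm; under eq_integral do rewrite expr1n.
  by rewrite integral_cst// mul1e; exact: probability_setT.
by rewrite mule1; apply => x; rewrite normr1 mulr1.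
Qed.

Lemma integrable_mul m u v : measurable_fun setT u -> measurable_fun setT v ->
  (sqnorm m u < +oo)%E -> (sqnorm m v < +oo)%E ->
  m.-integrable setT (EFin \o (fun x => u x * v x)).
Proof.
move=> mu mv fu fv.
have iu w : measurable_fun setT w -> (sqnorm m w < +oo)%E ->
    m.-integrable setT (fun x => ((w x) ^+ 2)%:E).
  move=> mw fw; apply/integrableP; split; first exact: measurable_sqr.
  by under eq_integral do rewrite /= ger0_norm ?sqr_ge0//.
apply: (le_integrable measurableT _ _ (integrableD measurableT (iu u mu fu) (iu v mv fv))).
  by apply/measurable_EFinP; exact: measurable_funM.
move=> x _ /=; rewrite lee_fin [leRHS]ger0_norm ?addr_ge0 ?sqr_ge0//.
by rewrite ler_norml; apply/andP; split; nra.
Qed.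

(** The variance is nonnegative: expand the integral of [(u - a) ^+ 2], where [a] is the mean of
    [u]. *)
Lemma Rintegral_sqr m u : measurable_fun setT u -> (sqnorm m u < +oo)%E ->
  (((\int[m]_x u x) ^+ 2)%:E <= sqnorm m u)%E.
Proof.
move=> mu fu.
have iu2 : m.-integrable setT (EFin \o (fun x => u x * u x)) by exact: integrable_mul.
have f1 : (sqnorm m (fun=> 1%R) < +oo)%E.
  by rewrite (le_lt_trans (@sqnorm_bounded m _ 1 _ _)) ?ltry// => x; rewrite normr1.
have iu : m.-integrable setT (EFin \o u).
  have := integrable_mul mu (measurable_cst (1 : R)) fu f1.
  by apply: eq_integrable => // x _ /=; rewrite mulr1.
set a := \int[m]_x u x.
have i1 : m.-integrable setT (EFin \o (fun=> a ^+ 2)).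
  by apply: finite_measure_integrable_cst.
have iau : m.-integrable setT (EFin \o (fun x => 2 * a * u x)).
  have := integrableZl measurableT (2 * a) iu.
  by apply: eq_integrable => // x _ /=.
have : 0 <= \int[m]_x (u x * u x - 2 * a * u x + a ^+ 2).
  apply: Rintegral_ge0 => x _.
  rewrite (_ : _ + _ = (u x - a) ^+ 2) ?sqr_ge0//; ring.
have i2 : m.-integrable setT (EFin \o (fun x => u x * u x - 2 * a * u x)).
  by have := integrableB measurableT iu2 iau; apply: eq_integrable.
rewrite RintegralD// RintegralB// RintegralZl// Rintegral_cst// -/a.
rewrite [X in fine X]probability_setT mulr1 => h.
have <- : (\int[m]_x (u x * u x))%:E = sqnorm m u.
  rewrite /Rintegral fineK; first by apply: eq_integral => x _; rewrite expr2.
  exact: integrable_fin_num.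
by rewrite lee_fin; move: h; lra.
Qed.

End square_integrals.

(** Extends an integration formula from nonnegative to integrable functions. The transform [W]
    stands for multiplication by a density or for a sum over branches; compatibility with
    differences lets positive and negative parts be treated separately. *)
Lemma Rintegral_signed d1 d2 (T1 : measurableType d1) (T2 : measurableType d2)
    (R : realType) (m1 : {measure set T1 -> \bar R}) (m2 : {measure set T2 -> \bar R})
    (D : set T2) (W : (T1 -> R) -> T2 -> R) (f : T1 -> R) : measurable D ->
  (forall g : T1 -> R, measurable_fun setT g -> (forall x, 0 <= g x) ->
    [/\ measurable_fun D (W g), forall y, 0 <= W g y &
        (\int[m1]_x (g x)%:E = \int[m2]_(y in D) (W g y)%:E)%E]) ->
  (forall g h y, W (fun x => g x - h x) y = W g y - W h y) ->
  m1.-integrable setT (EFin \o f) ->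
  \int[m1]_x f x = \int[m2]_(y in D) W f y.
Proof.
move=> mD HW WB fi; have mf : measurable_fun setT f.
  by apply/measurable_EFinP; exact: measurable_int fi.
pose fp x := Num.max (f x) 0; pose fn x := Num.max (- f x) 0.
have mfp : measurable_fun setT fp by apply: measurable_maxr.
have mfn : measurable_fun setT fn by apply: measurable_maxr => //; exact: measurableT_comp.
have fp0 x : 0 <= fp x by rewrite le_max lexx orbT.
have fn0 x : 0 <= fn x by rewrite le_max lexx orbT.
have fE : f = fun x => fp x - fn x.
  apply/funext => x; rewrite /fp /fn; have [h|] := boolP (0 <= f x).
    by rewrite max_l// max_r ?oppr_le0// subr0.
  rewrite -ltNge => /ltW h.
  by rewrite max_r// max_l ?oppr_ge0// sub0r opprK.
have ip : m1.-integrable setT (EFin \o fp).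
  apply: (le_integrable measurableT _ _ fi); first exact/measurable_EFinP.
  by move=> x _ /=; rewrite lee_fin ger0_norm// ge_max ler_norm normr_ge0.
have ine : m1.-integrable setT (EFin \o fn).
  apply: (le_integrable measurableT _ _ fi); first exact/measurable_EFinP.
  by move=> x _ /=; rewrite lee_fin ger0_norm// ge_max -normrN ler_norm normr_ge0.
have H (g : T1 -> R) : measurable_fun setT g -> (forall x, 0 <= g x) ->
    m1.-integrable setT (EFin \o g) -> m2.-integrable D (EFin \o W g).
  move=> mg g0 ig; have [mW W0 WE] := HW g mg g0.
  apply/integrableP; split; first exact/measurable_EFinP.
  under eq_integral do rewrite /= ger0_norm//.
  rewrite -WE; have /integrableP[_] := ig.
  by under eq_integral do rewrite /= ger0_norm//.
have [_ _ Ep] := HW fp mfp fp0; have [_ _ En] := HW fn mfn fn0.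
have -> : \int[m2]_(y in D) W f y = \int[m2]_(y in D) (W fp y - W fn y).
  by apply: eq_Rintegral => y _; rewrite {1}fE WB.
rewrite RintegralB//; [|exact: H|exact: H].
rewrite {1}fE RintegralB// /Rintegral.
by congr (fine _ - fine _).
Qed.

(** The crude constant comes from iterating [(s + a) ^+ 2 <= 2 * s ^+ 2 + 2 * a ^+ 2]; what matters
    is that it depends on [n] alone. *)
Lemma sqr_sum_le (R : realType) n (a : nat -> R) :
  (\sum_(i < n) a i) ^+ 2 <= 2 ^+ n * \sum_(i < n) a i ^+ 2.
Proof.
elim: n => [|n IH]; first by rewrite !big_ord0 expr0n mulr0.
rewrite !big_ord_recr /= [2 ^+ n.+1]exprS; set s := \sum_(i < n) a i in IH *.
set t := \sum_(i < n) _ in IH *.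
have t0 : 0 <= t by apply: sumr_ge0 => i _; exact: sqr_ge0.
have e1 : 1 <= 2 ^+ n :> R by rewrite exprn_ege1// ler1n.
have h : 0 <= (2 ^+ n - 1) * a n ^+ 2 by rewrite mulr_ge0 ?sqr_ge0// subr_ge0.
have := sqr_ge0 (s - a n); move: IH h; set e := 2 ^+ n; lra.
Qed.

(** * The derivative, its adjoint and their L^2 bounds *)

Section derivative_operator.
Variable R : realType.
Variables (F : circle R -> circle R) (rho : circle R -> R) (mu : probability (circle R) R).
Hypotheses (F_C2 : C2_map F).
Hypotheses (rho_gt0 : forall x, 0 < rho x) (rho_C1 : C1_fun rho).
Hypotheses (mu_rho : has_density mu rho) (mu_inv : invariant_measure F mu).
Variable S : branch_system F rho mu.
Local Notation leb := (@lebesgue_measure R).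
Local Notation d := (deg S).
Local Notation F' := (map_deriv F).
Implicit Types (x y z : R) (u v : circle R -> R) (p : circle R).

Let mF : measurable_fun setT F. Proof. exact: C2_map_measurable. Qed.

Let measurable_lip (g : circle R -> R) : lipschitz_fun (g \o @circle_pi R) ->
  measurable_fun setT g.
Proof.
move=> lg; apply: measurable_fun_circle; apply: continuous_measurable_fun.
exact: lipschitz_continuous.
Qed.

Let mF' : measurable_fun setT F'.
Proof. exact: measurable_lip (slope_lip S). Qed.

Let mrho : measurable_fun setT rho.
Proof. exact: measurable_lip (dens_lip S). Qed.

Lemma rho_lbound : exists2 m, 0 < m & forall p, m <= rho p.
Proof.
by have [m m0 rm] := dens_lbound S; exists m => // p; rewrite -(circle_reprK p); exact: rm.
Qed.

Lemma rho_ubound : exists2 M, 0 < M & forall p, rho p <= M.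
Proof.
have [M M0 rM] := dens_bounded S; exists (M + 1) => [|p]; first lra.
rewrite -(circle_reprK p); have := rM (circle_repr p).
by rewrite /dens /=; have := ler_norm (rho (circle_pi (circle_repr p))); lra.
Qed.

Lemma F'_bound : exists2 C, 0 < C & forall p, `|F' p| <= C.
Proof.
have [C C0 hC] := slope_bounded S; exists (C + 1) => [|p]; first lra.
by rewrite -(circle_reprK p); have := hC (circle_repr p); rewrite /slope /=; lra.
Qed.

Lemma measurable_rhoV : measurable_fun setT (fun p => (rho p)^-1).
Proof.
apply: measurable_lip; have [m m0 rm] := dens_lbound S.
apply: (lipschitzV m0 _ (dens_lip S)) => x.
by rewrite (le_trans (rm x))// ler_norm.
Qed.

Lemma integral_density (f : circle R -> R) : measurable_fun setT f -> (forall p, 0 <= f p) ->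
  (\int[mu]_p (f p)%:E =
   \int[leb]_(y in `[0%R, 1%R[) (f (circle_pi y) * rho (circle_pi y))%:E)%E.
Proof.
move=> mf f0.
rewrite (@integral_transfer _ _ _ _ _ leb mu (@circle_pi R) `[0, 1[%classic
  (rho \o @circle_pi R))//.
- exact: measurable_circle_pi.
- by apply: measurableT_comp => //; exact: measurable_circle_pi.
- by move=> x; rewrite /= ltW.
- by move=> A mA; exact: density_integral.
- exact/measurable_EFinP.
Qed.

(** The conditional expectation of [F' * v] given [F], at the point [p] of the target. The factor
    [F'] cancels the one in the denominator of [bwd_derive], up to the sign; hence no slope appears
    in [transfer]. *)
Definition transfer0 v p : R := sgn S * transfer S v (circle_repr p) / rho p.

Lemma transfer0_pi v y : transfer0 v (circle_pi y) = sgn S * transfer S v y / rho (circle_pi y).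
Proof. by rewrite /transfer0 (periodic_circle_repr (transfer1 S v)). Qed.

Lemma measurable_transfer v : measurable_fun setT v -> measurable_fun setT (transfer S v).
Proof.
move=> mv; rewrite /transfer; apply: measurable_sum => i.
have mp : measurable_fun setT (fun y : R => branch S (y + i%:R)).
  by apply: measurableT_comp (measurable_branch S) _; exact: measurable_funD.
by apply: measurable_funM; apply: measurableT_comp.
Qed.

Lemma measurable_transfer0 v : measurable_fun setT v -> measurable_fun setT (transfer0 v).
Proof.
move=> mv; apply: measurable_funM; last exact: measurable_rhoV.
by apply: measurable_funM => //; apply: measurable_fun_pi_repr; exact: measurable_transfer.
Qed.

Lemma sgn2 : sgn S * sgn S = 1.
Proof. by case: (sgn_unit S) => ->; rewrite ?mul1r// mulrNN mulr1. Qed.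

Lemma sqnorm_transfer0 : exists2 C, 0 < C & forall v, measurable_fun setT v ->
  (sqnorm mu (transfer0 v) <= C%:E * sqnorm mu v)%E.
Proof.
have [m m0 rm] := rho_lbound; have [M M0 rM] := rho_ubound.
have [q q0 hq] := bwd_derive_gt0 S.
(* [2 ^+ d] from squaring the sum, [M ^+ 2] from the factors [rho] inside it, [m] from the division
   by [rho], and [q] from restoring the weights [bwd_derive]. *)
pose C := 2 ^+ d * M ^+ 2 / (m * q).
have C0 : 0 < C by rewrite /C divr_gt0 ?mulr_gt0 ?exprn_gt0.
exists C => // v mv; have mv2 : measurable_fun setT (fun p => v p ^+ 2) by exact: measurable_funX.
have mt2 : measurable_fun setT (fun p => transfer0 v p ^+ 2).
  by apply: measurable_funX; exact: measurable_transfer0.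
rewrite /sqnorm integral_density//; last by move=> p; exact: sqr_ge0.
rewrite (integral_branch S mv2); last by move=> p; exact: sqr_ge0.
have mpi (g : circle R -> R) : measurable_fun setT g -> measurable_fun (`[0, 1[%classic : set R) (g \o @circle_pi R).
  by move=> mg; apply: measurable_funTS; apply: measurableT_comp => //; exact: measurable_circle_pi.
have msum : measurable_fun setT (fun y : R => \sum_(i < d) bwd_derive S (y + i%:R) * v (branch S (y + i%:R)) ^+ 2).
  apply: measurable_sum => i.
  have msh : measurable_fun setT (fun y : R => y + i%:R) by exact: measurable_funD.
  apply: measurable_funM.
    apply: (@measurableT_comp _ _ _ _ _ _ (bwd_derive S)) => //.
    apply: continuous_measurable_fun; have [l _] := bwd_derive_lip S.
    exact: lipschitz_continuous.
  apply: (@measurableT_comp _ _ _ _ _ _ (fun p => v p ^+ 2)) => //.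
  by apply: measurableT_comp (measurable_branch S) _.
have s0 y : 0 <= \sum_(i < d) bwd_derive S (y + i%:R) * v (branch S (y + i%:R)) ^+ 2.
  by apply: sumr_ge0 => i _; rewrite mulr_ge0 ?sqr_ge0 ?bwd_derive_ge0.
rewrite -ge0_integralZl//; last 3 first.
- by apply/measurable_EFinP; apply: measurable_funTS.
- by move=> y _; rewrite lee_fin.
- by rewrite lee_fin ltW.
apply: ge0_le_integral => //.
- by move=> y _; rewrite lee_fin mulr_ge0 ?sqr_ge0// ltW.
- apply/measurable_EFinP; apply: measurable_funM; [exact: (mpi (fun p => transfer0 v p ^+ 2))|exact: mpi].
- apply: emeasurable_funM => //; apply/measurable_EFinP; exact: measurable_funTS.
move=> y _; rewrite -EFinM lee_fin transfer0_pi.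
set r := rho (circle_pi y); have r0 : 0 < r by exact: rho_gt0.
rewrite (_ : _ * r = transfer S v y ^+ 2 / r); last first.
  rewrite expr_div_n exprMn expr2 sgn2 mul1r -mulrA; congr (_ * _).
  by field; rewrite gt_eqF.
apply: (@le_trans _ _ ((2 ^+ d * \sum_(i < d) (rho (branch S (y + i%:R)) * v (branch S (y + i%:R))) ^+ 2) / m)).
  apply: ler_pM; rewrite ?sqr_ge0 ?invr_ge0 ?(ltW r0)//.
    exact: (sqr_sum_le d (fun i => rho (branch S (y + i%:R)) * v (branch S (y + i%:R)))).
  by rewrite lef_pV2 ?posrE//; exact: rm.
rewrite (_ : C * _ = 2 ^+ d * (M ^+ 2 / q *
    (\sum_(i < d) bwd_derive S (y + i%:R) * v (branch S (y + i%:R)) ^+ 2)) / m); last first.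
  by rewrite /C; field; rewrite !gt_eqF.
rewrite ler_pM2r ?invr_gt0// ler_pM2l ?exprn_gt0// mulr_sumr.
apply: ler_sum => i _; rewrite exprMn [leRHS]mulrA ler_wpM2r ?sqr_ge0//.
rewrite mulrAC -mulrA (le_trans _ (_ : M ^+ 2 * 1 <= _))//.
  by rewrite mulr1 lerXn2r ?nnegrE ?(ltW M0)// ltW.
by rewrite ler_wpM2l ?sqr_ge0// ler_pdivlMr// mul1r.
Qed.

Lemma integral_invariant (f : circle R -> R) : measurable_fun setT f -> (forall p, 0 <= f p) ->
  (\int[mu]_p (f (F p))%:E = \int[mu]_p (f p)%:E)%E.
Proof.
move=> mf f0.
rewrite [RHS](@integral_transfer _ _ _ _ _ mu mu F setT (fun=> 1))//.
- by apply: eq_integral => p _; rewrite mule1.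
- move=> A mA; rewrite setTI integral_cst ?mul1e.
    exact/esym/mu_inv.
  by rewrite -[X in measurable X]setTI; exact: mF.
- exact/measurable_EFinP.
Qed.

Lemma Rintegral_density (f : circle R -> R) : mu.-integrable setT (EFin \o f) ->
  \int[mu]_p f p = \int[leb]_(y in `[0, 1[) (f (circle_pi y) * rho (circle_pi y)).
Proof.
move=> fi; pose W (g : circle R -> R) y := g (circle_pi y) * rho (circle_pi y).
apply: (@Rintegral_signed _ _ _ _ _ mu leb `[0, 1[%classic W f) => //.
- move=> g mg g0; split; last exact: integral_density.
    by apply: measurable_funTS; apply: measurable_funM; apply: measurableT_comp => //; exact: measurable_circle_pi.
  by move=> y; rewrite mulr_ge0// ltW.
- by move=> g h y; rewrite /W mulrBl.
Qed.

Lemma Rintegral_branch (f : circle R -> R) : mu.-integrable setT (EFin \o f) ->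
  \int[mu]_p f p = \int[leb]_(y in `[0, 1[)
     (\sum_(i < d) bwd_derive S (y + i%:R) * f (branch S (y + i%:R))).
Proof.
move=> fi; pose W (g : circle R -> R) y :=
  \sum_(i < d) bwd_derive S (y + i%:R) * g (branch S (y + i%:R)).
apply: (@Rintegral_signed _ _ _ _ _ mu leb `[0, 1[%classic W f) => //.
- move=> g mg g0; split; last exact: integral_branch.
    apply: measurable_funTS; rewrite /W; apply: measurable_sum => i.
    have msh : measurable_fun setT (fun y : R => y + i%:R) by exact: measurable_funD.
    apply: measurable_funM.
      apply: (@measurableT_comp _ _ _ _ _ _ (bwd_derive S)) => //.
      apply: continuous_measurable_fun; have [l _] := bwd_derive_lip S.
      exact: lipschitz_continuous.
    by apply: measurableT_comp => //; apply: measurableT_comp (measurable_branch S) _.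
  by move=> y; apply: sumr_ge0 => i _; rewrite mulr_ge0// bwd_derive_ge0.
- by move=> g h y; rewrite /W -sumrB; apply: eq_bigr => i _; rewrite mulrBr.
Qed.

Definition cotransfer u p : R := F' p * u (F p).

Lemma measurable_cotransfer u : measurable_fun setT u -> measurable_fun setT (cotransfer u).
Proof. by move=> mu'; apply: measurable_funM => //; exact: measurableT_comp. Qed.

Lemma sqnorm_cotransfer : exists2 C, 0 < C & forall u, measurable_fun setT u ->
  (sqnorm mu (cotransfer u) <= C%:E * sqnorm mu u)%E.
Proof.
have [C C0 hC] := F'_bound; exists (C ^+ 2) => [|u mu']; first by rewrite exprn_gt0.
have muF : measurable_fun setT (u \o F) by exact: measurableT_comp.
have mu2 : measurable_fun setT (fun p => u p ^+ 2) by exact: measurable_funX.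
rewrite [sqnorm mu u]/sqnorm -(integral_invariant mu2); last by move=> p; exact: sqr_ge0.
apply: (le_sqnorm mu (measurable_cotransfer mu') muF (ltW C0)) => p.
by rewrite normrM ler_wpM2r.
Qed.

Lemma sqnorm_lty (u w : circle R -> R) C : (sqnorm mu u <= C%:E * sqnorm mu w)%E ->
  0 < C -> (sqnorm mu w < +oo)%E -> (sqnorm mu u < +oo)%E.
Proof.
move=> uw C0 w1; apply: le_lt_trans uw _; have := sqnorm_ge0 mu w.
by case: (sqnorm mu w) w1 => [r| |]// _ _; rewrite -EFinM ltry.
Qed.

(** The left side is written over the target by the density, the right side by summing over the
    branches. Since [u (F p)] takes the same value on all branches over [y], the integrands agree
    pointwise. *)
Lemma transfer0_adjoint u v : measurable_fun setT u -> measurable_fun setT v ->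
  (sqnorm mu u < +oo)%E -> (sqnorm mu v < +oo)%E ->
  \int[mu]_p (transfer0 v p * u p) = \int[mu]_p (v p * cotransfer u p).
Proof.
move=> mu' mv fu fv.
have [C C0 hC] := sqnorm_transfer0; have [D D0 hD] := sqnorm_cotransfer.
have i1 := integrable_mul (measurable_transfer0 mv) mu' (sqnorm_lty (hC v mv) C0 fv) fu.
have i2 := integrable_mul mv (measurable_cotransfer mu') fv (sqnorm_lty (hD u mu') D0 fu).
rewrite (Rintegral_density i1) (Rintegral_branch i2).
apply: eq_Rintegral => y _; rewrite transfer0_pi /transfer !mulr_sumr !mulr_suml.
apply: eq_bigr => i _.
rewrite /cotransfer branchK circle_piDn.
rewrite /bwd_derive /slope /dens /= -/(branch S (y + i%:R)).
have s0 : sgn S != 0 by apply/eqP => s0; have := sgn2; rewrite s0 mul0r => /esym/eqP; rewrite oner_eq0.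
have r0 : rho (circle_pi y) != 0 by rewrite gt_eqF.
have F0 : F' (branch S (y + i%:R)) != 0.
  apply/eqP => F0; have := slope_gt1 S (param S (bwd S (y + i%:R))).
  by rewrite /slope /= -/(branch S (y + i%:R)) F0 mulr0 ltr10.
(* [field] does not know that the sign squares to 1; replacing one occurrence by its inverse makes
   the identity purely rational. *)
rewrite {1}(_ : sgn S = (sgn S)^-1); last by rewrite -[RHS]mul1r -sgn2 mulfK.
by field; rewrite s0 r0 F0.
Qed.

Definition rhoV p : R := (rho p)^-1.

(** The coefficient of the orthogonal projection of [transfer0 v] onto [rhoV]. Adjunction moves the
    operator onto [rhoV], which leaves a formula without branches and visibly linear in [v]. *)
Definition coef v : R := (\int[mu]_p (v p * cotransfer rhoV p)) / \int[mu]_p (rhoV p * rhoV p).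

Definition deriv_op v p : R := transfer0 v p - coef v * rhoV p.

Lemma rhoV_bound : exists2 C, 0 < C & forall p, `|rhoV p| <= C.
Proof.
have [m m0 rm] := rho_lbound; exists m^-1 => [|p]; first by rewrite invr_gt0.
by rewrite gtr0_norm ?invr_gt0// lef_pV2 ?posrE.
Qed.

Lemma sqnorm_rhoV : (sqnorm mu rhoV < +oo)%E.
Proof.
have [C C0 hC] := rhoV_bound.
by rewrite (le_lt_trans (sqnorm_bounded mu measurable_rhoV hC))// ltry.
Qed.

Lemma rhoV_norm_gt0 : 0 < \int[mu]_p (rhoV p * rhoV p).
Proof.
have [M M0 rM] := rho_ubound.
have i1 : mu.-integrable setT (EFin \o (fun=> M^-1 * M^-1)).
  exact: finite_measure_integrable_cst.
have i2 := integrable_mul measurable_rhoV measurable_rhoV sqnorm_rhoV sqnorm_rhoV.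
have : \int[mu]_p (M^-1 * M^-1) <= \int[mu]_p (rhoV p * rhoV p).
  apply: le_Rintegral => // p _.
  by apply: ler_pM; rewrite ?invr_ge0 ?(ltW M0)//; rewrite lef_pV2 ?posrE.
apply: lt_le_trans; rewrite Rintegral_cst//.
by rewrite [X in fine X](_ : _ = 1%E) ?mulr1 ?mulr_gt0 ?invr_gt0//; exact: probability_setT.
Qed.

Lemma measurable_deriv_op v : measurable_fun setT v -> measurable_fun setT (deriv_op v).
Proof.
move=> mv; apply: measurable_funB; first exact: measurable_transfer0.
by apply: measurable_funM => //; exact: measurable_rhoV.
Qed.

Lemma integrable_coef v : measurable_fun setT v -> (sqnorm mu v < +oo)%E ->
  mu.-integrable setT (EFin \o (fun p => v p * cotransfer rhoV p)).
Proof.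
move=> mv fv; have [D D0 hD] := sqnorm_cotransfer.
apply: integrable_mul => //; first exact: measurable_cotransfer measurable_rhoV.
exact: (sqnorm_lty (hD _ measurable_rhoV) D0 sqnorm_rhoV).
Qed.

Lemma transferD a u v y : transfer S (fun p => a * u p + v p) y =
  a * transfer S u y + transfer S v y.
Proof. by rewrite /transfer mulr_sumr -big_split; apply: eq_bigr => i _ /=; ring. Qed.

Lemma deriv_op_linear a u v : measurable_fun setT u -> measurable_fun setT v ->
  (sqnorm mu u < +oo)%E -> (sqnorm mu v < +oo)%E ->
  forall p, deriv_op (fun p => a * u p + v p) p = a * deriv_op u p + deriv_op v p.
Proof.
move=> mu' mv fu fv p.
have iu := integrable_coef mu' fu; have iv := integrable_coef mv fv.
have iau : mu.-integrable setT (EFin \o (fun p => a * (u p * cotransfer rhoV p))).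
  by have := integrableZl measurableT a iu; apply: eq_integrable.
have -> : deriv_op (fun p => a * u p + v p) p =
    transfer0 (fun p => a * u p + v p) p - (a * coef u + coef v) * rhoV p.
  rewrite /deriv_op /coef; congr (_ - _ * _).
  rewrite mulrA -mulrDl -RintegralZl// -RintegralD//; congr (_ / _).
  by apply: eq_Rintegral => q _; ring.
by rewrite /deriv_op /transfer0 transferD; ring.
Qed.

Lemma sqnorm_deriv_op : exists2 C, 0 < C & forall v, measurable_fun setT v ->
  (sqnorm mu v < +oo)%E -> (sqnorm mu (deriv_op v) <= C%:E * sqnorm mu v)%E.
Proof.
have [C C0 hC] := sqnorm_transfer0; have [D D0 hD] := rhoV_bound.
have [K K0 hK] := F'_bound; have N0 := rhoV_norm_gt0.
set N := \int[mu]_p _ in N0.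
(* The numerator of [coef v] is at most [K * D] times the norm of [v]; dividing by [N] and
   multiplying by the bound [D] on [rhoV] gives the square root of [E]. *)
pose E := D ^+ 2 * ((K * D) ^+ 2 / N ^+ 2).
have E0 : 0 < E by rewrite /E mulr_gt0 ?divr_gt0 ?exprn_gt0 ?mulr_gt0.
exists (2 * C + 2 * E) => [|v mv fv]; first by rewrite addr_gt0// mulr_gt0.
have mt := measurable_transfer0 mv.
have mco : measurable_fun setT (fun p => coef v * rhoV p) by apply: measurable_funM => //; exact: measurable_rhoV.
have h1 := @sqnormD _ mu (deriv_op v) _ _ (measurable_deriv_op mv) mt mco
  (fun p => ler_normB (transfer0 v p) (coef v * rhoV p)).
apply: (le_trans h1).
have h2 : (sqnorm mu (fun p => (coef v * rhoV p)%R) <= E%:E * sqnorm mu v)%E.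
  have h3 : (((\int[mu]_p (v p * cotransfer rhoV p)) ^+ 2)%:E <= ((K * D) ^+ 2)%:E * sqnorm mu v)%E.
    have mk := measurable_funM mv (measurable_cotransfer measurable_rhoV).
    have h4 : (sqnorm mu (fun p => (v p * cotransfer rhoV p)%R) <= ((K * D) ^+ 2)%:E * sqnorm mu v)%E.
      apply: le_sqnorm => //; first by rewrite mulr_ge0 ?ltW.
      by move=> p; rewrite normrM mulrC ler_wpM2r// /cotransfer normrM ler_pM.
    apply: (le_trans _ h4); apply: Rintegral_sqr => //.
    by apply: (sqnorm_lty h4); rewrite ?exprn_gt0 ?mulr_gt0.
  have h5 : (sqnorm mu (fun p => (coef v * rhoV p)%R) <= ((coef v * D) ^+ 2)%:E)%E.
    have -> : (coef v * D) ^+ 2 = (`|coef v| * D) ^+ 2.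
      by rewrite -[LHS]real_normK ?num_real// normrM (gtr0_norm D0).
    by apply: sqnorm_bounded => // p; rewrite normrM ler_wpM2l.
  apply: (le_trans h5).
  have := sqnorm_ge0 mu v; move: h3 fv; case: (sqnorm mu v) => [r| |]//.
  rewrite -!EFinM !lee_fin => h3 _ r0.
  rewrite /coef -/N; set I := \int[mu]_p _ in h3 *.
  have N1 : N != 0 by rewrite gt_eqF.
  rewrite (_ : _ ^+ 2 = (D / N) ^+ 2 * I ^+ 2); last by field.
  rewrite (_ : E * r = (D / N) ^+ 2 * ((K * D) ^+ 2 * r)); last by rewrite /E; field.
  by rewrite ler_wpM2l// sqr_ge0.
have h3 := hC v mv; move: h2 h3 fv.
have := sqnorm_ge0 mu v; case: (sqnorm mu v) => [r| |]// r0 h2 h3 _.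
apply: (@le_trans _ _ (2%:E * (C%:E * r%:E) + 2%:E * (E%:E * r%:E))%E).
  by apply: leeD; apply: lee_wpmul2l.
by rewrite -!EFinM -EFinD lee_fin; lra.
Qed.

End derivative_operator.

(** * The tangent space and the derivative *)

Section tangent_space.
Variable R : realType.
Variables (F : circle R -> circle R) (rho : circle R -> R) (mu : probability (circle R) R).
Hypotheses (F_C2 : C2_map F).
Hypotheses (rho_gt0 : forall x, 0 < rho x) (rho_C1 : C1_fun rho).
Hypotheses (mu_rho : has_density mu rho) (mu_inv : invariant_measure F mu).
Variable S : branch_system F rho mu.
Local Notation leb := (@lebesgue_measure R).
Local Notation d := (deg S).
Local Notation F' := (map_deriv F).
Implicit Types (x y z e : R) (u v w h : circle R -> R) (p : circle R).
Local Notation rhoV := (rhoV rho).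

Lemma smooth_deriv_C1 (g : circle R -> R) : smooth_fun g -> C1_fun (fun_deriv g).
Proof.
move=> sg; split; first exact: (sg 1%N).
apply: continuous_circle_fun; apply: derive_continuous => x.
exact: (is_derive_fun_deriv x (sg 2%N)).
Qed.

Lemma lipschitz_circle_measurable h : lipschitz_fun (h \o @circle_pi R) ->
  measurable_fun setT h.
Proof.
move=> lh; apply: measurable_fun_circle; apply: continuous_measurable_fun.
exact: lipschitz_continuous.
Qed.

Lemma smooth_deriv_lip (g : circle R -> R) : smooth_fun g ->
  lipschitz_fun (fun_deriv g \o @circle_pi R).
Proof. by move=> /smooth_deriv_C1/C1_fun_lipschitz[]. Qed.

Lemma lipschitz_sqnorm h : lipschitz_fun (h \o @circle_pi R) -> (sqnorm mu h < +oo)%E.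
Proof.
move=> lh.
have [C C0 hC] := periodic_bounded (pi_periodic h) (lipschitz_continuous lh).
apply: (@le_lt_trans _ _ (C ^+ 2)%:E); last exact: ltry.
apply: sqnorm_bounded; first exact: lipschitz_circle_measurable.
by move=> p; rewrite -(circle_reprK p); exact: hC.
Qed.

Lemma L20P (v : {mfun circle R >-> R}) : L20 mu v <-> (sqnorm mu v < +oo)%E /\
  forall e, 0 < e -> exists2 g, smooth_fun g &
    (sqnorm mu (fun p => v p - fun_deriv g p)%R < e%:E)%E.
Proof.
split=> [[/L2P v2 hv]|[v2 hv]].
  split=> // e e0; have [g [sg [w wE]]] := hv (Num.sqrt e) (etrans (sqrtr_gt0 e) e0).
  rewrite L2_dist_lt ?sqrtr_gt0// sqr_sqrtr ?(ltW e0)// => lt.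
  exists g => //; rewrite (_ : (fun p => v p - fun_deriv g p) = (fun p => v p - w p))//.
  by apply/funext => p; rewrite wE.
split; first exact/L2P.
move=> e e0; have [g sg lt] := hv (e ^+ 2) (exprn_gt0 2 e0).
exists g; split => //.
have mg := lipschitz_circle_measurable (smooth_deriv_lip sg).
exists (mfun_Sub (mem_set mg)) => //.
by rewrite L2_dist_lt.
Qed.

Lemma sqnorm_fin_sub u v : measurable_fun setT u -> measurable_fun setT v ->
  (sqnorm mu u < +oo)%E -> (sqnorm mu v < +oo)%E ->
  (sqnorm mu (fun p => u p - v p)%R < +oo)%E.
Proof.
move=> mu' mv fu fv.
have := @sqnormD _ mu _ _ _ (measurable_funB mu' mv) mu' mv (fun p => ler_normB (u p) (v p)).
move=> h; apply: (le_lt_trans h); have := sqnorm_ge0 mu u; have := sqnorm_ge0 mu v.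
move: fu fv; case: (sqnorm mu u) => [a| |]//; case: (sqnorm mu v) => [b| |]// _ _ _ _.
by rewrite -!EFinM -EFinD ltry.
Qed.

(** [rhoV] cancels the density, so pairing with it in L^2(mu) is the Lebesgue mean. The condition of
    mean zero is used in this form because the pairing is continuous in L^2(mu). *)
Lemma Rintegral_rhoV_lip h : lipschitz_fun (h \o @circle_pi R) ->
  \int[mu]_p (h p * rhoV p) = mean (h \o @circle_pi R).
Proof.
move=> lh; have ch := lipschitz_continuous lh.
have mh := lipschitz_circle_measurable lh.
have ih := integrable_mul mh (measurable_rhoV S) (lipschitz_sqnorm lh) (sqnorm_rhoV rho_gt0 S).
rewrite (Rintegral_density rho_gt0 rho_C1 mu_rho S ih).
have [p0 dp] := primitiveP ch.
transitivity (\int[leb]_(y in `[0, 1[) h (circle_pi y)).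
  apply: eq_Rintegral => y _; rewrite /rhoV -mulrA mulVf ?mulr1// gt_eqF//.
by rewrite /Rintegral (integral_derive ch dp ler01) p0 subr0.
Qed.

Lemma smooth_deriv_mean0 (g : circle R -> R) : smooth_fun g ->
  \int[mu]_p (fun_deriv g p * rhoV p) = 0.
Proof.
move=> sg; rewrite (Rintegral_rhoV_lip (smooth_deriv_lip sg)).
have dg x := is_derive_fun_deriv x (sg 0%N).
have cg := lipschitz_continuous (smooth_deriv_lip sg).
by rewrite (meanE dg cg) -[1]add0r pi_periodic subrr.
Qed.

Lemma mean0_closed u : measurable_fun setT u -> (sqnorm mu u < +oo)%E ->
  (forall e, 0 < e -> exists2 h, lipschitz_fun (h \o @circle_pi R) /\
     \int[mu]_p (h p * rhoV p) = 0 & (sqnorm mu (fun p => u p - h p)%R < e%:E)%E) ->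
  \int[mu]_p (u p * rhoV p) = 0.
Proof.
move=> mu' fu hu; have [D D0 hD] := rhoV_bound rho_gt0 S.
have D2 : 0 < D ^+ 2 by rewrite exprn_gt0.
set I := \int[mu]_p _.
suff : I ^+ 2 <= 0.
  by move=> I0; apply/eqP; rewrite -sqrf_eq0 eq_le I0 sqr_ge0.
apply/ler_addgt0Pr => e e0; rewrite add0r.
have [|h [lh h0] uh] := hu (e / D ^+ 2); first by rewrite divr_gt0.
have mh := lipschitz_circle_measurable lh.
have fh := lipschitz_sqnorm lh.
have muh := measurable_funB mu' mh.
have fuh := sqnorm_fin_sub mu' mh fu fh.
have -> : I = \int[mu]_p ((u p - h p) * rhoV p).
  rewrite -[I]subr0 -h0 /I -RintegralB//.
  - by apply: eq_Rintegral => p _; rewrite mulrBl.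
  - exact: integrable_mul (measurable_rhoV S) fu (sqnorm_rhoV rho_gt0 S).
  - exact: integrable_mul (measurable_rhoV S) fh (sqnorm_rhoV rho_gt0 S).
rewrite -lee_fin.
have muhr := measurable_funM muh (measurable_rhoV S).
have h1 : (sqnorm mu (fun p => ((u p - h p) * rhoV p)%R) <= (D ^+ 2)%:E * sqnorm mu (fun p => (u p - h p)%R))%E.
  apply: le_sqnorm => //; first exact: ltW.
  by move=> p; rewrite normrM mulrC ler_wpM2r.
apply: (@le_trans _ _ (sqnorm mu (fun p => ((u p - h p) * rhoV p)%R))).
  apply: Rintegral_sqr => //; apply: (sqnorm_lty h1) => //.
apply: (le_trans h1); move: uh; have := sqnorm_ge0 mu (fun p => (u p - h p)%R).
case: (sqnorm mu _) => [r| |]//; rewrite lee_fin lte_fin => r0.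
by rewrite ltr_pdivlMr// -EFinM lee_fin mulrC => /ltW.
Qed.

Lemma L20_mean0 (v : {mfun circle R >-> R}) : L20 mu v -> \int[mu]_p (v p * rhoV p) = 0.
Proof.
move=> /L20P[fv hv]; apply: mean0_closed => // e e0.
have [g sg lt] := hv e e0; exists (fun_deriv g) => //.
by split; [exact: smooth_deriv_lip|exact: smooth_deriv_mean0].
Qed.

(** Lipschitz mean-zero approximants suffice, by uniform density of smooth derivatives. This is
    needed because the operators send smooth derivatives to functions shown only to be Lipschitz. *)
Lemma L20_closed (u : {mfun circle R >-> R}) : (sqnorm mu u < +oo)%E ->
  (forall e, 0 < e -> exists2 h, lipschitz_fun (h \o @circle_pi R) /\
     \int[mu]_p (h p * rhoV p) = 0 & (sqnorm mu (fun p => u p - h p)%R < e%:E)%E) ->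
  L20 mu u.
Proof.
move=> fu hu; apply/L20P; split => // e e0.
(* By [sqnormD] the two errors [e / 4] and [e / 8] are doubled, for a total below [3 * e / 4]. *)
have e4 : 0 < e / 4 by rewrite divr_gt0.
have [h [lh h0] uh] := hu (e / 4) e4.
have s0 : 0 < Num.sqrt (e / 8) by rewrite sqrtr_gt0 divr_gt0.
have mh0 : mean (h \o @circle_pi R) = 0 by rewrite -(Rintegral_rhoV_lip lh).
have [g sg hg] := smooth_deriv_dense lh (pi_periodic h) mh0 s0.
exists g => //.
have mh := lipschitz_circle_measurable lh.
have mg := lipschitz_circle_measurable (smooth_deriv_lip sg).
have hhg : (sqnorm mu (fun p => (h p - fun_deriv g p)%R) <= (e / 8)%:E)%E.
  rewrite -[e / 8]sqr_sqrtr; last by rewrite divr_ge0// ltW.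
  apply: sqnorm_bounded; first exact: measurable_funB.
  by move=> p; rewrite -(circle_reprK p); exact: hg.
apply: (@le_lt_trans _ _ (2%:E * sqnorm mu (fun p => (u p - h p)%R) +
   2%:E * sqnorm mu (fun p => (h p - fun_deriv g p)%R))%E).
  apply: sqnormD; [exact: measurable_funB|exact: measurable_funB|exact: measurable_funB|].
  by move=> p; rewrite -(subrK (h p) (u p)) -addrA subrK; exact: ler_normD.
move: uh hhg; have := sqnorm_ge0 mu (fun p => (u p - h p)%R).
have := sqnorm_ge0 mu (fun p => (h p - fun_deriv g p)%R).
case: (sqnorm mu (fun p => (u p - h p)%R)) => [a| |]//.
case: (sqnorm mu _) => [b| |]//; rewrite !lee_fin !lte_fin.
lra.
Qed.

End tangent_space.

(** * Stability of the tangent space and adjunction *)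

Section derivative_properties.
Variable R : realType.
Variables (F : circle R -> circle R) (rho : circle R -> R) (mu : probability (circle R) R).
Hypotheses (F_C2 : C2_map F).
Hypotheses (rho_gt0 : forall x, 0 < rho x) (rho_C1 : C1_fun rho).
Hypotheses (mu_rho : has_density mu rho) (mu_inv : invariant_measure F mu).
Variable S : branch_system F rho mu.
Local Notation leb := (@lebesgue_measure R).
Local Notation d := (deg S).
Local Notation F' := (map_deriv F).
Implicit Types (x y z e : R) (u v w h : circle R -> R) (p : circle R).
Local Notation rhoV := (rhoV rho).

Lemma mfun_measurable (v : {mfun circle R >-> R}) : measurable_fun setT v.
Proof. by []. Qed.

Lemma branch_repr_lip : lipschitz_fun (fun y => param S (bwd S y)).
Proof. exact: (lipschitz_comp (param_lip S) (bilipschitz_lip (bwd_bilip S))). Qed.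

Lemma lip_bounded h : lipschitz_fun (h \o @circle_pi R) -> bounded_function (h \o @circle_pi R).
Proof.
by move=> lh; apply: (periodic_bounded (pi_periodic h)); exact: lipschitz_continuous.
Qed.

Lemma transfer_lip h : lipschitz_fun (h \o @circle_pi R) ->
  lipschitz_fun (transfer S h) /\ bounded_function (transfer S h).
Proof.
move=> lh; have bh := lip_bounded lh.
have lb i : lipschitz_fun (fun y => param S (bwd S (y + i%:R))).
  exact: lipschitz_shift branch_repr_lip.
have l1 i := lipschitz_comp (dens_lip S) (lb i).
have l2 i := lipschitz_comp lh (lb i).
have b1 i := bounded_comp (fun y => param S (bwd S (y + i%:R))) (dens_bounded S).
have b2 i := bounded_comp (fun y => param S (bwd S (y + i%:R))) bh.
split.
  apply: (@lipschitz_sum R d (fun i y => rho (branch S (y + i%:R)) * h (branch S (y + i%:R)))) => i.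
  exact: lipschitzM (l1 i) (b1 i) (l2 i) (b2 i).
apply: (@bounded_sum R d (fun i y => rho (branch S (y + i%:R)) * h (branch S (y + i%:R)))) => i.
exact: boundedM (b1 i) (b2 i).
Qed.

Lemma rhoV_lip : lipschitz_fun (rhoV \o @circle_pi R).
Proof.
have [m m0 rm] := dens_lbound S.
apply: (lipschitzV m0 _ (dens_lip S)) => x.
by rewrite (le_trans (rm x))// ler_norm.
Qed.

Lemma deriv_op_pi v y : deriv_op S v (circle_pi y) =
  (sgn S * transfer S v y - coef F rho mu v) * rhoV (circle_pi y).
Proof. by rewrite /deriv_op transfer0_pi mulrBl. Qed.

Lemma deriv_op_lip h : lipschitz_fun (h \o @circle_pi R) ->
  lipschitz_fun (deriv_op S h \o @circle_pi R).
Proof.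
move=> lh; have [lt bt] := transfer_lip lh.
have -> : deriv_op S h \o @circle_pi R = (fun y =>
    (sgn S * transfer S h y + - coef F rho mu h) * (rhoV \o @circle_pi R) y).
  by apply/funext => y /=; rewrite deriv_op_pi.
apply: lipschitzM; last 2 first.
- exact: rhoV_lip.
- exact: lip_bounded rhoV_lip.
- by apply: lipschitzD; [exact: lipschitzZ|exact: lipschitz_cst].
- apply: boundedD; last exact: bounded_function_cst.
  exact: (boundedM (bounded_function_cst (sgn S)) bt).
Qed.

Lemma deriv_op_mean0 v : measurable_fun setT v -> (sqnorm mu v < +oo)%E ->
  \int[mu]_p (deriv_op S v p * rhoV p) = 0.
Proof.
move=> mv fv; have [C C0 hC] := sqnorm_transfer0 rho_gt0 rho_C1 mu_rho S.
have fr := sqnorm_rhoV rho_gt0 S; have mr := measurable_rhoV S.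
have N0 := rhoV_norm_gt0 rho_gt0 S.
have i1 := integrable_mul (measurable_transfer0 S mv) mr (sqnorm_lty (hC v mv) C0 fv) fr.
have i2 := integrable_mul mr mr fr fr.
have i3 : mu.-integrable setT (EFin \o (fun p => coef F rho mu v * (rhoV p * rhoV p))).
  by have := integrableZl measurableT (coef F rho mu v) i2; apply: eq_integrable.
transitivity (\int[mu]_p (transfer0 S v p * rhoV p - coef F rho mu v * (rhoV p * rhoV p))).
  by apply: eq_Rintegral => p _; rewrite /deriv_op mulrBl mulrA.
rewrite RintegralB// RintegralZl// (transfer0_adjoint F_C2 rho_gt0 rho_C1 mu_rho mu_inv S mr mv fr fv).
by rewrite /coef divfK ?gt_eqF// subrr.
Qed.

Lemma deriv_opB u v : measurable_fun setT u -> measurable_fun setT v ->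
  (sqnorm mu u < +oo)%E -> (sqnorm mu v < +oo)%E ->
  forall p, deriv_op S (fun p => u p - v p) p = deriv_op S u p - deriv_op S v p.
Proof.
move=> mu' mv fu fv p.
have -> : (fun p => u p - v p) = (fun p => (-1) * v p + u p).
  by apply/funext => q; rewrite mulN1r addrC.
by rewrite (deriv_op_linear F_C2 rho_gt0 mu_inv S (-1) mv mu' fv fu) mulN1r addrC.
Qed.

Definition Lop (v : {mfun circle R >-> R}) : {mfun circle R >-> R} :=
  mfun_Sub (mem_set (measurable_deriv_op S (mfun_measurable v))).

Definition Aop (u : {mfun circle R >-> R}) : {mfun circle R >-> R} :=
  mfun_Sub (mem_set (measurable_cotransfer F_C2 S (mfun_measurable u))).

Lemma L20_Lop (v : {mfun circle R >-> R}) : L20 mu v -> L20 mu (Lop v).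
Proof.
move=> /L20P[fv hv].
have [C C0 hC] := sqnorm_deriv_op F_C2 rho_gt0 rho_C1 mu_rho S.
have mv := mfun_measurable v.
apply: (L20_closed rho_gt0 rho_C1 mu_rho S).
  exact: (sqnorm_lty (hC v mv fv) C0 fv).
move=> e e0; have [g sg lt] := hv (e / C) (divr_gt0 e0 C0).
have lg := smooth_deriv_lip sg.
have mg := lipschitz_circle_measurable lg.
have fg := lipschitz_sqnorm mu lg.
exists (deriv_op S (fun_deriv g)).
  by split; [exact: deriv_op_lip|exact: deriv_op_mean0].
have -> : (fun p => Lop v p - deriv_op S (fun_deriv g) p) =
    deriv_op S (fun p => v p - fun_deriv g p).
  by apply/funext => p; rewrite deriv_opB.
have fvg := sqnorm_fin_sub mv mg fv fg.
apply: (le_lt_trans (hC _ (measurable_funB mv mg) fvg)).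
move: lt; have := sqnorm_ge0 mu (fun p => (v p - fun_deriv g p)%R).
case: (sqnorm mu _) => [r| |]//; rewrite lte_fin => r0.
by rewrite ltr_pdivlMr// -EFinM lte_fin mulrC.
Qed.

Lemma cotransferB u v p : cotransfer F (fun p => u p - v p) p =
  cotransfer F u p - cotransfer F v p.
Proof. by rewrite /cotransfer mulrBr. Qed.

Lemma cotransfer_lip h : lipschitz_fun (h \o @circle_pi R) ->
  lipschitz_fun (cotransfer F h \o @circle_pi R).
Proof.
move=> lh.
have ll : lipschitz_fun (blift S).
  apply: derive_bounded_lipschitz (slope_bounded S) => x.
  exact: has_lip_derive_is_derive (blift_lip_derive S).
have -> : cotransfer F h \o @circle_pi R = fun x => slope S x * h (circle_pi (blift S x)).
  by apply/funext => x /=; rewrite /cotransfer blift_pi.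
apply: lipschitzM.
- exact: slope_lip.
- exact: slope_bounded.
- exact: lipschitz_comp lh ll.
- exact: (bounded_comp (blift S) (lip_bounded lh)).
Qed.

Lemma transfer_rhoV y : transfer S rhoV y = d%:R.
Proof.
rewrite /transfer (eq_bigr (fun=> 1)) ?sumr_const ?card_ord// => i _.
by rewrite /rhoV mulfV// gt_eqF.
Qed.

(** [transfer0] maps [rhoV] to the signed degree times [rhoV]. By adjunction the mean of
    [cotransfer F h] is therefore the signed degree times that of [h]. *)
Lemma cotransfer_mean0 h : lipschitz_fun (h \o @circle_pi R) ->
  \int[mu]_p (h p * rhoV p) = 0 -> \int[mu]_p (cotransfer F h p * rhoV p) = 0.
Proof.
move=> lh h0.
have fr := sqnorm_rhoV rho_gt0 S; have mr := measurable_rhoV S.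
have mh := lipschitz_circle_measurable lh.
have fh := lipschitz_sqnorm mu lh.
transitivity (\int[mu]_p (rhoV p * cotransfer F h p)).
  by apply: eq_Rintegral => p _; rewrite mulrC.
rewrite -(transfer0_adjoint F_C2 rho_gt0 rho_C1 mu_rho mu_inv S mh mr fh fr).
transitivity (\int[mu]_p ((sgn S * d%:R) * (h p * rhoV p))).
  by apply: eq_Rintegral => p _; rewrite /transfer0 transfer_rhoV -/(rhoV p) -!mulrA [rhoV p * h p]mulrC.
have ih := integrable_mul mh mr fh fr.
by rewrite RintegralZl// h0 mulr0.
Qed.

Lemma L20_Aop (u : {mfun circle R >-> R}) : L20 mu u -> L20 mu (Aop u).
Proof.
move=> /L20P[fv hv].
have [C C0 hC] := sqnorm_cotransfer F_C2 mu_inv S.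
have mu' := mfun_measurable u.
apply: (L20_closed rho_gt0 rho_C1 mu_rho S).
  exact: (sqnorm_lty (hC u mu') C0 fv).
move=> e e0; have [g sg lt] := hv (e / C) (divr_gt0 e0 C0).
have lg := smooth_deriv_lip sg.
have mg := lipschitz_circle_measurable lg.
exists (cotransfer F (fun_deriv g)).
  split; first exact: cotransfer_lip.
  apply: cotransfer_mean0 => //.
  exact: (smooth_deriv_mean0 rho_gt0 rho_C1 mu_rho S sg).
have -> : (fun p => Aop u p - cotransfer F (fun_deriv g) p) =
    cotransfer F (fun p => u p - fun_deriv g p).
  by apply/funext => p; rewrite cotransferB.
apply: (le_lt_trans (hC _ (measurable_funB mu' mg))).
move: lt; have := sqnorm_ge0 mu (fun p => (u p - fun_deriv g p)%R).
case: (sqnorm mu _) => [r| |]//; rewrite lte_fin => r0.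
by rewrite ltr_pdivlMr// -EFinM lte_fin mulrC.
Qed.

(** The correction is a multiple of [rhoV], which is orthogonal to [u]; only [transfer0]
    contributes. *)
Lemma Lop_adjoint (u v : {mfun circle R >-> R}) : L20 mu u -> L20 mu v ->
  L2_inner mu (Lop v) u = L2_inner mu v (Aop u).
Proof.
move=> Lu Lv; have u0 := L20_mean0 rho_gt0 rho_C1 mu_rho S Lu.
have [fu _] := (L20P mu u).1 Lu; have [fv _] := (L20P mu v).1 Lv.
have mu' := mfun_measurable u; have mv := mfun_measurable v.
rewrite /L2_inner -(transfer0_adjoint F_C2 rho_gt0 rho_C1 mu_rho mu_inv S mu' mv fu fv).
have [C C0 hC] := sqnorm_transfer0 rho_gt0 rho_C1 mu_rho S.
have fr := sqnorm_rhoV rho_gt0 S; have mr := measurable_rhoV S.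
have i1 := integrable_mul (measurable_transfer0 S mv) mu' (sqnorm_lty (hC v mv) C0 fv) fu.
have i2 := integrable_mul mu' mr fu fr.
have i3 : mu.-integrable setT (EFin \o (fun p => coef F rho mu v * (u p * rhoV p))).
  by have := integrableZl measurableT (coef F rho mu v) i2; apply: eq_integrable.
transitivity (\int[mu]_p (transfer0 S v p * u p - coef F rho mu v * (u p * rhoV p))).
  by apply: eq_Rintegral => p _; rewrite /= /deriv_op mulrBl -!mulrA [rhoV p * u p]mulrC.
by rewrite RintegralB// RintegralZl// u0 mulr0 subr0.
Qed.

End derivative_properties.

(** * The coupling *)

Section perturbed_coupling.
Variable R : realType.
Variables (F : circle R -> circle R) (rho : circle R -> R) (mu : probability (circle R) R).
Hypotheses (F_C2 : C2_map F).
Hypotheses (rho_gt0 : forall x, 0 < rho x).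
Variable S : branch_system F rho mu.
Variable w : circle R -> R.
Hypothesis lw : lipschitz_fun (w \o @circle_pi R).
Local Notation leb := (@lebesgue_measure R).
Local Notation d := (deg S).
Local Notation F' := (map_deriv F).
Local Notation Lw := (deriv_op S w).
Implicit Types (t u x y z e : R) (p : circle R).

Let sqr_le x y : `|x| <= y -> x ^+ 2 <= y ^+ 2.
Proof.
move=> xy; rewrite -[x ^+ 2]real_normK ?num_real// lerXn2r ?nnegrE//.
exact: le_trans xy.
Qed.

Let eta y := F' (branch S y) * w (branch S y) - Lw (circle_pi y).
Let theta y := bwd_derive S y * eta y.

Let bwd_derive_branch y : bwd_derive S y = rho (branch S y) / (sgn S * F' (branch S y)).
Proof. by []. Qed.

Let sF0 p : sgn S * F' p != 0.
Proof.
have := slope_gt1 S (circle_repr p); rewrite /slope /= circle_reprK => h.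
by rewrite gt_eqF// (lt_trans ltr01).
Qed.

Let thetaD y : theta (y + d%:R) = theta y.
Proof. by rewrite /theta /eta !bwd_derive_branch branchDdeg circle_piDn. Qed.

(** The weights [bwd_derive] sum to [rho], and weighted by [F' * w] they sum to [rho * transfer0 w].
    What remains is [rho] times the correction term of [deriv_op], and its factor [rhoV] turns this
    into a constant. *)
Let theta_sum y : \sum_(i < d) theta (y + i%:R) = coef F rho mu w.
Proof.
have E (i : 'I_d) : theta (y + i%:R) =
    sgn S * (rho (branch S (y + i%:R)) * w (branch S (y + i%:R))) -
    bwd_derive S (y + i%:R) * Lw (circle_pi y).
  rewrite /theta /eta circle_piDn mulrBr; congr (_ - _).
  rewrite bwd_derive_branch; have := sF0 (branch S (y + i%:R)).
  rewrite mulf_eq0 negb_or => /andP[s0 f0].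
  rewrite [sgn S in RHS](_ : sgn S = (sgn S)^-1); last by rewrite -[RHS]mul1r -(sgn2 S) mulfK.
  by field; rewrite s0 f0.
rewrite (eq_bigr _ (fun i _ => E i)) sumrB -mulr_sumr -mulr_suml -/(transfer S w y).
rewrite bwd_derive_sum deriv_op_pi /dens /= /rhoV mulrCA divff ?mulr1; last by rewrite gt_eqF.
by rewrite subKr.
Qed.

Let lip_branch (h : circle R -> R) : lipschitz_fun (h \o @circle_pi R) ->
  lipschitz_fun (fun y => h (branch S y)) /\ bounded_function (fun y => h (branch S y)).
Proof.
move=> lh; split; first exact: lipschitz_comp lh (branch_repr_lip S).
exact: (bounded_comp (fun y => param S (bwd S y)) (lip_bounded lh)).
Qed.

Let theta_lip : lipschitz_fun theta /\ bounded_function theta.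
Proof.
have [l1 b1] := lip_branch (slope_lip S); have [l2 b2] := lip_branch lw.
have lLw := deriv_op_lip S lw; have bLw := lip_bounded lLw.
have [lq bq] := bwd_derive_lip S.
have leta : lipschitz_fun eta.
  rewrite /eta; under eq_fun do rewrite -mulN1r.
  by apply: lipschitzD; [exact: lipschitzM|exact: lipschitzZ].
have beta : bounded_function eta.
  rewrite /eta; under eq_fun do rewrite -mulN1r.
  apply: boundedD; first exact: boundedM.
  exact: (boundedM (bounded_function_cst (-1)) bLw).
by split; [exact: lipschitzM|exact: boundedM].
Qed.

Let Psi t y := bwd S y - t * theta y.

Let Psi_bilip : exists2 t0, 0 < t0 & forall t, `|t| < t0 -> bilipschitz (Psi t).
Proof.
have [c [C [c0 C0 h]]] := bwd_bilip S; have [[L L0 lt] _] := theta_lip.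
have L1 : 0 < L + 1 by lra.
(* Below this threshold [t * theta] has slope at most [c / 2], so half of the lower slope [c] of
   [bwd] survives. *)
exists (c / 2 / (L + 1)); first by rewrite !divr_gt0.
move=> t; rewrite ltr_pdivlMr// => tL.
exists (c / 2), (C + c / 2); split; rewrite ?divr_gt0//; first by rewrite addr_gt0 ?divr_gt0.
move=> x y xy; have /andP[h1 h2] := h _ _ xy.
have h3 := lt y x; rewrite [`|y - x|]ger0_norm ?subr_ge0// in h3.
have h4 : `|t * (theta y - theta x)| <= c / 2 * (y - x).
  rewrite normrM (le_trans (ler_wpM2l (normr_ge0 t) h3))// mulrA.
  rewrite ler_wpM2r ?subr_ge0//; have := normr_ge0 t; nra.
move: h4; rewrite ler_norml /Psi => /andP[h4 h5]; apply/andP; split; lra.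
Qed.

Lemma perturbed_branches : exists C t0 : R, [/\ 0 <= C, 0 < t0 & forall t, `|t| < t0 ->
  exists K : R -> R, [/\ continuous K,
    (forall u, circle_pi (K (u + 1)) = circle_pi (K u)),
    (forall A, measurable A -> mu A = leb ([set u | A (circle_pi (K u))] `&` `[0, 1[)) &
    forall u, circle_dist
      (F (circle_pi (param S u) + circle_pi (t * w (circle_pi (param S u)))))
      (circle_pi (K u) + circle_pi (t * Lw (circle_pi (K u)))) <= C * t ^+ 2]].
Proof.
have [t0 t00 hPsi] := Psi_bilip.
have [C1 C10 hf] := blift_lip_derive S.
have [C2 C20 hE] := fwd_lip_derive S.
have [Bw Bw0 hw] := lip_bounded lw.
have [_ [Bt Bt0 ht]] := theta_lip.
have [Lk Lk0 hk] : lipschitz_fun (fun u => slope S (param S u) * w (circle_pi (param S u))).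
  apply: lipschitzM.
  - exact: lipschitz_comp (slope_lip S) (param_lip S).
  - exact: (bounded_comp (param S) (slope_bounded S)).
  - exact: lipschitz_comp lw (param_lip S).
  - exact: (bounded_comp (param S) (lip_bounded lw)).
(* In order: Taylor remainder of the lift at [X], Taylor remainder of [fwd] at [u0], and
   displacement of the argument of [slope * w] from [u] to [u0]. *)
exists (C1 * Bw ^+ 2 + C2 * Bt ^+ 2 + Lk * Bt), t0; split => //.
  by rewrite !addr_ge0 ?mulr_ge0 ?sqr_ge0.
move=> t tt0; have bPsi := hPsi t tt0.
have [K [PK KP bK]] := bilipschitz_inverse bPsi.
have K1 u : K (u + 1) = K u + d%:R.
  rewrite -[RHS]PK; congr K; rewrite /Psi bwdDdeg thetaD.
  by rewrite -{1}(KP u) /Psi; lra.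
have cK := lipschitz_continuous (bilipschitz_lip bK).
exists K; split => //.
- by move=> u; rewrite K1 circle_piDn.
- have m01 : measurable (`[0%R, 1%R[%classic : set (measurableTypeR R)) by exact: measurable_itv.
  have mK : measurable_fun [set: measurableTypeR R] (fun u => circle_pi (K u)).
    apply: measurableT_comp (@measurable_circle_pi R) _.
    exact: continuous_measurable_fun.
  apply: (@circle_measure_unique R mu (image_measure (mrestr leb m01) mK)).
  + rewrite /= /pushforward preimage_setT /mrestr setTI.
    rewrite [RHS]lebesgue_measure_itv /= lte_fin ltr01 -EFinB subr0.
    exact: probability_setT.
  + by rewrite [X in (X < _)%E](_ : _ = 1%E) ?ltry//; exact: probability_setT.
  + move=> a b ab ba; apply: (eq_trans (bwd_arc S ab ba)).
    (* The sums of [theta] over the branches at [a] and at [b] are equal, so the perturbation leaves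
       the mass of the arc unchanged. *)
    transitivity (\sum_(i < d) (Psi t (b + i%:R) - Psi t (a + i%:R)))%:E.
      congr EFin; transitivity (\sum_(i < d) (bwd S (b + i%:R) - bwd S (a + i%:R)) -
          t * (\sum_(i < d) theta (b + i%:R) - \sum_(i < d) theta (a + i%:R))).
        by rewrite !theta_sum subrr mulr0 subr0.
      rewrite mulrBr !mulr_sumr -sumrB -sumrB; apply: eq_bigr => i _.
      by rewrite /Psi; ring.
    rewrite -(lebesgue_arc bK bPsi KP PK K1 ab ba) /= /pushforward /mrestr.
    by congr (leb (_ `&` _)); apply/seteqP; split=> u; rewrite /= circle_arc_pi.
- move=> u; set X := param S u; set Y := K u.
  rewrite -!circle_piD -(blift_pi S); apply: (le_trans (circle_dist_pi _ _)).
  pose u0 := bwd S Y.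
  have uu0 : u - u0 = - (t * theta Y) by rewrite -{1}(KP u) -/Y /Psi /u0; lra.
  have h1 := hf X (X + t * w (circle_pi X)).
  have h2 := hE u0 u.
  have EuY : fwd S u0 = Y by rewrite /u0 bwdK.
  have fX : blift S X = fwd S u by rewrite fwdE.
  have h3 := hk u u0; rewrite -/X in h3.
  rewrite [X + _ - X]addrAC subrr add0r fX in h1.
  rewrite uu0 EuY in h2; rewrite uu0 normrN in h3.
  (* The derivatives of [fwd] at [u0] and of [bwd] at [Y] are inverse to each other, so moving the
     parameter by [- t * theta Y] moves the image by [- t * eta Y] to first order. *)
  have e0 : sgn S * slope S (param S u0) / dens S (param S u0) * theta Y = eta Y.
    rewrite /theta bwd_derive_branch /slope /dens /= -/(branch S Y).
    have := sF0 (branch S Y); have : rho (branch S Y) != 0 by rewrite gt_eqF.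
    rewrite mulf_eq0 negb_or => r0 /andP[s0 f0].
    by field; rewrite s0 f0 r0.
  have etaE : eta Y = slope S (param S u0) * w (circle_pi (param S u0)) - Lw (circle_pi Y) by [].
  (* The first-order terms cancel up to the last summand: [eta Y] is by definition the rate of the
     branch at [u0] minus the rate of the target. *)
  rewrite (_ : _ - _ = (blift S (X + t * w (circle_pi X)) - fwd S u - slope S X * (t * w (circle_pi X)))
    + (fwd S u - Y - sgn S * slope S (param S u0) / dens S (param S u0) * - (t * theta Y))
    + t * (slope S X * w (circle_pi X) - slope S (param S u0) * w (circle_pi (param S u0)))); last first.
    rewrite mulrN [_ * (t * theta Y)]mulrCA e0 etaE; ring.
  have t2 : 0 <= t ^+ 2 by exact: sqr_ge0.
  have h4 : C1 * (t * w (circle_pi X)) ^+ 2 <= C1 * Bw ^+ 2 * t ^+ 2.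
    by rewrite -mulrA ler_wpM2l// exprMn mulrC ler_wpM2r// sqr_le//; exact: hw.
  have h5 : C2 * (- (t * theta Y)) ^+ 2 <= C2 * Bt ^+ 2 * t ^+ 2.
    by rewrite -mulrA ler_wpM2l// sqrrN exprMn mulrC ler_wpM2r// sqr_le.
  have h6 : `|t * (slope S X * w (circle_pi X) -
      slope S (param S u0) * w (circle_pi (param S u0)))| <= Lk * Bt * t ^+ 2.
    rewrite normrM (le_trans (ler_wpM2l (normr_ge0 t) h3))// normrM.
    rewrite -[t ^+ 2]real_normK ?num_real// (_ : Lk * Bt * _ = `|t| * (Lk * (`|t| * Bt))); last by ring.
    by rewrite !ler_wpM2l.
  rewrite (le_trans (ler_normD _ _))// 2!mulrDl lerD//.
  by rewrite (le_trans (ler_normD _ _))// lerD//; [exact: le_trans h4|exact: le_trans h5].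
Qed.

End perturbed_coupling.

(** * Upper bounds for the Wasserstein distance *)

Section wasserstein_bounds.
Variable R : realType.
Implicit Types (mu nu : probability (circle R) R).

Lemma measurable_circle_distsq :
  measurable_fun setT (fun z : circle R * circle R => (circle_dist z.1 z.2 ^+ 2)%:E).
Proof.
apply/measurable_EFinP; apply: measurable_funX.
have mr := @measurable_circle_repr R.
have mB : measurable_fun setT (fun z : circle R * circle R => z.1 - z.2).
  rewrite (_ : (fun _ => _) = @circle_pi R \o
      (fun z : circle R * circle R => circle_repr z.1 - circle_repr z.2)); last first.
    by apply/funext => z /=; rewrite circle_piB !circle_reprK.
  apply: measurableT_comp; first exact: measurable_circle_pi.
  by apply: measurable_funB; apply: measurableT_comp.
by apply: measurableT_comp => //; apply: measurableT_comp mr mB.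
Qed.

Lemma wasserstein2_le mu nu (P : probability (circle R * circle R)%type R) (c : R) :
  coupling mu nu P -> 0 <= c ->
  (\int[P]_z (circle_dist z.1 z.2 ^+ 2)%:E <= (c ^+ 2)%:E)%E ->
  wasserstein2 mu nu <= c.
Proof.
move=> Pc c0 Pi; rewrite /wasserstein2 -[leRHS](ger0_norm c0) -sqrtr_sqr ler_wsqrtr//.
set I := ereal_inf _.
have I0 : (0 <= I)%E.
  apply/ereal_infP => _ [Q _ <-].
  by apply: integral_ge0 => z _; rewrite lee_fin sqr_ge0.
have IC : (I <= (c ^+ 2)%:E)%E.
  by apply: le_trans Pi; apply: ereal_inf_lbound; exists P.
(* The two bounds make the infimum finite, so [fine] does not return its default value. *)
by move: I0 IC; case: I => [r| |]//=; rewrite lee_fin.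
Qed.

Lemma wasserstein2_ge0 mu nu : 0 <= wasserstein2 mu nu.
Proof. exact: sqrtr_ge0. Qed.

(** Realises the law on the probability space [circle_lebesgue], on which couplings can be built as
    distributions. Representatives lie in [-1/2, 1/2[ rather than [0, 1[, which the periodicity of
    [K] makes harmless. *)
Lemma circle_law mu (K : R -> circle R) : (forall u, K (u + 1) = K u) ->
  (forall A, measurable A -> mu A = lebesgue_measure ([set u | A (K u)] `&` `[0, 1[)) ->
  forall A, measurable A -> mu A = @circle_lebesgue R ((K \o @circle_repr R) @^-1` A).
Proof.
move=> K1 Klaw A mA; rewrite (Klaw A mA) /circle_lebesgue; congr (lebesgue_measure (_ `&` _)).
by apply/seteqP; split=> u /=; rewrite (periodic_circle_repr K1).
Qed.

Lemma integral_circle_law mu (X : circle R -> circle R) (f : circle R -> R) :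
  measurable_fun setT X ->
  (forall A, measurable A -> mu A = @circle_lebesgue R (X @^-1` A)) ->
  measurable_fun setT f ->
  (\int[@circle_lebesgue R]_p ((f (X p)) ^+ 2)%:E = sqnorm mu f)%E.
Proof.
move=> mX Xlaw mf.
rewrite /sqnorm [RHS](@integral_transfer _ _ _ _ _ (@circle_lebesgue R) mu X setT (fun=> 1))//.
- by apply: eq_integral => p _; rewrite mule1.
- move=> A mA; rewrite setTI integral_cst ?mul1e; first exact: Xlaw.
  by rewrite -[X in measurable X]setTI; exact: mX.
- by move=> p; rewrite lee_fin sqr_ge0.
- exact: measurable_sqr.
Qed.

End wasserstein_bounds.

(** * The Wasserstein estimate with a smooth approximation *)

Section gateaux.
Variable R : realType.
Variables (F : circle R -> circle R) (rho : circle R -> R) (mu : probability (circle R) R).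
Hypotheses (F_C2 : C2_map F).
Hypotheses (rho_gt0 : forall x, 0 < rho x) (rho_C1 : C1_fun rho).
Hypotheses (mu_rho : has_density mu rho) (mu_inv : invariant_measure F mu).
Variable S : branch_system F rho mu.
Local Notation leb := (@lebesgue_measure R).
Local Notation lambda := (@circle_lebesgue R).
Implicit Types (t u x y z e : R) (p : circle R).

Lemma circle_dist_shift (p : circle R) (a b : R) :
  circle_dist (p + circle_pi a) (p + circle_pi b) <= `|a - b|.
Proof.
rewrite -(circle_reprK p) -!circle_piD (le_trans (circle_dist_pi _ _))//.
by rewrite opprD addrACA subrr add0r.
Qed.

Lemma map_dist_shift : exists2 M, 0 <= M & forall (p : circle R) (a b : R),
  circle_dist (F (p + circle_pi a)) (F (p + circle_pi b)) <= M * `|a - b|.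
Proof.
have [M M0 lM] : lipschitz_fun (blift S).
  apply: derive_bounded_lipschitz (slope_bounded S) => x.
  exact: has_lip_derive_is_derive (blift_lip_derive S).
exists M => // p a b; rewrite -(circle_reprK p) -!circle_piD -!(blift_pi S).
rewrite (le_trans (circle_dist_pi _ _))// (le_trans (lM _ _))//.
by rewrite opprD addrACA subrr add0r.
Qed.

(** The order of quantifiers is what matters: [M] and [CL] are given independently of [g], while [C]
    and [t0] depend on it. In the limit [s] is fixed from [M] and [CL], then [g], and only then [t]
    tends to 0. *)
Lemma wasserstein_push_shift (v : {mfun circle R >-> R}) (g : circle R -> R) :
  (sqnorm mu v < +oo)%E -> smooth_fun g ->
  forall s : R, (sqnorm mu (fun p => v p - fun_deriv g p)%R <= s%:E)%E ->
  forall M CL, 0 <= M -> 0 < CL ->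
  (forall (p : circle R) (a b : R),
     circle_dist (F (p + circle_pi a)) (F (p + circle_pi b)) <= M * `|a - b|) ->
  (forall u : circle R -> R, measurable_fun setT u -> (sqnorm mu u < +oo)%E ->
     (sqnorm mu (deriv_op S u) <= CL%:E * sqnorm mu u)%E) ->
  exists C t0 : R, 0 < t0 /\ forall t, `|t| < t0 ->
    wasserstein2 (push (C2_map_measurable F_C2) (Defs.shift mu (t *: v)))
      (Defs.shift (push (C2_map_measurable F_C2) mu) (t *: Lop S v)) <=
    `|t| * Num.sqrt (3 * ((M ^+ 2 + CL) * s + C ^+ 2 * t ^+ 2)).
Proof.
move=> fv sg s vs M CL M0 CL0 hM hCL.
have lg := smooth_deriv_lip sg.
have mg := lipschitz_circle_measurable lg.
have fg := lipschitz_sqnorm mu lg.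
have mv := mfun_measurable v.
set w := fun_deriv g in lg mg fg vs *.
have [C [t0 [C0 t00 H]]] := perturbed_branches rho_gt0 S lg.
exists C, t0; split => // t tt0.
have [K [cK K1 Klaw Kd]] := H t tt0.
have mK : measurable_fun [set: R] (fun u => circle_pi (K u)).
  apply: measurableT_comp (@measurable_circle_pi R) _; exact: continuous_measurable_fun.
have mP : measurable_fun [set: R] (fun u => circle_pi (param S u)).
  apply: measurableT_comp (@measurable_circle_pi R) _; apply: continuous_measurable_fun.
  exact/lipschitz_continuous/param_lip.
pose X := (fun u => circle_pi (param S u)) \o @circle_repr R.
pose Z := (fun u => circle_pi (K u)) \o @circle_repr R.
have mX : measurable_fun setT X by exact: measurable_fun_pi_repr.
have mZ : measurable_fun setT Z by exact: measurable_fun_pi_repr.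
have Xlaw := circle_law (param_pi1 S) (param_law S).
have Zlaw := circle_law K1 Klaw.
have mF := C2_map_measurable F_C2.
pose f p := F (X p + circle_pi ((t *: v) (X p))).
pose h p := Z p + circle_pi ((t *: Lop S v) (Z p)).
have mf : measurable_fun setT f.
  apply: measurableT_comp mF _.
  exact: measurableT_comp (measurable_shift (t *: v)) mX.
have mh : measurable_fun setT h.
  exact: measurableT_comp (measurable_shift (t *: Lop S v)) mZ.
have mfh : measurable_fun setT (fun p => (f p, h p)) by exact/measurable_fun_pair.
pose P := distribution lambda (mfun_Sub (mem_set mfh)).
have c0 : 0 <= `|t| * Num.sqrt (3 * ((M ^+ 2 + CL) * s + C ^+ 2 * t ^+ 2)).
  by rewrite mulr_ge0.
apply: (@wasserstein2_le _ _ _ P) => //.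
  move=> A mA; split.
    transitivity (lambda (X @^-1` [set p | A (F (p + circle_pi ((t *: v) p)))])).
      by congr (lambda _); apply/seteqP; split=> p //= [].
    rewrite -Xlaw//.
    have := measurableT_comp mF (measurable_shift (t *: v)).
    by move=> /(_ measurableT A mA); rewrite setTI.
  have mA' : measurable [set p | A (p + circle_pi ((t *: Lop S v) p))].
    by have := measurable_shift (t *: Lop S v) measurableT mA; rewrite setTI.
  transitivity (lambda (Z @^-1` [set p | A (p + circle_pi ((t *: Lop S v) p))])).
    by congr (lambda _); apply/seteqP; split=> p //= [].
  (* The second marginal is a shift of the push-forward of [mu], which invariance identifies with
     [mu], the law of [Z]. *)
  by rewrite -Zlaw// -(mu_inv mA').
have s0 : 0 <= s by rewrite -lee_fin (le_trans _ vs)// sqnorm_ge0.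
(* A path of three legs: from [v] to [w] at [X], from [X] to [Z] for [w], and from [L w] to [L v] at
   [Z]; the factor 3 comes from squaring a sum of three terms. *)
have dfh p : circle_dist (f p) (h p) ^+ 2 <=
    3 * (M ^+ 2 * t ^+ 2 * (v (X p) - w (X p)) ^+ 2 +
         t ^+ 2 * (deriv_op S v (Z p) - deriv_op S w (Z p)) ^+ 2 + (C * t ^+ 2) ^+ 2).
  have d1 : circle_dist (f p) (F (X p + circle_pi (t * w (X p)))) <=
      M * (`|t| * `|v (X p) - w (X p)|).
    by apply: (le_trans (hM _ _ _)); rewrite /= -mulrBr normrM.
  have d3 : circle_dist (Z p + circle_pi (t * deriv_op S w (Z p))) (h p) <=
      `|t| * `|deriv_op S v (Z p) - deriv_op S w (Z p)|.
    by apply: (le_trans (circle_dist_shift _ _ _)); rewrite /= -mulrBr normrM distrC.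
  have d2 := Kd (circle_repr p).
  have d13 := circle_distD (f p) (F (X p + circle_pi (t * w (X p)))) (h p).
  have d23 := circle_distD (F (X p + circle_pi (t * w (X p))))
    (Z p + circle_pi (t * deriv_op S w (Z p))) (h p).
  have tt : t ^+ 2 = `|t| ^+ 2 by rewrite real_normK ?num_real.
  have aa : (v (X p) - w (X p)) ^+ 2 = `|v (X p) - w (X p)| ^+ 2.
    by rewrite real_normK ?num_real.
  have bb : (deriv_op S v (Z p) - deriv_op S w (Z p)) ^+ 2 =
      `|deriv_op S v (Z p) - deriv_op S w (Z p)| ^+ 2 by rewrite real_normK ?num_real.
  rewrite aa bb; set a := `|v _ - _| in d1 *; set b := `|deriv_op S v _ - _| in d3 *.
  have d0 := circle_dist_ge0 (f p) (h p).
  have dd : circle_dist (f p) (h p) <= M * (`|t| * a) + C * t ^+ 2 + `|t| * b.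
    apply: (le_trans d13); rewrite -addrA; apply: lerD => //.
    by apply: (le_trans d23); apply: lerD.
  apply: (@le_trans _ _ ((M * (`|t| * a) + C * t ^+ 2 + `|t| * b) ^+ 2)).
    by rewrite lerXn2r ?nnegrE// (le_trans d0).
  set T := `|t| * b; set U := M * (`|t| * a); set V := C * t ^+ 2.
  rewrite (_ : 3 * _ = 3 * (U ^+ 2 + T ^+ 2 + V ^+ 2)); last first.
    by rewrite /U /T /V tt; ring.
  have := sqr_ge0 (U - V); have := sqr_ge0 (U - T); have := sqr_ge0 (V - T).
  by clear; lra.
pose a p := v p - w p; pose b p := deriv_op S v p - deriv_op S w p.
have ma : measurable_fun setT a by exact: measurable_funB.
have mb : measurable_fun setT b by apply: measurable_funB; exact: measurable_deriv_op.
have bE : b = deriv_op S a.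
  by apply/funext => p; rewrite /a deriv_opB.
have fa : (sqnorm mu a < +oo)%E by exact: sqnorm_fin_sub.
have sb : (sqnorm mu b <= (CL * s)%:E)%E.
  rewrite bE; apply: (le_trans (hCL a ma fa)); rewrite EFinM.
  by apply: lee_wpmul2l => //; rewrite lee_fin ltW.
have maX : measurable_fun setT (fun p => (a (X p) ^+ 2)%:E).
  by apply: (@measurable_sqr R (a \o X)); exact: measurableT_comp.
have mbZ : measurable_fun setT (fun p => (b (Z p) ^+ 2)%:E).
  by apply: (@measurable_sqr R (b \o Z)); exact: measurableT_comp.
have md : measurable_fun setT (fun p => (circle_dist (f p) (h p) ^+ 2)%:E).
  exact: (measurableT_comp (@measurable_circle_distsq R) mfh).
have -> : (\int[P]_z (circle_dist z.1 z.2 ^+ 2)%:E =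
    \int[lambda]_p (circle_dist (f p) (h p) ^+ 2)%:E)%E.
  rewrite (@integral_transfer _ _ _ _ _ lambda P (fun p => (f p, h p)) setT (fun=> 1))//.
  - by apply: eq_integral => p _; rewrite mule1.
  - move=> A mA; rewrite setTI integral_cst ?mul1e//.
    by have := mfh measurableT A mA; rewrite setTI.
  - by move=> z; rewrite lee_fin sqr_ge0.
  - exact: measurable_circle_distsq.
have t20 : 0 <= t ^+ 2 by exact: sqr_ge0.
pose A0 := 3 * (M ^+ 2 * t ^+ 2); pose B0 := 3 * t ^+ 2; pose C1 := 3 * (C * t ^+ 2) ^+ 2.
have A00 : 0 <= A0 by rewrite mulr_ge0// mulr_ge0// sqr_ge0.
have B00 : 0 <= B0 by rewrite mulr_ge0.
have C10 : 0 <= C1 by rewrite mulr_ge0// sqr_ge0.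
apply: (@le_trans _ _ (\int[lambda]_p ((A0%:E * (a (X p) ^+ 2)%:E +
    B0%:E * (b (Z p) ^+ 2)%:E) + C1%:E))%E).
  apply: ge0_le_integral => //.
  - by move=> p _; rewrite lee_fin sqr_ge0.
  - by do 2?[apply: emeasurable_funD => //]; apply: emeasurable_funM.
  - move=> p _; rewrite -!EFinM -!EFinD lee_fin (le_trans (dfh p))//.
    by rewrite /a /b /A0 /B0 /C1 le_eqVlt; apply/orP; left; apply/eqP; ring.
have nn p : (0 <= (a (X p) ^+ 2)%:E)%E by rewrite lee_fin sqr_ge0.
have nn' p : (0 <= (b (Z p) ^+ 2)%:E)%E by rewrite lee_fin sqr_ge0.
rewrite ge0_integralD//; first last.
- by apply: emeasurable_funD; apply: emeasurable_funM.
- by move=> p _; rewrite adde_ge0// mule_ge0// lee_fin.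
rewrite ge0_integralD//; first last.
- by apply: emeasurable_funM.
- by move=> p _; rewrite mule_ge0// lee_fin.
- by apply: emeasurable_funM.
- by move=> p _; rewrite mule_ge0// lee_fin.
rewrite !ge0_integralZl//; rewrite ?lee_fin//.
rewrite (integral_circle_law mX Xlaw ma) (integral_circle_law mZ Zlaw mb).
rewrite integral_cst//= (_ : lambda setT = 1%E) ?mule1; last exact: probability_setT.
apply: (@le_trans _ _ (A0%:E * s%:E + B0%:E * (CL * s)%:E + C1%:E)%E).
  by apply: leeD => //; apply: leeD; apply: lee_wpmul2l.
rewrite -!EFinM -!EFinD lee_fin exprMn sqr_sqrtr; last first.
  by rewrite mulr_ge0// addr_ge0// mulr_ge0 ?sqr_ge0// addr_ge0 ?sqr_ge0// ltW.
rewrite real_normK ?num_real// /A0 /B0 /C1.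
by rewrite le_eqVlt; apply/orP; left; apply/eqP; ring.
Qed.

End gateaux.

(** * Passage to the limit and assembly *)

Section conclusion.
Variable R : realType.
Variables (F : circle R -> circle R) (rho : circle R -> R) (mu : probability (circle R) R).
Hypotheses (F_C2 : C2_map F).
Hypotheses (rho_gt0 : forall x, 0 < rho x) (rho_C1 : C1_fun rho).
Hypotheses (mu_rho : has_density mu rho) (mu_inv : invariant_measure F mu).
Variable S : branch_system F rho mu.
Local Notation mF := (C2_map_measurable F_C2).
Implicit Types (t e : R) (u v : {mfun circle R >-> R}).

Lemma wasserstein_push_shift_cvg v : L20 mu v ->
  (fun t : R => wasserstein2 (push mF (Defs.shift mu (t *: v)))
                             (Defs.shift (push mF mu) (t *: Lop S v)) / t) @ 0^' --> 0.
Proof.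
move=> /L20P[fv hv].
have [M M0 hM] := map_dist_shift S.
have [CL CL0 hCL] := sqnorm_deriv_op F_C2 rho_gt0 rho_C1 mu_rho S.
apply/cvgrPdist_lt => e e0.
have e20 : 0 < e ^+ 2 by rewrite exprn_gt0.
have D0 : 0 < 6 * (M ^+ 2 + CL) by rewrite mulr_gt0// ltr_wpDl ?sqr_ge0.
(* Chosen so that the part of the bound due to the approximation by [g] is half of [e ^+ 2]. *)
pose s := e ^+ 2 / (6 * (M ^+ 2 + CL)).
have s0 : 0 < s by rewrite divr_gt0.
have sE : 3 * ((M ^+ 2 + CL) * s) = e ^+ 2 / 2.
  have D1 : M ^+ 2 + CL != 0 by rewrite gt_eqF// ltr_wpDl ?sqr_ge0.
  by rewrite /s; field.
have [g sg gs] := hv s s0.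
have [C [t0 [t00 H]]] :=
  wasserstein_push_shift F_C2 rho_gt0 mu_inv fv sg (ltW gs) M0 CL0 hM hCL.
near=> t.
have tn0 : t != 0 by near: t; exact: nbhs_dnbhs_neq.
have tt0 : `|t| < t0 by near: t; exact: dnbhs0_lt.
(* This gives [3 * C ^+ 2 * t ^+ 2 < e ^+ 2 / 3], within the remaining half; the added 1 covers the
   case [C = 0]. *)
have tC : `|t| < e / (3 * (`|C| + 1)).
  near: t; apply: dnbhs0_lt; rewrite divr_gt0// mulr_gt0// ltr_wpDl.
have t1 : 0 < `|t| by rewrite normr_gt0.
rewrite sub0r normrN normrM normfV ltr_pdivrMr// ger0_norm ?wasserstein2_ge0//.
apply: (le_lt_trans (H t tt0)); rewrite mulrC ltr_pM2r//.
rewrite -[ltRHS]ger0_norm ?(ltW e0)// -sqrtr_sqr ltr_sqrt//.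
rewrite mulrDr sE.
have C1 : 0 < 3 * (`|C| + 1) by rewrite mulr_gt0// ltr_wpDl.
move: tC; rewrite ltr_pdivlMr// => tC.
have tC' : `|t| * (3 * `|C|) < e.
  by apply: le_lt_trans tC; rewrite !ler_wpM2l// lerDl.
have : (`|t| * (3 * `|C|)) ^+ 2 < e ^+ 2 by rewrite ltrXn2r ?nnegrE ?mulr_ge0 ?(ltW e0).
rewrite !exprMn !real_normK ?num_real// => h.
have := sqr_ge0 (C * t); rewrite exprMn; lra.
Unshelve. all: by end_near. Qed.

Lemma measurable_set1_circle (x : circle R) : measurable [set x].
Proof.
rewrite (_ : [set x] = @circle_repr R @^-1` [set circle_repr x]).
  by rewrite -[X in measurable X]setTI; apply: measurable_circle_repr => //; exact: measurable_set1.
apply/seteqP; split=> [y -> //|y /= xy].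
by rewrite -(circle_reprK y) xy circle_reprK.
Qed.

Lemma atomless_density : atomless mu.
Proof.
move=> x; rewrite (density_integral rho_gt0 rho_C1 mu_rho (measurable_set1_circle x)).
pose y := circle_repr x; pose z := y - (Num.floor y)%:~R.
have zx : circle_pi z = x by rewrite /z -intrN circle_piDz circle_reprK.
rewrite (_ : _ `&` _ = [set z]); first exact: integral_set1.
apply/seteqP; split=> [a /=|a ->].
  rewrite in_itv /= => -[/andP[a0 a1]]; rewrite -zx => /circle_pi_eq /intrP[k ak].
  have /andP[z0] := floor_itv y; rewrite intrD => z1.
  have k0 : (k%:~R : R) < 1%:~R by move: ak; rewrite /z; lra.
  have k1 : ((-1)%:~R : R) < k%:~R by move: ak; rewrite /z intrN; lra.
  move: k0 k1; rewrite !ltr_int => k0 k1.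
  have k00 : k = 0 by lia.
  by move: ak; rewrite k00; lra.
split=> //=; rewrite in_itv /=; have /andP[z0] := floor_itv y; rewrite intrD /z => z1.
by apply/andP; split; lra.
Qed.

Lemma push_invariant A : measurable A -> push mF mu A = mu A.
Proof. exact: mu_inv. Qed.

(** Invariance identifies the two measures on measurable sets, not as functions on all sets;
    equality is therefore transported through integrals. *)
Lemma sqnorm_push (u : circle R -> R) : sqnorm (push mF mu) u = sqnorm mu u.
Proof. by apply: eq_measure_integral => A mA _; exact: push_invariant. Qed.

Lemma L20_push u : L20 mu u -> L20 (push mF mu) u.
Proof.
move=> /L20P[fu hu]; apply/L20P; split; first by rewrite sqnorm_push.
by move=> e e0; have [g sg gu] := hu e e0; exists g => //; rewrite sqnorm_push.
Qed.

Lemma Lop_continuous_linear : L20_continuous_linear mu (push mF mu) (Lop S).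
Proof.
have [C C0 hC] := sqnorm_deriv_op F_C2 rho_gt0 rho_C1 mu_rho S.
split.
- by move=> v Lv; apply: L20_push; exact: L20_Lop.
- move=> a u v /L20P[fu _] /L20P[fv _]; apply: nearW => p _ /=.
  exact: (deriv_op_linear F_C2 rho_gt0 mu_inv S a (mfun_measurable u) (mfun_measurable v) fu fv).
- move=> u /L20P[fu _] e e0.
  have sC : 0 < Num.sqrt C by rewrite sqrtr_gt0.
  exists (e / Num.sqrt C); first by rewrite divr_gt0.
  move=> v /L20P[fv _]; rewrite !L2_dist_lt ?divr_gt0// sqnorm_push.
  have mu' := mfun_measurable u; have mv := mfun_measurable v.
  have -> : (fun p => Lop S u p - Lop S v p) = deriv_op S (fun p => u p - v p).
    by apply/funext => p; rewrite (deriv_opB F_C2 rho_gt0 mu_inv S mu' mv fu fv).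
  move=> h; apply: (le_lt_trans (hC _ (measurable_funB mu' mv) (sqnorm_fin_sub mu' mv fu fv))).
  move: h; have := sqnorm_ge0 mu (fun p => (u p - v p)%R).
  case: (sqnorm mu _) => [r| |]//; rewrite lte_fin => r0.
  by rewrite expr_div_n sqr_sqrtr ?(ltW C0)// ltr_pdivlMr// -EFinM lte_fin mulrC.
Qed.

End conclusion.

Theorem theorem1p3 (R : realType) (Phi : circle R -> circle R)
    (Phi_C2 : C2_map Phi) (Phi_expanding : expanding Phi)
    (rho : circle R -> R) (rho_gt0 : forall x, 0 < rho x) (rho_C1 : C1_fun rho)
    (mu : probability (circle R) R) (mu_rho : has_density mu rho)
    (mu_inv : invariant_measure Phi mu) :
  exists L : {mfun circle R >-> R} -> {mfun circle R >-> R},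
    is_gateaux_derivative (push (C2_map_measurable Phi_C2)) mu L /\
    exists A : {mfun circle R >-> R} -> {mfun circle R >-> R},
      is_adjoint mu mu L A /\
      forall u, L20 mu u -> forall x, A u x = map_deriv Phi x * u (Phi x).
Proof.
have [S] := branch_system_exists Phi_C2 Phi_expanding rho_gt0 rho_C1 mu_rho mu_inv.
have mu_atomless := atomless_density rho_gt0 rho_C1 mu_rho.
exists (Lop S); split.
  split => //.
  - move=> x; rewrite push_invariant//; exact: measurable_set1_circle.
  - exact: Lop_continuous_linear.
  - by move=> v; exact: wasserstein_push_shift_cvg.
exists (Aop Phi_C2 S); split=> //; split.
  by move=> u; exact: L20_Aop.
by move=> u v; exact: Lop_adjoint.
Qed.
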